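(* Let $P\in(0,\infty)$. The $P$-periodic Whitham kernel $K_P$ is given by $$K_P(x)=\frac1\pi\sum_{n=1}^\infty\int_{\frac{(2n-1)\pi}2}^{n\pi}\frac{\cosh\!\big(s\,(x-\frac P2-P\lfloor\frac xP\rfloor)\big)}{\sinh(\frac P2 s)}\sqrt{\frac{|\tan s|}s}\,ds$$ for $x\in\mathbb R\setminus P\mathbb Z$. Hence, $K_P$ is smooth in $\mathbb R\setminus P\mathbb Z$ and completely monotone on $(0,P/2)$. In particular, it is positive, strictly decreasing on $(0,P/2)$, and convex on $(0,P)$.
   Context: $m(\xi)=\sqrt{\tanh(\xi)/\xi}$ (with $m(0)=1$), and $K=\mathcal F^{-1}m$, i.e. $K(x)=\frac1{2\pi}\int_{\mathbb R}m(\xi)e^{ix\xi}\,d\xi$ (inverse Fourier transform of tempered distributions), regarded as an even function on $\mathbb R\setminus\{0\}$, where it is smooth and exponentially decaying at infinity. The periodised kernel is $K_P(x)=\sum_{n\in\mathbb Z}K(x+nP)$. A function $g$ is completely monotone on an open interval $I$ if it is $C^\infty$ there and $(-1)^ng^{(n)}\ge0$ on $I$ for all integers $n\ge0$. *)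

(* Defs.v *)
From HB Require Import structures.
From mathcomp Require Import all_boot all_order all_algebra.
From mathcomp Require Import complex.
From mathcomp Require Import all_classical all_reals all_analysis.

Set Implicit Arguments.
Unset Strict Implicit.
Unset Printing Implicit Defensive.

Import Order.TTheory GRing.Theory Num.Theory.
Import numFieldNormedType.Exports.

Local Open Scope classical_set_scope.
Local Open Scope ring_scope.

Section Smooth.
Context {R : realType}.
Implicit Types (D : set R) (f : R -> R).

(* Meant for open D: there the value of f^`(n) depends only on f near the
   point, although f^`(n) is formed from the total function f. *)
Definition smooth_on D f :=
  forall (n : nat) (x : R), D x -> derivable (derive1n n f) x 1.

Definition completely_monotone D f :=
  smooth_on D f /\
  forall (n : nat) (x : R), D x -> 0 <= (-1) ^+ n * derive1n n f x.

Definition schwartz f :=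
  smooth_on setT f /\
  forall k n : nat, exists C : R,
    forall x : R, `|x ^+ k * derive1n n f x| <= C.

End Smooth.

Section InverseFourier.
Context {R : realType}.
Local Notation mu := (@lebesgue_measure R).
Implicit Types (f phi : R -> R[i]).

Definition cintegrable f :=
  mu.-integrable setT (EFin \o (fun x => complex.Re (f x))) /\
  mu.-integrable setT (EFin \o (fun x => complex.Im (f x))).

Definition cintegral f : R[i] :=
  Complex (\int[mu]_x complex.Re (f x)) (\int[mu]_x complex.Im (f x)).

Definition cschwartz phi :=
  schwartz (fun x => complex.Re (phi x)) /\ schwartz (fun x => complex.Im (phi x)).

Definition expi (t : R) : R[i] := Complex (cos t) (sin t).

Definition inv_fourier phi (xi : R) : R[i] :=
  real_complex R (2 * pi)^-1 * cintegral (fun x => phi x * expi (x * xi)).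

(* The tempered distribution F^-1 m, phi |-> <m, F^-1 phi>, is given by
   integration against the function K. *)
Definition is_inv_fourier_tempered (m K : R -> R) :=
  forall phi, cschwartz phi ->
    cintegrable (fun x => real_complex R (K x) * phi x) /\
    cintegral (fun x => real_complex R (K x) * phi x) =
    cintegral (fun xi => real_complex R (m xi) * inv_fourier phi xi).

End InverseFourier.

Section Whitham.
Context {R : realType}.
Implicit Types (K : R -> R) (P x : R).

Definition sinh x : R := (expR x - expR (- x)) / 2.
Definition cosh x : R := (expR x + expR (- x)) / 2.
Definition tanh x : R := sinh x / cosh x.

Definition whitham_symbol (xi : R) : R :=
  if xi == 0 then 1 else Num.sqrt (tanh xi / xi).

(* A distribution determines a function only almost everywhere; continuity
   away from 0 fixes every value of K except the irrelevant K 0. Evenness,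
   smoothness and exponential decay are consequences and are not assumed. *)
Definition whitham_kernel K :=
  is_inv_fourier_tempered whitham_symbol K /\
  forall x, x != 0 -> {for x, continuous K}.

(* The sum of K (x + n P) over n in Z, as the part with n >= 0 plus the part
   with n < 0. *)
Definition periodised K P x : R :=
  limn (series (fun n : nat => K (x + n%:R * P))) +
  limn (series (fun n : nat => K (x - n.+1%:R * P))).

Definition off_lattice P : set R := [set x | forall n : int, x != n%:~R * P].

End Whitham.

(* Main.v *)
Require Import Defs.
From HB Require Import structures.
From mathcomp Require Import all_boot all_order all_algebra.
From mathcomp Require Import complex zify ring lra.
From mathcomp Require Import all_classical all_reals all_analysis measurable_realfun.

Set Implicit Arguments.
Unset Strict Implicit.
Unset Printing Implicit Defensive.

Import Order.TTheory GRing.Theory Num.Theory.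
Import numFieldNormedType.Exports.

Local Open Scope classical_set_scope.
Local Open Scope ring_scope.

(* For xi <> 0 the symbol has the Stieltjes representation
     pi * sqrt (tanh xi / xi) = \int weight s * 2 s / (s^2 + xi^2) ds,
   where weight s = sqrt (|tan s| / s) on the intervals where tan is negative
   and 0 elsewhere. At finite level N, the function
   tanh x * (1 + cosh (x/N)) / sinh (x/N) + c is, by Chebyshev polynomials, a
   rational function of cosh (x/N) with explicit poles and with the zeros
   cos (s_k/N), one s_k in each branch of tan. The logarithm of its product
   formula, integrated over v with c = 2 N v^2 by means of
   \int_0^oo ln ((a^2 + v^2) / (b^2 + v^2)) dv = pi (a - b), is a discrete
   version of the representation, and N tends to infinity.
   As 2 s / (s^2 + xi^2) is the Fourier transform of exp (-s |x|), the kernel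
   is pi^-1 \int weight s * exp (-s |x|) ds; Gaussian test functions suffice
   to see this, since the kernel is continuous off 0. Summing the geometric
   series exp (-s n P) gives the formula for K_P, which on (0, P) is
   F x + F (P - x) with F the Laplace transform of a nonnegative function;
   all the other claims follow from this. *)

(** An integral representation of a square root is usually read off from the jump across a branch
    cut. Here it comes from a real integral: integrating a logarithm over v produces the square
    roots, so that only logarithms of rational functions, hence finite sums, have to be handled.
    Working with polynomials at level N avoids infinite products and their convergence. The factor
    (1 + cosh t) / sinh t = coth (t/2), with t = x/N, stands in for 1/x: it makes the numerator a
    polynomial in cosh t of degree exactly N, and coth (x/(2N)) / (2N) tends to 1/x. The equation
    for the zeros becomes - tan s = 2 N v^2 tan (s/(2N)), so the zeros, as v varies, are the level
    points of [tan_ratio]; its monotonicity on each branch turns the sum over zeros into a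
    layer-cake integral. The second obstacle is that [weight] is singular at the left end of every
    branch. The integrability of weight s / s is not estimated by hand: Fatou's lemma extracts it
    from the finite identity at x = 1. It is the only size information on [weight] that the
    domination, Fubini and Laplace arguments use. *)

(** * A product formula for tanh *)

Section Chebyshev.
Context {R : realType}.
Implicit Types (n : nat) (c t : R).

(* The Chebyshev polynomials T_n and U_(n-1). *)
Fixpoint chebyshev n : {poly R} * {poly R} :=
  if n is m.+1 then
    let: (t, u) := chebyshev m in ('X * t + ('X ^+ 2 - 1) * u, t + 'X * u)
  else (1, 0).

(** The recursion of [chebyshev] is the pair of addition formulas for n t + t. The second identity
    is multiplied by sin t to avoid a division. *)
Lemma chebyshev_cos n t :
  (chebyshev n).1.[cos t] = cos (n%:R * t) /\
  (chebyshev n).2.[cos t] * sin t = sin (n%:R * t).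
Proof.
elim: n => [|n [IH1 IH2]] /=.
  by rewrite hornerE horner0 !mul0r cos0 sin0.
case: (chebyshev n) IH1 IH2 => a b /= IH1 IH2.
have -> : n.+1%:R * t = n%:R * t + t by rewrite -natr1 mulrDl mul1r.
rewrite !(hornerD, hornerN, hornerM, hornerXn, hornerX, hornerC) cosD sinD -IH1 -IH2.
have := cos2Dsin2 t; move: (cos t) (sin t) => c s cs.
have -> : c * c = 1 - s ^+ 2 by rewrite -cs addrK expr2.
by split; ring.
Qed.

Lemma coshsqr t : cosh t ^+ 2 = 1 + sinh t ^+ 2.
Proof.
rewrite /cosh /sinh; have := expRxMexpNx_1 t.
move: (expR t) (expR (- t)) => a b ab.
by rewrite !exprMn !sqrrD sqrrN mulrN ab; field.
Qed.

Lemma coshD s t : cosh (s + t) = cosh s * cosh t + sinh s * sinh t.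
Proof. by rewrite /cosh /sinh opprD !expRD; field. Qed.

Lemma sinhD s t : sinh (s + t) = sinh s * cosh t + cosh s * sinh t.
Proof. by rewrite /cosh /sinh opprD !expRD; field. Qed.

Lemma cosh0 : cosh (0 : R) = 1.
Proof. by rewrite /cosh oppr0 expR0 -[1 + 1]/(2%:R) divff. Qed.

Lemma sinh0 : sinh (0 : R) = 0.
Proof. by rewrite /sinh oppr0 subrr mul0r. Qed.

Lemma cosh_gt0 t : 0 < cosh t.
Proof. by rewrite /cosh divr_gt0// addr_gt0// expR_gt0. Qed.

Lemma sinh_gt0 t : 0 < t -> 0 < sinh t.
Proof. by move=> t0; rewrite /sinh divr_gt0// subr_gt0 ltr_expR; lra. Qed.

Lemma cosh_gt1 t : 0 < t -> 1 < cosh t.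
Proof.
move=> /sinh_gt0 s0; have := coshsqr t; have := cosh_gt0 t.
by move: (cosh t) (sinh t) s0 => a b b0 a0 e; nra.
Qed.

Lemma chebyshev_cosh n t :
  (chebyshev n).1.[cosh t] = cosh (n%:R * t) /\
  (chebyshev n).2.[cosh t] * sinh t = sinh (n%:R * t).
Proof.
elim: n => [|n [IH1 IH2]] /=.
  by rewrite hornerE horner0 !mul0r cosh0 sinh0.
case: (chebyshev n) IH1 IH2 => a b /= IH1 IH2.
have -> : n.+1%:R * t = n%:R * t + t by rewrite -natr1 mulrDl mul1r.
rewrite !(hornerD, hornerN, hornerM, hornerXn, hornerX, hornerC) coshD sinhD -IH1 -IH2.
by have := coshsqr t; rewrite expr2; move: (cosh t) (sinh t) => c s ->; split; ring.
Qed.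

(** Degree bounds and top coefficients, as needed to compute the leading coefficient of a
    combination of both polynomials. *)
Lemma chebyshev_size n :
  [/\ (size (chebyshev n.+1).1 <= n.+2)%N, (size (chebyshev n.+1).2 <= n.+1)%N,
      (chebyshev n.+1).1`_n.+1 = 2 ^+ n & (chebyshev n.+1).2`_n = 2 ^+ n].
Proof.
elim: n => [|n].
  rewrite /= !mulr0 mulr1 !addr0 size_polyX size_polyC oner_eq0.
  by rewrite expr0; split; rewrite ?coefX ?coef1.
have -> : chebyshev n.+2 = (let: (t, u) := chebyshev n.+1 in
  ('X * t + ('X ^+ 2 - 1) * u, t + 'X * u)) by [].
case: (chebyshev n.+1) => a b [/= sa sb ca cb].
have -> : 'X * a + ('X^2 - 1) * b = ('X * a + 'X * ('X * b)) - b.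
  by rewrite mulrA -expr2; ring.
have bn : b`_n.+2 = 0 by apply: nth_default; rewrite (leq_trans sb).
have an : a`_n.+2 = 0 by apply: nth_default.
split.
- apply: (leq_trans (size_polyD _ _)); rewrite geq_max size_polyN.
  apply/andP; split; last by rewrite (leq_trans sb)// ltnW// ltnW.
  apply: (leq_trans (size_polyD _ _)); rewrite geq_max.
  rewrite -!commr_polyX !(leq_trans (size_polyMleq _ _))// ?size_polyX ?addn2//=.
  rewrite ltnS (leq_trans (size_polyMleq _ _))// size_polyX addn2/=.
  by rewrite ltnS.
- apply: (leq_trans (size_polyD _ _)); rewrite geq_max sa.
  by rewrite -!commr_polyX !(leq_trans (size_polyMleq _ _))// size_polyX addn2.
- by rewrite coefB !coefD !coefXM/= ca cb bn subr0 exprS mulrC mulr2n mulrDr mulr1.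
- by rewrite coefD coefXM/= ca cb exprS mulrC mulr2n mulrDr mulr1.
Qed.

End Chebyshev.

Section ChebyshevProduct.
Context {R : realType}.
Implicit Types (c t x : R) (phi : nat -> R).

(** cos is injective on (0, pi), so increasing angles supply n distinct roots, which exhaust a
    polynomial of degree n. *)
Lemma horner_prod_cos (p : {poly R}) n phi x :
  (size p <= n.+1)%N -> p`_n != 0 ->
  (forall k, (k < n)%N -> 0 < phi k < pi) ->
  (forall j k, (j < k < n)%N -> phi j < phi k) ->
  (forall k, (k < n)%N -> p.[cos (phi k)] = 0) ->
  p.[x] = p`_n * \prod_(k < n) (x - cos (phi k)).
Proof.
move=> sp pn phi01 phiS p0.
have szp : size p = n.+1.
  apply/eqP; rewrite eqn_leq sp ltnNge; apply/negP => sn.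
  by move/eqP: pn; apply; exact: nth_default.
pose rs := [seq cos (phi k) | k <- iota 0 n].
have srs : size rs = n by rewrite size_map size_iota.
have := @all_roots_prod_XsubC R p rs.
rewrite srs => /(_ szp) E; rewrite [in LHS]E; last 2 first.
- by apply/allP => _ /mapP[k /[!mem_iota]/= kn ->]; apply/rootP/p0.
- rewrite uniq_rootsE map_inj_in_uniq ?iota_uniq// => j k.
  rewrite !mem_iota !add0n/= => jn kn.
  have [jk|kj|//] := ltngtP j k => /cos_inj.
  + have := phiS j k; rewrite jk kn => /(_ isT) + e.
    by rewrite e ?ltxx// in_itv/= !ltW//; have/andP[] := phi01 _ jn; have/andP[] := phi01 _ kn.
  + have := phiS k j; rewrite kj jn => /(_ isT) + e.
    by rewrite e ?ltxx// in_itv/= !ltW//; have/andP[] := phi01 _ jn; have/andP[] := phi01 _ kn.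
rewrite hornerZ horner_prod big_map -{1}(subn0 n) -/(index_iota 0 n) big_mkord.
rewrite lead_coefE szp/=; congr (_ * _).
by apply: eq_bigr => k _; rewrite !hornerE.
Qed.

(* After clearing denominators both sides are polynomials in cosh t of degree
   n.+1 with the roots cos (phi k) and the same leading coefficient. *)
Lemma tanh_cot_prod n c t phi : 0 <= c -> 0 < t ->
  (forall k, (k <= n)%N -> 0 < phi k < pi) ->
  (forall j k, (j < k <= n)%N -> phi j < phi k) ->
  (forall k, (k <= n)%N -> (1 + cos (phi k)) * sin (n.+1%:R * phi k) +
     c * cos (n.+1%:R * phi k) * sin (phi k) = 0) ->
  (1 + cosh t) / sinh t * tanh (n.+1%:R * t) + c =
  (1 + c) * \prod_(k < n.+1) ((cosh t - cos (phi k)) /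
    (cosh t - cos ((2 * k%:R + 1) * pi / 2 / n.+1%:R))).
Proof.
move=> c0 t0 phi01 phiS phi0.
have [sT sU cT cU] := @chebyshev_size R n.
set T := (chebyshev n.+1).1 in sT cT; set U := (chebyshev n.+1).2 in sU cU.
(* The cosines of these angles are the zeros of T, hence the poles of the left-hand side. *)
pose psi k : R := (2 * k%:R + 1) * pi / 2 / n.+1%:R.
have n0 : 0 < n.+1%:R :> R by rewrite ltr0n.
have npsi k : n.+1%:R * psi k = (2 * k%:R + 1) * pi / 2.
  by rewrite /psi mulrC divfK// gt_eqF.
have psi0 k : 0 < psi k.
  by rewrite /psi !divr_gt0// mulr_gt0 ?pi_gt0// ltr_wpDl// mulr_ge0.
have psiS j k : (j < k)%N -> psi j < psi k.
  move=> jk; rewrite /psi !ltr_pM2r ?invr_gt0 ?pi_gt0// ltrD2r ltr_pM2l//.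
  by rewrite ltr_nat.
have psipi k : (k <= n)%N -> psi k < pi.
  move=> kn; rewrite /psi ltr_pdivrMr// ltr_pdivrMr// -mulrA mulrC ltr_pM2l ?pi_gt0//.
  have : k%:R <= n%:R :> R by rewrite ler_nat.
  by rewrite -natr1; lra.
have cos_psi k : cos (n.+1%:R * psi k) = 0.
  rewrite npsi (_ : _ / 2 = pi / 2 + pi *+ k); last first.
    by rewrite -(mulr_natr pi k); field.
  by elim: k => [|k IH]; rewrite ?mulr0n ?addr0 ?cos_pihalf// [pi *+ _]mulrSr addrA cosDpi IH oppr0.
have pT x : T.[x] = 2 ^+ n * \prod_(k < n.+1) (x - cos (psi k)).
  rewrite -cT; apply: horner_prod_cos => //.
  - by rewrite cT expf_neq0.
  - by move=> k kn; rewrite psi0 psipi.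
  - by move=> j k /andP[jk _]; exact: psiS.
  - by move=> k kn; rewrite (chebyshev_cos _ _).1 cos_psi.
(* The left-hand side is Q / T at cosh t. Both summands of Q have degree n.+1, whence the leading
   coefficient 2 ^ n (1 + c). *)
pose Q := (1 + 'X) * U + c *: T.
have cQ : Q`_n.+1 = 2 ^+ n * (1 + c).
  rewrite coefD coefZ cT mulrDl mul1r coefD coefXM/= cU nth_default//.
  by rewrite add0r; ring.
have pQ x : Q.[x] = 2 ^+ n * (1 + c) * \prod_(k < n.+1) (x - cos (phi k)).
  rewrite -cQ; apply: horner_prod_cos => //.
  - apply: (leq_trans (size_polyD _ _)); rewrite geq_max.
    rewrite (leq_trans (size_scale_leq _ _))// andbT.
    apply: (leq_trans (size_polyMleq _ _)); rewrite addrC -polyC1 size_XaddC/=.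
    by rewrite ltnS.
  - by rewrite cQ mulf_neq0 ?expf_neq0// gt_eqF// ltr_wpDr.
  (* U is known at a cosine only after multiplication by the sine, which is nonzero here and can be
     cancelled. *)
  - move=> k kn; have s0 : sin (phi k) != 0.
      by rewrite gt_eqF// sin_gt0_pi// phi01.
    apply/eqP; rewrite -(mulIr_eq0 _ (mulIf s0)); apply/eqP.
    rewrite /Q hornerD hornerM hornerZ hornerD hornerX hornerC mulrDl -mulrA.
    by rewrite (chebyshev_cos _ _).2 (chebyshev_cos _ _).1 phi0.
have C1 := cosh_gt1 t0.
have Cpsi k : cosh t - cos (psi k) != 0.
  by rewrite gt_eqF// subr_gt0 (le_lt_trans (cos_le1 _)).
have T0 : T.[cosh t] != 0 by rewrite (chebyshev_cosh _ _).1 gt_eqF// cosh_gt0.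
have -> : (1 + cosh t) / sinh t * tanh (n.+1%:R * t) + c = Q.[cosh t] / T.[cosh t].
  rewrite /Q hornerD hornerM hornerZ hornerD hornerX hornerC.
  rewrite /tanh -(chebyshev_cosh _ _).1 -(chebyshev_cosh _ _).2 -/T -/U.
  by have := sinh_gt0 t0 => s0; field; rewrite T0 gt_eqF.
rewrite pQ pT prodf_div invfM [in LHS]mulrACA -mulrA.
rewrite [2 ^+ n * _]mulrC -!mulrA; congr (_ * _).
by rewrite mulrA mulfV ?mul1r// expf_neq0.
Qed.

End ChebyshevProduct.

(** * The Stieltjes representation at a finite level *)

Section DeriveCalculus.
Context {R : realType}.
Implicit Types (f g : R -> R) (x a b : R).

Lemma is_deriveW f x a b : is_derive x 1 f a -> a = b -> is_derive x 1 f b.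
Proof. by move=> + <-. Qed.

Lemma is_derive_add f g x a b : is_derive x 1 f a -> is_derive x 1 g b ->
  is_derive x 1 (fun y => f y + g y) (a + b).
Proof. by move=> df dg; exact: is_deriveD. Qed.

Lemma is_derive_sub f g x a b : is_derive x 1 f a -> is_derive x 1 g b ->
  is_derive x 1 (fun y => f y - g y) (a - b).
Proof. by move=> df dg; exact: is_deriveB. Qed.

Lemma is_derive_mul f g x a b : is_derive x 1 f a -> is_derive x 1 g b ->
  is_derive x 1 (fun y => f y * g y) (a * g x + f x * b).
Proof.
move=> df dg; have := is_deriveM df dg.
by move=> /is_deriveW; apply; rewrite /GRing.scale/= addrC mulrC.
Qed.

Lemma is_derive_inv f x a : is_derive x 1 f a -> f x != 0 ->
  is_derive x 1 (fun y => (f y)^-1) (- a / f x ^+ 2).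
Proof.
move=> df f0; have := is_deriveV f0 df.
by move=> /is_deriveW; apply; rewrite /GRing.scale/= !mulNr mulrC.
Qed.

Lemma is_derive_comp f g x a b : is_derive x 1 g b -> is_derive (g x) 1 f a ->
  is_derive x 1 (fun y => f (g y)) (a * b).
Proof. by move=> dg df; exact: is_derive1_comp. Qed.

Lemma is_derive_mulc (c x : R) : is_derive x 1 (fun y => c * y) c.
Proof.
have := is_derive_mul (is_derive_cst c x 1) (is_derive_id x 1).
by move=> /is_deriveW; apply; rewrite mul0r add0r mulr1.
Qed.

Lemma is_derive_divc (c x : R) : is_derive x 1 (fun y => y / c) c^-1.
Proof. by under eq_fun do rewrite mulrC; exact: is_derive_mulc. Qed.

Lemma is_derive_sqr x : is_derive x 1 (fun y => y ^+ 2) (2 * x).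
Proof.
under eq_fun do rewrite expr2.
have := is_derive_mul (is_derive_id x 1) (is_derive_id x 1).
by move=> /is_deriveW; apply; rewrite mul1r mulr1 mulr_natl mulr2n.
Qed.

Lemma is_derive_continuous f x a : is_derive x 1 f a -> {for x, continuous f}.
Proof. by move=> df; apply/differentiable_continuous/derivable1_diffP. Qed.

End DeriveCalculus.

Section LogIntegral.
Context {R : realType}.
Implicit Types a b v : R.

(** Integration by parts gives the primitive v ln (q v) + 2 a atan (v/a) - 2 b atan (v/b); the
    arctangents contribute pi a - pi b at infinity. *)
Lemma ge0_integral_lnD a b : 0 < b -> b <= a ->
  (\int[@lebesgue_measure R]_(v in `[0%R, +oo[)
     (ln ((a ^+ 2 + v ^+ 2) / (b ^+ 2 + v ^+ 2)))%:E = (pi * (a - b))%:E)%E.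
Proof.
move=> b0 ba; have a0 : 0 < a by exact: lt_le_trans ba.
have pos (c v : R) : 0 < c -> 0 < c ^+ 2 + v ^+ 2 
  by move=> c0; rewrite ltr_pwDl ?exprn_gt0 ?sqr_ge0.
pose q v := (a ^+ 2 + v ^+ 2) / (b ^+ 2 + v ^+ 2).
have q0 v : 0 < q v by rewrite divr_gt0 ?pos.
pose F v := v * ln (q v) + (2 * a * atan (v / a) - 2 * b * atan (v / b)).
have Dsq c v : is_derive v 1 (fun v : R => c ^+ 2 + v ^+ 2) (2 * v).
  have := is_derive_add (is_derive_cst (c ^+ 2) v 1) (is_derive_sqr v).
  by move=> /is_deriveW; apply; rewrite add0r.
have Dln v : is_derive v 1 (fun v => ln (q v))
    (2 * v / (a ^+ 2 + v ^+ 2) - 2 * v / (b ^+ 2 + v ^+ 2)).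
  have bv := pos b v b0; have av := pos a v a0.
  have Dq := is_derive_mul (Dsq a v) (is_derive_inv (Dsq b v) (lt0r_neq0 bv)).
  have := is_derive_comp Dq (is_derive1_ln (q0 v)); move=> /is_deriveW; apply.
  by rewrite /q; field; rewrite !gt_eqF.
have Datan (c v : R) : 0 < c ->
    is_derive v 1 (fun v => 2 * c * atan (v / c)) (2 * c ^+ 2 / (c ^+ 2 + v ^+ 2)).
  move=> c0; have := is_derive_comp (is_derive_divc c v) (is_derive1_atan (v / c)).
  move=> /(is_derive_mul (is_derive_cst (2 * c) v 1)); move=> /is_deriveW; apply.
  by rewrite /cst; have := pos c v c0 => cv; field; rewrite !gt_eqF.
have DF v : is_derive v 1 F (ln (q v)).
  have := is_derive_add (is_derive_mul (is_derive_id v 1) (Dln v))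
    (is_derive_sub (Datan a v a0) (Datan b v b0)).
  move=> /is_deriveW; apply; rewrite mul1r/=.
  by have av := pos a v a0; have bv := pos b v b0; field; rewrite !gt_eqF.
have cF v : {for v, continuous F} by exact: is_derive_continuous (DF v).
have lnq0 v : 0 <= ln (q v).
  rewrite ln_ge0// /q ler_pdivlMr ?pos// mul1r lerD2r.
  by rewrite ler_sqr ?nnegrE// ltW.
rewrite (@ge0_continuous_FTC2y _ (fun v => ln (q v)) F 0 (pi * (a - b))).
- by rewrite -EFinB /F mul0r !mul0r atan0 !mulr0 subrr addr0 subr0.
- by move=> v _; exact: lnq0.
- apply: continuous_subspaceT => v.
  exact: is_derive_continuous (Dln v).
- have atany (c : R) : 0 < c -> 2 * c * atan (v / c) @[v --> +oo] --> pi * c.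
    move=> c0; rewrite (_ : pi * c = 2 * c * (pi / 2)); last by field.
    apply: cvgMr; have vc : v / c @[v --> +oo] --> +oo.
      by apply: gt0_cvgMly => //; rewrite invr_gt0.
    exact: (cvg_comp (fun v => v / c) (@atan R) vc (@cvgy_atan R)).
  rewrite (_ : pi * (a - b) = 0 + (pi * a - pi * b)); last by ring.
  apply: cvgD; last by apply: cvgB; exact: atany.
  (* The boundary term v ln (q v) is O(1/v), by ln (1 + y) <= y with y = (a^2 - b^2) / (b^2 +
     v^2). *)
  apply: (@squeeze_cvgr _ _ _ _ (fun=> 0) (fun v => (a ^+ 2 - b ^+ 2) / v)).
  + near=> v.
    have v0 : 0 < v by near: v; exact: nbhs_pinfty_gt.
    rewrite mulr_ge0 ?(ltW v0)//=.
    have -> : q v = 1 + (a ^+ 2 - b ^+ 2) / (b ^+ 2 + v ^+ 2).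
      by rewrite /q; have := pos b v b0 => bv; field; rewrite gt_eqF.
    have ab2 : 0 <= a ^+ 2 - b ^+ 2 by rewrite subr_ge0 ler_sqr ?nnegrE// ltW.
    apply: le_trans (_ : v * ((a ^+ 2 - b ^+ 2) / (b ^+ 2 + v ^+ 2)) <= _).
      rewrite ler_pM2l// le_ln1Dx// (lt_le_trans (ltrN10 _))//.
      by rewrite divr_ge0// ltW ?pos.
    rewrite mulrCA ler_wpM2l// ler_pdivrMr ?pos// mulrC ler_pdivlMr//.
    by rewrite -expr2 lerDr sqr_ge0.
  + exact: cvg_cst.
  + rewrite -[X in _ --> X](mulr0 (a ^+ 2 - b ^+ 2)); apply: cvgMr.
    by apply/gtr0_cvgV0; [exact: nbhs_pinfty_gt|].
- by move=> v _; have := DF v.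
- exact/cvg_at_right_filter/cF.
- by move=> v _; rewrite derive1E; apply: derive_val.
Unshelve. all: by end_near. Qed.

End LogIntegral.

Section MeasurableElementary.
Context {R : realType}.

(** The inverse is continuous off 0, and its conventional value at 0 only concerns a measurable
    singleton. *)
Lemma measurable_inv : measurable_fun [set: R] (@GRing.inv R).
Proof.
have -> : [set: R] = ~` [set 0] `|` [set 0] by rewrite setUC setUv.
apply/measurable_funU; [exact: measurableC|exact: measurable_set1|split].
  apply: open_continuous_measurable_fun; first by rewrite openC; exact: closed_eq.
  by move=> x; rewrite inE/= => /eqP x0; exact: inv_continuous.
exact: measurable_fun_set1.
Qed.

Lemma measurable_funV d (T : measurableType d) (D : set T) (f : T -> R) :
  measurable_fun D f -> measurable_fun D (fun x => (f x)^-1).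
Proof. exact: measurableT_comp measurable_inv. Qed.

Lemma measurable_sqrt : measurable_fun [set: R] (@Num.sqrt R).
Proof. by apply: continuous_measurable_fun; exact: sqrt_continuous. Qed.

Lemma measurable_sin : measurable_fun [set: R] (@sin R).
Proof. by apply: continuous_measurable_fun; exact: continuous_sin. Qed.

Lemma measurable_cos : measurable_fun [set: R] (@cos R).
Proof. by apply: continuous_measurable_fun; exact: continuous_cos. Qed.

Lemma measurable_tan : measurable_fun [set: R] (@tan R).
Proof.
apply: measurable_funM; first exact: measurable_sin.
by apply: measurable_funV; exact: measurable_cos.
Qed.

End MeasurableElementary.

Section TanBranch.
Context {R : realType}.
Implicit Types (k : nat) (s : R).

(** Numbered from 0: this is the interior of the interval of index k.+1 in the formula for the
    periodic kernel. *)
Definition branch k : set R := `](2 * k%:R + 1) * pi / 2, k.+1%:R * pi[%classic.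

Lemma branch_gt0 k s : branch k s -> 0 < s.
Proof.
rewrite /branch/= in_itv/= => /andP[+ _]; apply: le_lt_trans.
by rewrite !mulr_ge0// ?invr_ge0// ?pi_ge0// addr_ge0// mulr_ge0.
Qed.

Lemma tanBnpi k s : tan (s - k%:R * pi) = tan s.
Proof.
elim: k => [|k IH]; first by rewrite mul0r subr0.
by rewrite -[RHS]IH -[LHS]tanDpi -(natr1 k); congr tan; ring.
Qed.

Lemma branch_shift k s : branch k s -> - (pi / 2) < s - k.+1%:R * pi < 0.
Proof.
rewrite /branch/= in_itv/= -(natr1 k) => /andP[s1 s2].
by apply/andP; split; lra.
Qed.

Lemma branch_tan_lt0 k s : branch k s -> tan s < 0.
Proof.
move=> /branch_shift/andP[s1 s2]; rewrite -(tanBnpi k.+1) -tan0.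
by rewrite ltr_tan// in_itv/=; have := @pi_gt0 R => p0; apply/andP; split; lra.
Qed.

Lemma branch_tan_incr k s t : branch k s -> branch k t -> s < t -> tan s < tan t.
Proof.
move=> /branch_shift/andP[s1 s2] /branch_shift/andP[t1 t2] st.
rewrite -(tanBnpi k.+1) -(tanBnpi k.+1 t).
have p0 := @pi_gt0 R.
by rewrite ltr_tan ?in_itv/=; [lra|apply/andP; split; lra..].
Qed.

Lemma tan_gt0_pihalf s : 0 < s < pi / 2 -> 0 < tan s.
Proof.
move=> /andP[s0 s2]; have p0 := @pi_gt0 R.
by rewrite -tan0 ltr_tan ?in_itv//=; apply/andP; split; lra.
Qed.

Lemma cosDnpi k s : cos (s + k%:R * pi) = (-1) ^+ k * cos s.
Proof.
elim: k => [|k IH]; first by rewrite mul0r addr0 expr0 mul1r.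
rewrite (_ : s + _ = s + k%:R * pi + pi) ?cosDpi ?IH ?exprS; last by rewrite -(natr1 k); ring.
by rewrite mulN1r mulNr.
Qed.

Lemma sinDnpi k s : sin (s + k%:R * pi) = (-1) ^+ k * sin s.
Proof.
elim: k => [|k IH]; first by rewrite mul0r addr0 expr0 mul1r.
rewrite (_ : s + _ = s + k%:R * pi + pi) ?sinDpi ?IH ?exprS; last by rewrite -(natr1 k); ring.
by rewrite mulN1r mulNr.
Qed.

End TanBranch.

Section TanRatio.
Context {R : realType}.
Variables (n : nat) (x : R).
Hypothesis x0 : 0 < x.
Implicit Types (k : nat) (s v : R).
Local Notation N := (n.+1%:R : R).

(* As N tends to infinity, tan_ratio s tends to |tan s| / s and
   chebyshev_kernel s to 2 s / (s^2 + x^2). *)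
Definition tan_ratio s : R := `|tan s| / (2 * N * tan (s / (2 * N))).

Definition chebyshev_kernel s : R :=
  sin (s / N) / N / (cosh (x / N) - cos (s / N)).

Let N0 : 0 < N. Proof. by rewrite ltr0n. Qed.

(** On the first N branches the half angle stays in the first quadrant, where sin, cos and tan are
    positive. *)
Lemma branch_half k s : (k <= n)%N -> branch k s -> 0 < s / (2 * N) < pi / 2.
Proof.
move=> kn bs; rewrite divr_gt0 ?(branch_gt0 bs) ?mulr_gt0//=.
move: bs; rewrite /branch/= in_itv/= => /andP[_ sk].
rewrite ltr_pdivrMr ?mulr_gt0//; apply: (lt_le_trans sk).
rewrite [leRHS](_ : _ = N * pi); last by field.
by rewrite ler_pM2r ?pi_gt0// ler_nat.
Qed.

(** On a branch |tan s| decreases to 0 while tan (s / (2 N)) increases. Hence a superlevel set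
    within a branch is an interval at its left end. *)
Lemma tan_ratio_decr k s t : (k <= n)%N -> branch k s -> branch k t -> s < t ->
  tan_ratio t < tan_ratio s.
Proof.
move=> kn bs bt st; rewrite /tan_ratio.
have /andP[s1 s2] := branch_half kn bs; have /andP[t1 t2] := branch_half kn bt.
have ts : 0 < tan (s / (2 * N)) by rewrite tan_gt0_pihalf ?s1.
have ht : tan (s / (2 * N)) < tan (t / (2 * N)).
  have p0 : - (pi / 2) < 0 :> R by rewrite oppr_lt0 divr_gt0 ?pi_gt0.
  rewrite ltr_tan ?in_itv/= ?s2 ?t2 ?andbT ?(lt_trans p0)//.
  by rewrite ltr_pM2r ?invr_gt0 ?mulr_gt0.
have D0 : 0 < 2 * N * tan (s / (2 * N)) by apply: mulr_gt0 => //; apply: mulr_gt0.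
have D1 : 2 * N * tan (s / (2 * N)) < 2 * N * tan (t / (2 * N)).
  by rewrite ltr_pM2l ?mulr_gt0.
rewrite !ltr0_norm ?(branch_tan_lt0 bs) ?(branch_tan_lt0 bt)//.
have := branch_tan_incr bs bt st; have := branch_tan_lt0 bt; have := branch_tan_lt0 bs.
move=> a b c; rewrite ltr_pdivrMr ?(lt_trans D0)// mulrAC ltr_pdivlMr//.
by nra.
Qed.

Lemma tan_ratio_root k v : (k <= n)%N -> 0 < v -> exists s, [/\ branch k s,
  tan_ratio s = v ^+ 2 &
  (1 + cos (s / N)) * sin s + (2 * N * v ^+ 2) * cos s * sin (s / N) = 0].
Proof.
move=> kn v0; have p0 := @pi_gt0 R.
pose w := 2 * N * v ^+ 2.
have w0 : 0 < w by rewrite !mulr_gt0// exprn_gt0.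
(* By the double-angle formulas the left-hand side of the equation is 2 cos (s / (2 N)) times g
   s. *)
pose g s := sin s * cos (s / (2 * N)) + w * cos s * sin (s / (2 * N)).
pose a : R := (2 * k%:R + 1) * pi / 2; pose b : R := k.+1%:R * pi.
have k0 : 0 <= k%:R :> R by [].
have kN : k%:R + 1 <= N by rewrite natr1 ler_nat.
have ab : a < b by rewrite /a /b -(natr1 k); lra.
have a0 : 0 < a by rewrite /a; nra.
have bN : b <= N * pi by rewrite /b ler_pM2r// ler_nat.
have aE : a = pi / 2 + k%:R * pi by rewrite /a; field.
have bE : b = pi + k%:R * pi by rewrite /b -(natr1 k); ring.
have ga : g a = (-1) ^+ k * cos (a / (2 * N)).
  by rewrite /g {1 3}aE sinDnpi cosDnpi sin_pihalf cos_pihalf; ring.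
have gb : g b = (-1) ^+ k * - (w * sin (b / (2 * N))).
  by rewrite /g {1 3}bE sinDnpi cosDnpi sinpi cospi; ring.
have ca : 0 < cos (a / (2 * N)).
  apply: cos_gt0_pihalf; apply/andP; split.
    by apply: lt_trans (_ : 0 < _); [lra|rewrite divr_gt0 ?mulr_gt0].
  by rewrite ltr_pdivrMr ?mulr_gt0//; lra.
have sb : 0 < sin (b / (2 * N)).
  apply: sin_gt0_pi; apply/andP; split; first by rewrite divr_gt0 ?mulr_gt0//; lra.
  by rewrite ltr_pdivrMr ?mulr_gt0//; nra.
have cg : continuous g.
  move=> s; have Dh := is_derive_divc (2 * N) s.
  have := is_derive_add
    (is_derive_mul (is_derive_sin s) (is_derive_comp Dh (is_derive_cos _)))
    (is_derive_mul (is_derive_mul (is_derive_cst w s 1) (is_derive_cos s))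
      (is_derive_comp Dh (is_derive_sin _))).
  exact: is_derive_continuous.
(* cos vanishes at a and sin at b, so one term of g survives at each end, with signs (-1)^k and
   -(-1)^k; which is positive depends on the parity of k. *)
have : Num.min (g a) (g b) <= 0 <= Num.max (g a) (g b).
  rewrite ga gb ge_min le_max; have wb : 0 < w * sin (b / (2 * N)) by rewrite mulr_gt0.
  have [->|->] : (-1 : R) ^+ k = 1 \/ (-1 : R) ^+ k = -1.
  - by rewrite -signr_odd; case: odd; rewrite ?expr1 ?expr0; [right|left].
  - by rewrite !mul1r (ltW ca) oppr_le0 (ltW wb) orbT.
  - by rewrite !mulN1r opprK (ltW wb) oppr_le0 (ltW ca) orbT.
move=> /(IVT (ltW ab) (continuous_subspaceT cg))[s].
rewrite in_itv/= => /andP[as_ sb_] gs.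
(* The root is interior because g is nonzero at both endpoints. *)
have bs : branch k s.
  rewrite /branch/= in_itv/= -/a -/b; apply/andP; split; rewrite lt_neqAle ?as_ ?sb_ andbT.
    apply/eqP => sa; move: gs; rewrite -sa ga => /eqP.
    by rewrite mulf_eq0 signr_eq0 gt_eqF.
  apply/eqP => sa; move: gs; rewrite sa gb => /eqP.
  by rewrite mulf_eq0 signr_eq0 oppr_eq0 gt_eqF// mulr_gt0.
have /andP[h0 h1] := branch_half kn bs.
have sh : 0 < sin (s / (2 * N)) by apply: sin_gt0_pi; rewrite h0/= (lt_trans h1)//; lra.
have ch : 0 < cos (s / (2 * N)) by apply: cos_gt0_pihalf; rewrite h1 andbT (lt_trans _ h0)//; lra.
have cs : cos s != 0.
  by apply/eqP => cs0; have := branch_tan_lt0 bs; rewrite /tan cs0 invr0 mulr0 ltxx.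
exists s; split => //.
  rewrite /tan_ratio ltr0_norm ?(branch_tan_lt0 bs)// /tan.
  have -> : sin s = - (w * cos s * sin (s / (2 * N)) / cos (s / (2 * N))).
    apply: (mulIf (lt0r_neq0 ch)); rewrite mulNr divfK ?gt_eqF//.
    by apply/eqP; rewrite -addr_eq0; apply/eqP.
  by rewrite /w; field; rewrite cs !gt_eqF.
rewrite (_ : s / N = (s / (2 * N)) *+ 2); last by rewrite -[_ *+ 2]mulr_natr; field.
rewrite cos_mulr2n sin_mulr2n; rewrite -/w.
transitivity (2 * cos (s / (2 * N)) * g s); last by rewrite gs mulr0.
by rewrite /g; ring.
Qed.

End TanRatio.

Lemma mem_set_itv {R : realType} (i : interval R) (v : R) :
  (v \in [set` i]) = (v \in i).
Proof. by apply/idP/idP => [/set_mem|/mem_set]. Qed.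

Lemma ln_prod {R : realType} (n : nat) (F : 'I_n -> R) : (forall i, 0 < F i) ->
  ln (\prod_(i < n) F i) = \sum_(i < n) ln (F i).
Proof.
move=> F0; have [] // : 0 < \prod_(i < n) F i /\
  ln (\prod_(i < n) F i) = \sum_(i < n) ln (F i).
elim/big_rec2: _ => [|i y z _ [z0 zy]]; first by rewrite ln1.
by rewrite mulr_gt0// lnM ?posrE// zy.
Qed.

Section LayerCake.
Context {R : realType}.
Variables (n : nat) (x : R).
Hypothesis x0 : 0 < x.
Implicit Types (k : nat) (s v : R).
Local Notation N := (n.+1%:R : R).
Local Notation mu := (@lebesgue_measure R).
Local Notation f := (tan_ratio n).
Local Notation kappa := (chebyshev_kernel n x).

Let N0 : 0 < N. Proof. by rewrite ltr0n. Qed.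
Let t0 : 0 < x / N. Proof. by rewrite divr_gt0. Qed.

Let C_cos s : 0 < cosh (x / N) - cos s.
Proof. by rewrite subr_gt0 (le_lt_trans (cos_le1 _))// cosh_gt1. Qed.

Lemma chebyshev_kernel_ge0 k s : (k <= n)%N -> branch k s -> 0 <= kappa s.
Proof.
move=> kn bs; have /andP[h0 h1] := branch_half kn bs.
rewrite /chebyshev_kernel !mulr_ge0 ?invr_ge0 ?(ltW N0) ?(ltW (C_cos _))//.
rewrite sin_ge0_pi// (_ : s / N = 2 * (s / (2 * N))); last by field.
by move: (s / (2 * N)) h0 h1 => h h0 h1; apply/andP; split; lra.
Qed.

Lemma measurable_chebyshev_kernel : measurable_fun [set: R] kappa.
Proof.
have mN : measurable_fun [set: R] (fun s => s / N) by exact: mulrr_measurable.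
apply: measurable_funM.
  by apply: measurable_funM => //; exact: measurableT_comp measurable_sin mN.
apply: measurable_funV; apply: measurable_funB => //.
exact: measurableT_comp measurable_cos mN.
Qed.

Lemma measurable_tan_ratio : measurable_fun [set: R] f.
Proof.
apply: measurable_funM; first by apply: measurableT_comp => //; exact: measurable_tan.
apply: measurable_funV; apply: measurable_funM => //.
apply: measurableT_comp; first exact: measurable_tan.
exact: mulrr_measurable.
Qed.

Lemma measurable_branch k : measurable (branch k : set R).
Proof. exact: measurable_itv. Qed.

(** This is where [chebyshev_kernel] comes from: it is the logarithmic derivative in s of one factor
    of the product formula. *)
Lemma is_derive_ln_kernel s :
  is_derive s 1 (fun s => ln (cosh (x / N) - cos (s / N))) (kappa s).
Proof.
have D := is_derive_sub (is_derive_cst (cosh (x / N)) s 1)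
  (is_derive_comp (is_derive_divc N s) (is_derive_cos (s / N))).
have := is_derive_comp D (is_derive1_ln (C_cos _)).
move=> /is_deriveW; apply; rewrite /chebyshev_kernel/=.
by have := C_cos (s / N) => C0; field; rewrite !gt_eqF.
Qed.

Lemma continuous_kernel : continuous kappa.
Proof.
move=> s; apply: cvgM.
  apply: cvgM; last exact: cvg_cst.
  apply: continuous_comp; last exact: continuous_sin.
  by apply: cvgM; [exact: cvg_id|exact: cvg_cst].
apply: cvgV; first by rewrite gt_eqF.
apply: cvgB; first exact: cvg_cst.
apply: continuous_comp; last exact: continuous_cos.
by apply: cvgM; [exact: cvg_id|exact: cvg_cst].
Qed.

Lemma integral_kernel a b : a < b ->
  (\int[mu]_(s in `]a, b[) (kappa s)%:E =
   (ln ((cosh (x / N) - cos (b / N)) / (cosh (x / N) - cos (a / N))))%:E)%E.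
Proof.
move=> ab; rewrite -(@integral_itv_bndoo _ _ _ _ true false); last first.
  by apply/measurable_EFinP; apply: measurable_funTS; exact: measurable_chebyshev_kernel.
pose F s := ln (cosh (x / N) - cos (s / N)).
have cF : continuous F by move=> s; exact: is_derive_continuous (is_derive_ln_kernel s).
rewrite (@continuous_FTC2 _ _ F)//.
- by rewrite -EFinB ln_div// posrE.
- by apply: continuous_subspaceT; exact: continuous_kernel.
- split => [s _||]; first by have := is_derive_ln_kernel s.
    exact/cvg_at_right_filter/cF.
  exact/cvg_at_left_filter/cF.
- by move=> s _; rewrite derive1E; have D := is_derive_ln_kernel s; exact: derive_val.
Qed.

(* Integrating over v first gives sqrt (tan_ratio s), integrating over s first
   gives the logarithm of one factor of the product formula. *)
Definition layer k (z : R * R) : R := \1_(branch k) z.1 * kappa z.1 *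
  (if (0 < z.2) && (z.2 ^+ 2 < f z.1) then 1 else 0).

Lemma layer_ge0 k z : (k <= n)%N -> 0 <= layer k z.
Proof.
move=> kn; rewrite /layer; apply: mulr_ge0; last by case: ifP.
rewrite indicE; case: (boolP (_ \in _)) => [/set_mem bz|_]; last by rewrite mul0r.
by rewrite mul1r (chebyshev_kernel_ge0 kn).
Qed.

Lemma measurable_layer k : measurable_fun [set: R * R] (layer k).
Proof.
apply: measurable_funM.
  apply: measurable_funM.
    apply: measurableT_comp; last exact: measurable_fst.
    by apply: measurable_indic; exact: measurable_branch.
  by apply: measurableT_comp; [exact: measurable_chebyshev_kernel|exact: measurable_fst].
apply: measurable_fun_ifT => //; apply: measurable_and.
  by apply: measurable_fun_ltr => //; exact: measurable_snd.
apply: measurable_fun_ltr.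
  by apply: measurable_funX; exact: measurable_snd.
by apply: measurableT_comp; [exact: measurable_tan_ratio|exact: measurable_fst].
Qed.

Lemma integral_layer_v k s : (k <= n)%N ->
  (\int[mu]_v (layer k (s, v))%:E = (\1_(branch k) s * kappa s * Num.sqrt (f s))%:E)%E.
Proof.
move=> kn; rewrite /layer/=.
have k0 : 0 <= \1_(branch k) s * kappa s.
  rewrite indicE; case: (boolP (_ \in _)) => [/set_mem bz|_]; last by rewrite mul0r.
  by rewrite mul1r (chebyshev_kernel_ge0 kn).
transitivity (\int[mu]_v ((\1_(branch k) s * kappa s)%:E *
    (\1_(`]0, Num.sqrt (f s)[%classic : set R) v)%:E))%E.
  apply: eq_integral => v _; rewrite -EFinM; congr (_ * _)%:E.
  rewrite indicE mem_set_itv in_itv/=; have [v0|v0] := ltP 0 v => //=.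
  (* The two conditions on v say that v lies in ]0, sqrt (f s)[, which is also right when f s <= 0,
     since the root is then 0. *)
  have [f0|f0] := leP (f s) 0.
    rewrite ler0_sqrtr// (ltNge v) (ltW v0)/= ifF//.
    by apply/negbTE; rewrite -leNgt (le_trans f0)// sqr_ge0.
  by rewrite -{2}(ger0_norm (ltW v0)) -sqrtr_sqr ltr_sqrt//; case: ifP.
rewrite ge0_integralZl_EFin//; last first.
  by apply/measurable_EFinP; apply: measurable_indic.
rewrite integral_indic// setIT/= lebesgue_measure_itv/= lte_fin -EFinB subr0.
case: ltP => [_|]; first by rewrite -EFinM.
by rewrite le_eqVlt ltNge sqrtr_ge0 orbF => /eqP ->; rewrite mulr0 mule0.
Qed.

(** Since f decreases on the branch, the condition v^2 < f r cuts out the part of the branch to the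
    left of s. *)
Lemma integral_layer_s k s v : (k <= n)%N -> 0 < v -> branch k s -> f s = v ^+ 2 ->
  (\int[mu]_r (layer k (r, v))%:E =
   (ln ((cosh (x / N) - cos (s / N)) /
        (cosh (x / N) - cos ((2 * k%:R + 1) * pi / 2 / N))))%:E)%E.
Proof.
move=> kn v0 bs fs.
have /andP[as_ sb] : (2 * k%:R + 1) * pi / 2 < s < k.+1%:R * pi.
  by move: bs; rewrite /branch/= in_itv.
rewrite -integral_kernel// [RHS]integral_mkcond; apply: eq_integral => r _.
rewrite /layer/= v0/= patchE indicE (mem_set_itv `](_ / 2), s[) in_itv/=.
case: (boolP (_ \in _)) => [/set_mem br|nbr].
  have /andP[-> _] : (2 * k%:R + 1) * pi / 2 < r < k.+1%:R * pi.
    by move: br; rewrite /branch/= in_itv.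
  rewrite mul1r/= -fs; have [rs|sr|->] := ltgtP r s.
  - by rewrite (tan_ratio_decr kn br bs rs) mulr1.
  - by rewrite ltNge (ltW (tan_ratio_decr kn bs br sr)) mulr0.
  - by rewrite ltxx mulr0.
rewrite !mul0r; case: ifP => // /andP[ar rs]; exfalso; move/negP: nbr; apply.
by rewrite inE /branch/= in_itv/= ar (lt_trans rs).
Qed.

(** The logarithm of the product formula. The bound 1 <= A falls out of it and is what
    [ge0_integral_lnD] requires. *)
Lemma sum_integral_layer v : 0 < v ->
  let A := (1 + cosh (x / N)) / sinh (x / N) * tanh x in
  (\sum_(k < n.+1) \int[mu]_r (layer k (r, v))%:E =
    (ln ((A / (2 * N) + v ^+ 2) / ((2 * N)^-1 + v ^+ 2)))%:E)%E /\ 1 <= A.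
Proof.
move=> v0 A.
have /choice[s sP] : forall k : nat, exists s, (k <= n)%N ->
    [/\ branch k s, f s = v ^+ 2 &
    (1 + cos (s / N)) * sin s + (2 * N * v ^+ 2) * cos s * sin (s / N) = 0].
  move=> k; have [kn|_] := leqP k n; last by exists 0.
  by have [s [? ? ?]] := tan_ratio_root kn v0; exists s.
have br k : (k <= n)%N -> (2 * k%:R + 1) * pi / 2 < s k < k.+1%:R * pi.
  by move=> /sP[+ _ _]; rewrite /branch/= in_itv.
have p0 := @pi_gt0 R.
(* The constant c of the product formula, scaled so that dividing A + w and 1 + w by 2 N leaves v^2
   as second summand. *)
pose w := 2 * N * v ^+ 2.
have w0 : 0 < w by rewrite !mulr_gt0// exprn_gt0.
have range k : (k <= n)%N -> 0 < s k / N < pi.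
  move=> kn; have [bs _ _] := sP k kn; rewrite divr_gt0 ?(branch_gt0 bs)//=.
  rewrite ltr_pdivrMr// mulrC; have /andP[_ ] := br k kn => /lt_le_trans; apply.
  by rewrite ler_pM2r// ler_nat.
have incr j k : (j < k <= n)%N -> s j / N < s k / N.
  move=> /andP[jk kn]; rewrite ltr_pM2r ?invr_gt0//.
  have /andP[+ _] := br k kn; apply: le_lt_trans.
  have /andP[_ /ltW] := br j (ltnW (leq_trans jk kn)); move=> /le_trans; apply.
  have : j.+1%:R <= k%:R :> R by rewrite ler_nat.
  by move=> ?; nra.
have Q k : (k <= n)%N -> (1 + cos (s k / N)) * sin (N * (s k / N)) +
     w * cos (N * (s k / N)) * sin (s k / N) = 0.
  by move=> kn; have [_ _ +] := sP k kn; rewrite (mulrC N) divfK ?gt_eqF.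
have := tanh_cot_prod (ltW w0) t0 range incr Q.
rewrite [N * (x / N)]mulrC divfK ?gt_eqF// -/A => AE.
(* The zero s k lies to the right of the pole at the left end of its branch, and cos decreases. *)
have fac1 k : (k <= n)%N -> 1 <= (cosh (x / N) - cos (s k / N)) /
    (cosh (x / N) - cos ((2 * k%:R + 1) * pi / 2 / N)).
  move=> kn; rewrite ler_pdivlMr// mul1r lerD2l lerN2.
  have /andP[sa sb] := br k kn; have /andP[s0 s1] := range k kn.
  have ks : (2 * k%:R + 1) * pi / 2 / N < s k / N by rewrite ltr_pM2r ?invr_gt0.
  have k0 : 0 <= (2 * k%:R + 1) * pi / 2 / N.
    by rewrite !mulr_ge0 ?invr_ge0 ?(ltW p0) ?(ltW N0)// addr_ge0.
  by rewrite ltW// ltr_cos// in_itv/= ?k0 ?(ltW s0) ?(ltW s1) ?(ltW (lt_trans ks s1)).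
have P1 : 1 <= \prod_(k < n.+1) ((cosh (x / N) - cos (s k / N)) /
    (cosh (x / N) - cos ((2 * k%:R + 1) * pi / 2 / N))).
  elim/big_rec: _ => // k y _ y1; have := fac1 k; rewrite -ltnS => /(_ (ltn_ord k)).
  by move=> F1; rewrite (le_trans F1)// ler_peMr// (le_trans _ F1).
split; last first.
  have : 1 + w <= A + w by rewrite AE ler_peMr// addr_ge0// ltW.
  by rewrite lerD2r.
transitivity (\sum_(k < n.+1) (ln ((cosh (x / N) - cos (s k / N)) /
    (cosh (x / N) - cos ((2 * k%:R + 1) * pi / 2 / N))))%:E)%E.
  apply: eq_bigr => k _; have kn : (k <= n)%N by rewrite -ltnS.
  by have [bs fs _] := sP k kn; exact: integral_layer_s.
rewrite sumEFin; congr (_%:E).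
have -> : (A / (2 * N) + v ^+ 2) / ((2 * N)^-1 + v ^+ 2) = (A + w) / (1 + w).
  by rewrite /w; field; rewrite -?mulrDr; rewrite !gt_eqF//= ?ltr_wpDl// ?mulr_gt0// ?exprn_gt0// ltW// mulr_gt0// ?exprn_gt0.
rewrite AE [X in ln X](_ : _ = \prod_(k < n.+1) ((cosh (x / N) - cos (s k / N)) /
    (cosh (x / N) - cos ((2 * k%:R + 1) * pi / 2 / N)))); last first.
  by rewrite mulrAC mulfV ?mul1r// gt_eqF// ltr_wpDr// ltW.
by rewrite ln_prod// => i; rewrite divr_gt0.
Qed.

(** Tonelli applied to [layer]: its nonnegativity makes the exchange possible before any
    integrability is known. *)
Lemma finite_stieltjes :
  (\sum_(k < n.+1) \int[mu]_(s in branch k) (Num.sqrt (f s) * kappa s)%:E =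
   (pi * (Num.sqrt ((1 + cosh (x / N)) / sinh (x / N) * tanh x / (2 * N))
          - Num.sqrt ((2 * N)^-1)))%:E)%E.
Proof.
set A := (1 + cosh (x / N)) / sinh (x / N) * tanh x.
have A1 : 1 <= A by have [] := sum_integral_layer (@ltr01 R).
have N20 : 0 < 2 * N by rewrite mulr_gt0.
have B0 : 0 < (2 * N)^-1 by rewrite invr_gt0.
have mL k : measurable_fun [set: R * R] (EFin \o layer k).
  by apply/measurable_EFinP; exact: measurable_layer.
have L0 (k : 'I_n.+1) z : (0 <= (EFin \o layer k) z)%E.
  by rewrite lee_fin layer_ge0// -ltnS.
transitivity (\sum_(k < n.+1) \int[mu]_v \int[mu]_s (layer k (s, v))%:E)%E.
  apply: eq_bigr => k _; have kn : (k <= n)%N by rewrite -ltnS.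
  rewrite -(@fubini_tonelli _ _ _ _ _ mu mu (EFin \o layer k) (mL k) (L0 k)).
  rewrite integral_mkcond; apply: eq_integral => s _ /=.
  rewrite integral_layer_v// patchE indicE.
  by case: ifPn => _; rewrite ?mul1r 1?mulrC// mul0r mulr0.
rewrite -ge0_integral_sum//; last 2 first.
- by move=> k; exact: (@measurable_fun_fubini_tonelli_G _ _ _ _ _ mu (EFin \o layer k) (mL k) (L0 k)).
- by move=> k v _; apply: integral_ge0 => s _; exact: (L0 k (s, v)).
rewrite -(ge0_integral_lnD (a := Num.sqrt (A / (2 * N)))); last 2 first.
- by rewrite sqrtr_gt0.
- by apply: ler_wsqrtr; rewrite -[leLHS]mul1r ler_wpM2r// ltW.
rewrite -integral_itv_obnd_cbnd; last first.
  apply/measurable_EFinP; apply: measurable_funTS.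
  apply: measurableT_comp; first exact: measurable_ln.
  by apply: measurable_funM; [|apply: measurable_funV];
    apply: measurable_funD => //; exact: measurable_funX.
rewrite [RHS]integral_mkcond; apply: eq_integral => v _.
rewrite patchE mem_set_itv in_itv/= andbT; case: ifPn => [v0|].
  rewrite (sum_integral_layer v0).1 -/A !sqr_sqrtr ?(ltW B0)//.
  by rewrite divr_ge0// ?(ltW N20)// (le_trans ler01).
rewrite -leNgt => v0; rewrite big1// => k _; rewrite integral0_eq// => s _.
by rewrite /layer/= ltNge v0 mulr0.
Qed.

End LayerCake.

(** * The Stieltjes representation of the Whitham symbol *)

Section HyperbolicDerivatives.
Context {R : realType}.
Implicit Types x : R.

Lemma is_derive_expRN x : is_derive x 1 (fun y : R => expR (- y)) (- expR (- x)).
Proof.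
have := is_derive_comp (is_deriveN (is_derive_id x 1)) (is_derive_expR (- x)).
by move=> /is_deriveW; apply; rewrite mulrN1.
Qed.

Lemma is_derive_sinh x : is_derive x 1 (@sinh R) (cosh x).
Proof.
have := is_derive_mul (is_derive_sub (is_derive_expR x) (is_derive_expRN x))
  (is_derive_cst (2^-1 : R) x 1).
by move=> /is_deriveW; apply; rewrite mulr0 addr0 opprK.
Qed.

Lemma is_derive_cosh x : is_derive x 1 (@cosh R) (sinh x).
Proof.
have := is_derive_mul (is_derive_add (is_derive_expR x) (is_derive_expRN x))
  (is_derive_cst (2^-1 : R) x 1).
by move=> /is_deriveW; apply; rewrite mulr0 addr0.
Qed.

Lemma continuous_cosh : continuous (@cosh R).
Proof. by move=> x; exact: is_derive_continuous (is_derive_cosh x). Qed.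

Lemma cvg_divn (a : R) : a / n.+1%:R @[n --> \oo] --> 0.
Proof.
rewrite -(mulr0 a); apply: cvgM; first exact: cvg_cst.
exact: (@cvg_harmonic R).
Qed.

(** The difference quotient at 0 taken along a / n.+1; a = 0 is separate because that quotient
    excludes the increment 0. *)
Lemma is_derive_cvg_scaled (f : R -> R) (d a : R) : is_derive (0 : R) 1 f d -> f 0 = 0 ->
  n.+1%:R * f (a / n.+1%:R) @[n --> \oo] --> d * a.
Proof.
move=> df f0; have [->|a0] := eqVneq a 0.
  by rewrite mulr0; under eq_fun do rewrite mul0r f0 mulr0; exact: cvg_cst.
have [+ dv] := df; rewrite /derivable -/(derive f 0 1) => D.
have {}D : h^-1 *: (f (h *: (1 : R) + 0) - f 0) @[h --> 0^'] --> d.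
  by rewrite -dv; exact: D.
have /cvgr_dnbhsP/(_ (fun n => a / n.+1%:R)) := D.
have H : (forall n, a / n.+1%:R != 0) /\ a / n.+1%:R @[n --> \oo] --> 0.
  by split; [move=> n; rewrite mulf_neq0|exact: cvg_divn].
move=> /(_ H) {}D.
rewrite mulrC; apply: cvg_trans (cvgM (cvg_cst a) D).
apply: near_eq_cvg; near=> n.
by rewrite /GRing.scale/= f0 mulr1 addr0 (subr0 (f _)) invf_div; field; rewrite a0.
Unshelve. all: by end_near. Qed.

(** tan z - z vanishes at 0 and has derivative tan^2 z. *)
Lemma ler_tan (x : R) : 0 <= x < pi / 2 -> x <= tan x.
Proof.
move=> /andP[x0 x2]; have c0 y : 0 <= y <= x -> 0 < cos y.
  move=> /andP[y0 yx]; apply: cos_gt0_pihalf; rewrite (le_lt_trans yx x2) andbT.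
  by rewrite (lt_le_trans _ y0)// oppr_lt0 divr_gt0// pi_gt0.
have D y : 0 <= y <= x -> is_derive y 1 (fun z => tan z - z) (tan y ^+ 2).
  move=> /c0 cy; have cy0 := lt0r_neq0 cy.
  have := is_derive_sub (is_derive_tan cy0) (is_derive_id y 1).
  by move=> /is_deriveW; apply; rewrite cos2_tan2// addrC addKr.
have := @ger0_derive1_ndecr R (fun z => tan z - z) 0 x _ _ _ 0 x.
rewrite tan0 subr0 subr_ge0; apply=> //.
- by move=> y; rewrite in_itv/= => /andP[/ltW y0 /ltW yx]; have [] := D y _; rewrite ?y0.
- move=> y; rewrite in_itv/= => /andP[/ltW y0 /ltW yx].
  have Dy := D y; rewrite derive1E (@derive_val _ _ _ _ _ _ _ (Dy _)) ?y0//.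
  exact: sqr_ge0.
- apply: derivable_within_continuous => y; rewrite in_itv/= => xy.
  by have [] := D y xy.
Qed.

End HyperbolicDerivatives.

Section Limit.
Context {R : realType}.
Implicit Types (n k : nat) (s x : R).

Definition branches : set R := \bigcup_k branch k.

Definition weight s : R := \1_branches s * Num.sqrt (`|tan s| / s).

Lemma measurable_branches : measurable branches.
Proof. by apply: bigcup_measurable => k _; exact: measurable_branch. Qed.

Lemma measurable_weight : measurable_fun [set: R] weight.
Proof.
apply: measurable_funM; first by apply: measurable_indic; exact: measurable_branches.
apply: measurableT_comp; first exact: measurable_sqrt.
apply: measurable_funM; last exact: measurable_funV.
by apply: measurableT_comp => //; exact: measurable_tan.
Qed.

Lemma weight_ge0 s : 0 <= weight s.
Proof. by rewrite /weight mulr_ge0// sqrtr_ge0. Qed.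

Lemma branches_gt s : branches s -> pi / 2 < s.
Proof.
move=> [k _]; rewrite /branch/= in_itv/= => /andP[+ _]; apply: le_lt_trans.
by rewrite ler_pM2r ?invr_gt0// ler_peMl ?pi_ge0// lerDr mulr_ge0.
Qed.

(** The support keeps away from 0, so divisions by s and by 1 - exp (- s P) are harmless on it. *)
Lemma weight_neq0 s : weight s != 0 -> pi / 2 < s.
Proof.
rewrite /weight indicE; case: (boolP (_ \in _)) => [/set_mem/branches_gt//|_].
by rewrite mul0r eqxx.
Qed.

Lemma branch_inj j k s : branch j s -> branch k s -> j = k.
Proof.
have H i l : branch i s -> branch l s -> (i <= l)%N.
  rewrite /branch/= !in_itv/= => /andP[s1 _] /andP[_ s2].
  rewrite leqNgt; apply/negP => li; have : l.+1%:R <= i%:R :> R by rewrite ler_nat.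
  by have := @pi_gt0 R; nra.
by move=> bj bk; apply/eqP; rewrite eqn_leq !H.
Qed.

Lemma cvg_tan_ratio s : 0 < s -> tan_ratio n s @[n --> \oo] --> `|tan s| / s.
Proof.
move=> s0; apply: cvgM; first exact: cvg_cst.
apply: cvgV; first by rewrite gt_eqF.
have c0 : cos (0 : R) != 0 by rewrite cos0.
have := is_derive_cvg_scaled (a := s / 2) (is_derive_tan c0) (@tan0 R).
rewrite cos0 expr1n invr1 mul1r => /(cvgM (cvg_cst (2 : R))).
rewrite [2 * (s / 2)]mulrC divfK//; apply: cvg_trans.
by apply: near_eq_cvg; near=> n; rewrite /= mulrA invfM (mulrA s).
Unshelve. all: by end_near. Qed.

Lemma cvg_chebyshev_kernel x s : 0 < x ->
  chebyshev_kernel n x s @[n --> \oo] --> 2 * s / (s ^+ 2 + x ^+ 2).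
Proof.
move=> x0.
have S (a : R) : n.+1%:R * sin (a / n.+1%:R) @[n --> \oo] --> a.
  have := is_derive_cvg_scaled (a := a) (is_derive_sin (0 : R)) (@sin0 R).
  by rewrite cos0 mul1r.
have H (a : R) : n.+1%:R * sinh (a / n.+1%:R) @[n --> \oo] --> a.
  have := is_derive_cvg_scaled (a := a) (is_derive_sinh (0 : R)) (@sinh0 R).
  by rewrite cosh0 mul1r.
have D : 2 * (n.+1%:R * sinh (x / 2 / n.+1%:R)) ^+ 2 +
    2 * (n.+1%:R * sin (s / 2 / n.+1%:R)) ^+ 2 @[n --> \oo] -->
    (s ^+ 2 + x ^+ 2) / 2.
  rewrite (_ : (s ^+ 2 + x ^+ 2) / 2 = 2 * (x / 2) ^+ 2 + 2 * (s / 2) ^+ 2); last by field.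
  by under eq_fun do rewrite !expr2;
    rewrite !expr2; apply: cvgD; apply: cvgM; (try exact: cvg_cst); apply: cvgM.
have sx0 : 0 < s ^+ 2 + x ^+ 2 by rewrite ltr_wpDl ?sqr_ge0// exprn_gt0.
have D0 : (s ^+ 2 + x ^+ 2) / 2 != 0 by rewrite gt_eqF// divr_gt0.
rewrite (_ : 2 * s / _ = s / ((s ^+ 2 + x ^+ 2) / 2)); last by field; rewrite gt_eqF.
apply: cvg_trans (cvgM (S s) (cvgV D0 D)).
apply: near_eq_cvg; near=> n; rewrite /chebyshev_kernel/=.
have N0 : 0 < n.+1%:R :> R by rewrite ltr0n.
have t0 : 0 < x / n.+1%:R by rewrite divr_gt0.
rewrite (_ : s / 2 / n.+1%:R = s / n.+1%:R / 2); last by rewrite mulrAC.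
rewrite (_ : x / 2 / n.+1%:R = x / n.+1%:R / 2); last by rewrite mulrAC.
(* The difference of two quantities tending to 1 becomes a sum of squares, each with an explicit
   limit after multiplication by N^2. *)
have -> : cosh (x / n.+1%:R) - cos (s / n.+1%:R) =
    2 * sinh (x / n.+1%:R / 2) ^+ 2 + 2 * sin (s / n.+1%:R / 2) ^+ 2.
  rewrite {1}(splitr (x / n.+1%:R)) {1}(splitr (s / n.+1%:R)) cosD coshD -!expr2.
  by rewrite coshsqr cos2sin2; ring.
have P0 : 0 < 2 * sinh (x / n.+1%:R / 2) ^+ 2 + 2 * sin (s / n.+1%:R / 2) ^+ 2.
  by apply: ltr_pwDl; [rewrite mulr_gt0 ?exprn_gt0 ?sinh_gt0 ?divr_gt0|rewrite mulr_ge0 ?sqr_ge0].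
move: P0 N0; move: (sinh (x / n.+1%:R / 2)) (sin (s / n.+1%:R / 2)) => a b.
move: (n.+1%:R) => N P0 N0.
rewrite (_ : 2 * (N * a) ^+ 2 + _ = N ^+ 2 * (2 * a ^+ 2 + 2 * b ^+ 2)); last by ring.
by field; rewrite !gt_eqF.
Unshelve. all: by end_near. Qed.

End Limit.

Section Stieltjes.
Context {R : realType}.
Implicit Types (n k : nat) (s x : R).
Local Notation mu := (@lebesgue_measure R).

Let upto n : set R := \bigcup_(k in `I_n.+1) branch k.

(** The integrand of [finite_stieltjes] as one function on the line, so that the limit theorems
    apply. *)
Let approx n x s : R := \1_(upto n) s * (Num.sqrt (tan_ratio n s) * chebyshev_kernel n x s).

Let measurable_upto n : measurable (upto n).
Proof. by apply: bigcup_measurable => k _; exact: measurable_branch. Qed.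

Let measurable_approx n x : 0 < x -> measurable_fun [set: R] (approx n x).
Proof.
move=> x0; apply: measurable_funM; first exact: measurable_indic.
apply: measurable_funM; last exact: measurable_chebyshev_kernel.
by apply: measurableT_comp; [exact: measurable_sqrt|exact: measurable_tan_ratio].
Qed.

Let approx_ge0 n x s : 0 < x -> 0 <= approx n x s.
Proof.
move=> x0; rewrite /approx indicE; case: (boolP (_ \in _)) => [/set_mem|_]; last by rewrite mul0r.
by move=> [k kn bs]; rewrite mul1r mulr_ge0 ?sqrtr_ge0// (chebyshev_kernel_ge0 x0 _ bs).
Qed.

Let integral_approx n x : 0 < x ->
  (\int[mu]_s (approx n x s)%:E = (pi * (Num.sqrt ((1 + cosh (x / n.+1%:R)) /
     sinh (x / n.+1%:R) * tanh x / (2 * n.+1%:R)) - Num.sqrt ((2 * n.+1%:R)^-1)))%:E)%E.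
Proof.
move=> x0; rewrite -finite_stieltjes// -(big_mkord xpredT
  (fun k => \int[mu]_(s in branch k) (Num.sqrt (tan_ratio n s) * chebyshev_kernel n x s)%:E)%E).
rewrite -(@ge0_integral_bigsetU _ _ _ mu _ (fun k => branch k)); last 5 first.
- exact: measurable_branch.
- exact: iota_uniq.
- by move=> j k _ _ [s [bj bk]]; exact: branch_inj bj bk.
- apply: measurable_funTS; apply/measurable_EFinP; apply: measurable_funM.
    by apply: measurableT_comp; [exact: measurable_sqrt|exact: measurable_tan_ratio].
  exact: measurable_chebyshev_kernel.
- move=> s; rewrite big_mkord -bigcup_mkord => -[k kn bs].
  by rewrite lee_fin mulr_ge0 ?sqrtr_ge0// (chebyshev_kernel_ge0 x0 _ bs).
rewrite big_mkord -bigcup_mkord [RHS]integral_mkcond; apply: eq_integral => s _.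
by rewrite /approx patchE indicE; case: ifPn => _; rewrite ?mul1r ?mul0r.
Qed.

Let cvg_approx x s : 0 < x ->
  approx n x s @[n --> \oo] --> weight s * (2 * s / (s ^+ 2 + x ^+ 2)).
Proof.
move=> x0; rewrite /weight /approx.
have [[k _ bs]|nb] := pselect (branches s); last first.
  rewrite indicE memNset// !mul0r.
  under eq_fun => n.
    rewrite indicE memNset ?mul0r; last by move=> [k _ bs]; apply: nb; exists k.
    over.
  exact: cvg_cst.
rewrite indicE mem_set ?mul1r; last by exists k.
have s0 := branch_gt0 bs.
have C := cvgM (continuous_cvg _ (@sqrt_continuous R _) (cvg_tan_ratio s0))
  (cvg_chebyshev_kernel (s := s) x0).
(* The indicator equals 1 as soon as n reaches the index k of the branch containing s. *)
apply: cvg_trans (C _ _); apply: near_eq_cvg; near=> n.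
rewrite indicE mem_set ?mul1r//; exists k => //=.
by near: n; exists k => // m /=; rewrite ltnS.
Unshelve. all: by end_near. Qed.

Let tan_ratio_le n k s : (k <= n)%N -> branch k s -> tan_ratio n s <= `|tan s| / s.
Proof.
move=> kn bs; have s0 := branch_gt0 bs; have /andP[h0 h1] := branch_half kn bs.
have N0 : 0 < 2 * n.+1%:R :> R by rewrite mulr_gt0.
have T0 : 0 < tan (s / (2 * n.+1%:R)) by rewrite tan_gt0_pihalf ?h0.
rewrite /tan_ratio ler_wpM2l// lef_pV2 ?posrE//; last exact: mulr_gt0.
by rewrite mulrC -ler_pdivrMr// ler_tan// h1 ltW.
Qed.

(** With h = s / (2 N), cosh >= 1 bounds the kernel by cot h / N, and h <= tan h bounds that by 1 /
    (N h) = 2 / s, uniformly in N and x. *)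
Let chebyshev_kernel_le n k x s : 0 < x -> (k <= n)%N -> branch k s ->
  chebyshev_kernel n x s <= 2 / s.
Proof.
move=> x0 kn bs; have s0 := branch_gt0 bs; have /andP[h0 h1] := branch_half kn bs.
have N0 : 0 < n.+1%:R :> R by rewrite ltr0n.
have C1 : 1 < cosh (x / n.+1%:R) by rewrite cosh_gt1// divr_gt0.
pose h := s / (2 * n.+1%:R); have p0 := @pi_gt0 R.
have sh : 0 < sin h by rewrite sin_gt0_pi// h0 (lt_trans h1)//; lra.
have ch : 0 < cos h by rewrite cos_gt0_pihalf// h1 (lt_trans _ h0)//; lra.
have th : h <= sin h / cos h by apply: ler_tan; rewrite h1 ltW.
rewrite /chebyshev_kernel (_ : s / n.+1%:R = h + h); last by rewrite /h; field; rewrite gt_eqF.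
have cE : cos (h + h) = 1 - 2 * sin h ^+ 2 by rewrite cosD -!expr2 cos2sin2; ring.
have D0 : 0 < 2 * sin h ^+ 2 by rewrite mulr_gt0// exprn_gt0.
have -> : 2 / s = (n.+1%:R * h)^-1 by rewrite /h; field; rewrite !gt_eqF.
apply: (@le_trans _ _ (sin (h + h) / n.+1%:R / (2 * sin h ^+ 2))).
  rewrite ler_wpM2l ?divr_ge0 ?(ltW N0)//.
    by rewrite sinD; nra.
  by rewrite lef_pV2 ?posrE// cE; lra.
rewrite -[leRHS]mul1r ler_pdivlMr ?mulr_gt0//.
have -> : sin (h + h) / n.+1%:R / (2 * sin h ^+ 2) * (n.+1%:R * h) = h / (sin h / cos h).
  by rewrite sinD; field; rewrite !gt_eqF.
by rewrite ler_pdivrMr ?divr_gt0// mul1r.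
Qed.

Let approx_le n x s : 0 < x -> approx n x s <= 2 * (weight s / s).
Proof.
move=> x0; rewrite /approx indicE; case: (boolP (_ \in _)) => [/set_mem|_]; last first.
  rewrite mul0r mulr_ge0//; have [->|/weight_neq0 s0] := eqVneq (weight s) 0; first by rewrite mul0r.
  by rewrite divr_ge0 ?weight_ge0// ltW// (lt_trans _ s0)// divr_gt0// pi_gt0.
move=> [k /= + bs]; rewrite ltnS => kn; rewrite mul1r [leRHS]mulrCA /weight indicE mem_set ?mul1r; last by exists k.
apply: ler_pM; first exact: sqrtr_ge0.
- exact: (chebyshev_kernel_ge0 x0 kn bs).
- by rewrite ler_wsqrtr// (tan_ratio_le kn bs).
- exact: chebyshev_kernel_le x0 kn bs.
Qed.

Let cvg_integral_approx x : 0 < x -> (\int[mu]_s (approx n x s)%:E)%E @[n --> \oo] -->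
  (pi * whitham_symbol x)%:E.
Proof.
move=> x0; rewrite /whitham_symbol gt_eqF//.
under eq_fun do rewrite integral_approx//.
apply: cvg_EFin; first exact: nearW.
apply: cvgM; first exact: cvg_cst.
rewrite -[X in _ --> X]subr0; apply: cvgB.
  apply: continuous_cvg; first exact: sqrt_continuous.
  (* Shaped after the level-N expression: 1 + 1 is the limit of 1 + cosh (x/N), and x that of N sinh
     (x/N). *)
  have -> : tanh x / x = (1 + 1) / 2 / x * tanh x by field; rewrite gt_eqF.
  have H : n.+1%:R * sinh (x / n.+1%:R) @[n --> \oo] --> x.
    have := is_derive_cvg_scaled (a := x) (is_derive_sinh (0 : R)) (@sinh0 R).
    by rewrite cosh0 mul1r.
  have C : cosh (x / n.+1%:R) @[n --> \oo] --> (1 : R).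
    rewrite -[X in _ --> X](@cosh0 R); apply: continuous_cvg; first exact: continuous_cosh.
    exact: cvg_divn.
  have T := cvgM (cvgM (cvgM (cvgD (cvg_cst (1 : R)) C) (cvg_cst (2^-1 : R)))
    (cvgV (lt0r_neq0 x0) H)) (cvg_cst (tanh x)).
  apply: cvg_trans (T _ _ _ _ _ _ _ _); apply: near_eq_cvg; near=> n.
  rewrite /= [in LHS]/GRing.add/=.
  have : 0 < sinh (x / n.+1%:R) by rewrite sinh_gt0// divr_gt0.
  move: (sinh _) (tanh x) => a b a0; have N0 : 0 < n.+1%:R :> R by rewrite ltr0n.
  by move: (n.+1%:R) (cosh _) N0 => N c N0; field; rewrite !gt_eqF.
rewrite -[X in _ --> X](@sqrtr0 R); apply: continuous_cvg; first exact: sqrt_continuous.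
apply: cvg_trans (cvg_divn (2^-1 : R)).
by apply: near_eq_cvg; near=> n; rewrite invfM.
Unshelve. all: by end_near. Qed.

Let measurable_stieltjes x :
  measurable_fun [set: R] (fun s => weight s * (2 * s / (s ^+ 2 + x ^+ 2))).
Proof.
apply: measurable_funM; first exact: measurable_weight.
apply: measurable_funM; first exact: mulrl_measurable.
by apply: measurable_funV; apply: measurable_funD => //; exact: measurable_funX.
Qed.

Lemma integrable_weight : mu.-integrable setT (fun s => (weight s / s)%:E).
Proof.
have mw : measurable_fun [set: R] (fun s => weight s / s).
  by apply: measurable_funM; [exact: measurable_weight|exact: measurable_funV].
apply/integrableP; split; first exact/measurable_EFinP.
apply: (@le_lt_trans _ _
    (\int[mu]_s (weight s * (2 * s / (s ^+ 2 + 1 ^+ 2)))%:E)%E).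
  apply: ge0_le_integral => //.
  - by apply/measurable_EFinP; apply: measurableT_comp.
  - by apply/measurable_EFinP; exact: measurable_stieltjes.
  - move=> s _; rewrite lee_fin; have [->|/weight_neq0 s1] := eqVneq (weight s) 0.
      by rewrite !mul0r normr0.
    have p2 := @pi_ge2 R; have {}s1 : 1 < s by lra.
    have s0 : 0 < s by lra.
    rewrite ger0_norm ?mulr_ge0 ?invr_ge0 ?weight_ge0 ?(ltW s0)//.
    rewrite ler_wpM2l ?weight_ge0// expr1n.
    have D0 : 0 < s ^+ 2 + 1 by rewrite ltr_wpDl// sqr_ge0.
    by rewrite ler_pdivlMr// mulrC ler_pdivrMr//; nra.
have := @fatou _ _ _ mu setT measurableT (fun n s => (approx n 1 s)%:E).
have -> : (fun s => limn_einf ((fun n s => (approx n 1 s)%:E)^~ s)) =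
    (fun s => (weight s * (2 * s / (s ^+ 2 + 1 ^+ 2)))%:E).
  apply/funext => s; apply: (fun L => (@cvg_limn_einf_sup R _ _ L).1).
  by apply: cvg_EFin; [exact: nearW|exact: cvg_approx].
rewrite (cvg_limn_einf_sup (cvg_integral_approx (@ltr01 R))).1.
move=> F; apply: (le_lt_trans (F _ _)); last exact: ltry.
- by move=> n; apply/measurable_EFinP; exact: measurable_approx.
- by move=> n s _; rewrite lee_fin approx_ge0.
Qed.

(** Both sides are even in x; for x > 0 the approximants converge under the majorant 2 weight s /
    s. *)
Lemma weight_stieltjes x : x != 0 ->
  (\int[mu]_s (weight s * (2 * s / (s ^+ 2 + x ^+ 2)))%:E = (pi * whitham_symbol x)%:E)%E.
Proof.
wlog x0 : x / 0 < x => [H|_].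
  move=> xn0; have [x0|x0] := ltP 0 x; first exact: H.
  have := H (- x); rewrite oppr_gt0 oppr_eq0 lt_neqAle xn0 x0 sqrrN => ->//.
  rewrite /whitham_symbol oppr_eq0 (negbTE xn0).
  have -> : tanh (- x) = - tanh x.
    by rewrite /tanh /sinh /cosh opprK -mulNr -mulNr opprB (addrC (expR x)).
  by rewrite invrN mulrNN.
have := @dominated_convergence _ _ _ mu setT measurableT
  (fun n s => (approx n x s)%:E) (fun s => (weight s * (2 * s / (s ^+ 2 + x ^+ 2)))%:E)
  (fun s => 2%:E * (weight s / s)%:E)%E.
case.
- by move=> n; apply/measurable_EFinP; exact: measurable_approx.
- by apply/measurable_EFinP; exact: measurable_stieltjes.
- by apply/aeW => s _; apply: cvg_EFin; [exact: nearW|exact: cvg_approx].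
- by apply: integrableZl => //; exact: integrable_weight.
- by apply/aeW => s n _; rewrite lee_fin ger0_norm ?approx_ge0// approx_le.
move=> _ _ C; exact: cvg_unique C (cvg_integral_approx x0).
Qed.

End Stieltjes.

(** * Gaussian tests of the kernel *)

Section RealFubini.
Context {R : realType}.
Local Notation mu := (@lebesgue_measure R).
Implicit Types (f : R * R -> R) (g h : R -> R).

(** The inner integrals are finite only almost everywhere, so passing to real values changes the
    iterated integrands on a null set. *)
Lemma Rintegral_Fubini f : (mu \x mu)%E.-integrable setT (EFin \o f) ->
  \int[mu]_x \int[mu]_y f (x, y) = \int[mu]_y \int[mu]_x f (x, y).
Proof.
move=> intf; have F := Fubini intf.
transitivity (fine (\int[mu]_x \int[mu]_y (f (x, y))%:E)%E).
  rewrite /Rintegral; congr fine; apply: ae_eq_integral => //.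
  - apply/measurable_EFinP; apply: (measurableT_comp (@fine_measurable R setT measurableT)).
    exact: measurable_fubini_F intf.
  - exact: measurable_fubini_F intf.
  - have := ae_integrable1 intf; apply: filterS => x ix _.
    by rewrite fineK//; exact: integrable_fin_num.
rewrite F /Rintegral; congr fine; apply: ae_eq_integral => //.
- exact: measurable_fubini_G intf.
- apply/measurable_EFinP; apply: (measurableT_comp (@fine_measurable R setT measurableT)).
  exact: measurable_fubini_G intf.
- have := ae_integrable2 intf; apply: filterS => y iy _.
  by rewrite fineK//; exact: integrable_fin_num.
Qed.

Lemma integrable_prod_bounded g h f (B : R) :
  mu.-integrable setT (EFin \o g) -> mu.-integrable setT (EFin \o h) ->
  measurable_fun setT f -> (forall z, `|f z| <= B) ->
  (mu \x mu)%E.-integrable setT (fun z => (g z.1 * h z.2 * f z)%:E).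
Proof.
move=> ig ih mf fB.
have /measurable_EFinP mg := measurable_int mu ig.
have /measurable_EFinP mh := measurable_int mu ih.
have B0 : 0 <= B by apply: le_trans (fB (0, 0)).
apply/integrable12ltyP.
  apply/measurable_EFinP; apply: measurable_funM => //; apply: measurable_funM.
    by apply: measurableT_comp => //; exact: measurable_fst.
  by apply: measurableT_comp => //; exact: measurable_snd.
have mfx x : measurable_fun setT (fun y => f (x, y)).
  exact: measurableT_comp mf (pair1_measurable x).
have [/integrableP[_ ig1] /integrableP[_ ih1]] := (ig, ih).
have ig2 : (\int[mu]_x `|g x|%:E)%E \is a fin_num.
  by rewrite ge0_fin_numE//; apply: integral_ge0 => x _; rewrite lee_fin.
have ih2 : (\int[mu]_x `|h x|%:E)%E \is a fin_num.
  by rewrite ge0_fin_numE//; apply: integral_ge0 => x _; rewrite lee_fin.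
apply: (@le_lt_trans _ _ (\int[mu]_x (`|g x|%:E * (B%:E * \int[mu]_y `|h y|%:E)))%E).
  apply: ge0_le_integral => //.
  - by move=> x _; apply: integral_ge0.
  - have := @measurable_fun_fubini_tonelli_F _ _ _ _ _ mu
      (fun z => `|(g z.1 * h z.2 * f z)%:E|%E); apply => //.
    apply: measurableT_comp => //; apply/measurable_EFinP.
    apply: measurable_funM => //; apply: measurable_funM.
      by apply: measurableT_comp => //; exact: measurable_fst.
    by apply: measurableT_comp => //; exact: measurable_snd.
  - apply: emeasurable_funM; last exact: measurable_cst.
    by apply/measurable_EFinP; exact: measurableT_comp.
  - move=> x _; rewrite -!ge0_integralZl_EFin//; last 3 first.
    + by move=> y _; rewrite mule_ge0.
    + apply: emeasurable_funM; first exact: measurable_cst.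
      by apply/measurable_EFinP; exact: measurableT_comp.
    + by apply/measurable_EFinP; exact: measurableT_comp.
    apply: ge0_le_integral => //.
    + apply: measurableT_comp => //; apply/measurable_EFinP => /=.
      by apply: measurable_funM; [apply: measurable_funM; [exact: measurable_cst|exact: mh]|exact: mfx].
    + apply: emeasurable_funM; first exact: measurable_cst.
      apply: emeasurable_funM; first exact: measurable_cst.
      by apply/measurable_EFinP; exact: measurableT_comp.
    + move=> y _; rewrite -!EFinM lee_fin !normrM -mulrA ler_wpM2l// mulrC.
      by rewrite ler_wpM2r.
rewrite -(fineK ih2) -EFinM ge0_integralZr//; last 2 first.
- by apply/measurable_EFinP; exact: measurableT_comp.
- rewrite lee_fin mulr_ge0// fine_ge0//; apply: integral_ge0 => y _.
  by rewrite lee_fin.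
by rewrite -(fineK ig2) -EFinM ltry.
Qed.

End RealFubini.

Section IntegralDerivative.
Context {R : realType}.
Local Notation mu := (@lebesgue_measure R).
Implicit Types (f F : R -> R).

Lemma integrable_scale (c : R) f : mu.-integrable setT (EFin \o f) ->
  mu.-integrable setT (EFin \o (fun x => c * f x)).
Proof. by move=> intf; apply: eq_integrable (integrableZl measurableT c intf). Qed.

Lemma integrable_add f F : mu.-integrable setT (EFin \o f) ->
  mu.-integrable setT (EFin \o F) -> mu.-integrable setT (EFin \o (fun x => f x + F x)).
Proof. by move=> intf intF; apply: eq_integrable (integrableD measurableT intf intF). Qed.

Lemma cvg_integral_itvNnn f : mu.-integrable setT (EFin \o f) ->
  \int[mu]_(x in `[- n%:R, n%:R]) f x @[n --> \oo] --> \int[mu]_x f x.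
Proof.
move=> intf; apply: fine_cvg; rewrite fineK; last exact: integrable_fin_num.
have /measurable_EFinP mf := measurable_int mu intf.
under eq_fun do rewrite integral_mkcond.
have := @dominated_convergence _ _ _ mu setT measurableT
  (fun n => (EFin \o f) \_ `[- n%:R, n%:R]) (EFin \o f) (abse \o (EFin \o f)).
case.
- move=> n; apply/(measurable_restrictT _ _).1 => //; apply: measurable_funTS.
  exact/measurable_EFinP.
- exact/measurable_EFinP.
- apply/aeW => x _; apply: cvg_near_cst; near=> n.
  rewrite patchE mem_set_itv in_itv/= -ler_norml ifT//.
  by near: n; exact: nbhs_infty_ger.
- exact: integrable_abse.
- by apply/aeW => x n _; rewrite patchE; case: ifP => // _; rewrite (_ : point = 0%E)// abse0 abse_ge0.
by move=> _ _.
Unshelve. all: by end_near. Qed.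

Lemma Rintegral_derive_eq0 F f :
  (forall x : R, is_derive x 1 F (f x)) -> continuous f ->
  mu.-integrable setT (EFin \o f) ->
  F n%:R @[n --> \oo] --> 0 -> F (- n%:R) @[n --> \oo] --> 0 ->
  \int[mu]_x f x = 0.
Proof.
move=> dF cf intf F1 F2; have C := cvg_integral_itvNnn intf.
apply: (cvg_unique _ C) => //.
rewrite -(subr0 0); apply: cvg_trans (cvgB F1 F2); apply: near_eq_cvg; near=> n.
have n0 : (- n%:R : R) < n%:R.
  have : 0 < n%:R :> R by near: n; exact: nbhs_infty_gtr.
  by move=> ?; lra.
have cF : continuous F by move=> x; exact: is_derive_continuous (dF x).
rewrite /Rintegral (@continuous_FTC2 _ f F)//.
- exact: continuous_subspaceT.
- split => [x _||]; first by have := dF x.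
    exact/cvg_at_right_filter/cF.
  exact/cvg_at_left_filter/cF.
- by move=> x _; rewrite derive1E; exact: derive_val.
Unshelve. all: by end_near. Qed.

End IntegralDerivative.

Section Gaussian.
Context {R : realType}.
Local Notation mu := (@lebesgue_measure R).
Variables (a sigma : R).
Hypothesis sigma0 : 0 < sigma.
Local Notation g := (normal_fun a sigma).

Lemma integrable_normal_fun : mu.-integrable setT (EFin \o g).
Proof.
have s0 := lt0r_neq0 sigma0.
have -> : EFin \o g = (fun x => (normal_peak sigma)^-1%:E * (normal_pdf a sigma x)%:E)%E.
  apply/funext => x; rewrite normal_pdfE// -EFinM /=.
  by rewrite mulrA mulVf ?mul1r// gt_eqF// normal_peak_gt0.
by apply: integrableZl => //; exact: integrable_normal_pdf.
Qed.

Lemma Rintegral_normal_fun : \int[mu]_x g x = Num.sqrt (sigma ^+ 2 * pi *+ 2).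
Proof.
have s0 := lt0r_neq0 sigma0.
have p0 := normal_peak_gt0 s0.
have : \int[mu]_x normal_pdf a sigma x = 1 by rewrite /Rintegral integral_normal_pdf.
rewrite normal_pdfE// RintegralZl//; last exact: integrable_normal_fun.
move=> H; apply: (mulfI (lt0r_neq0 p0)); rewrite H.
by rewrite -[Num.sqrt _]invrK mulfV// lt0r_neq0.
Qed.

Lemma is_derive_normal_fun (x : R) : is_derive x 1 g (- (x - a) / sigma ^+ 2 * g x).
Proof.
have D := is_derive_comp (is_derive_sub (is_derive_id x 1) (is_derive_cst a x 1)) (is_derive_sqr (x - a)).
have D1 := is_derive_mul (is_deriveN D) (is_derive_cst ((sigma ^+ 2 *+ 2)^-1 : R) x 1).
have := is_derive_comp D1 (is_derive_expR (- (x - a) ^+ 2 / (sigma ^+ 2 *+ 2))).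
move=> /is_deriveW; apply; rewrite -/(normal_fun a sigma x) mulr0 addr0 /cst -[_ *+ 2]mulr_natr.
by field; rewrite gt_eqF.
Qed.

Lemma measurable_linear_sin (t p : R) : measurable_fun setT (fun y : R => sin (t * (y - a) + p)).
Proof.
apply: measurableT_comp; first exact: measurable_sin.
by apply: measurable_funD => //; apply: measurable_funM => //; exact: measurable_funB.
Qed.

Lemma measurable_linear_cos (t p : R) : measurable_fun setT (fun y : R => cos (t * (y - a) + p)).
Proof.
apply: measurableT_comp; first exact: measurable_cos.
by apply: measurable_funD => //; apply: measurable_funM => //; exact: measurable_funB.
Qed.

End Gaussian.

Section GaussianFourier.
Context {R : realType}.
Local Notation mu := (@lebesgue_measure R).
Variables (a sigma p : R).
Hypothesis sigma0 : 0 < sigma.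
Local Notation g := (normal_fun a sigma).
Implicit Types t y : R.

Lemma integrable_mul_bounded (f h : R -> R) (B : R) : mu.-integrable setT (EFin \o f) ->
  measurable_fun setT h -> (forall y, `|h y| <= B) ->
  mu.-integrable setT (fun y => (f y * h y)%:E).
Proof.
move=> intf mh hB; have /measurable_EFinP mf := measurable_int mu intf.
apply: (@le_integrable _ _ _ mu setT measurableT _ (fun y => B%:E * (f y)%:E)%E).
- by apply/measurable_EFinP; exact: measurable_funM.
- move=> y _; rewrite -EFinM lee_fin normrM mulrC normrM ler_wpM2r//.
  by rewrite (le_trans (hB y))// ler_norm.
- exact: integrableZl.
Qed.

(** Half of the exponent absorbs the factor |y - a|; the other half is a Gaussian of standard
    deviation sqrt 2 sigma and stays as majorant. *)
Lemma integrable_moment : mu.-integrable setT (fun y => (`|y - a| * g y)%:E).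
Proof.
have s20 : 0 < Num.sqrt 2 * sigma by rewrite mulr_gt0// sqrtr_gt0.
have s2E : (Num.sqrt 2 * sigma) ^+ 2 *+ 2 = 4 * sigma ^+ 2.
  by rewrite exprMn sqr_sqrtr// -mulr_natr; ring.
have := @integrableZl _ _ _ mu setT measurableT (1 + 4 * sigma ^+ 2) _
  (integrable_normal_fun a s20).
apply: le_integrable => //.
  apply/measurable_EFinP; apply: measurable_funM; last exact: measurable_normal_fun.
  by apply: measurableT_comp => //; exact: measurable_funB.
move=> y _; rewrite /= lee_fin.
have C0 : 0 <= 1 + 4 * sigma ^+ 2 by rewrite addr_ge0// mulr_ge0// sqr_ge0.
rewrite [leLHS]ger0_norm ?mulr_ge0 ?expR_ge0// [leRHS]ger0_norm ?mulr_ge0 ?expR_ge0//.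
have q0 : 0 < 4 * sigma ^+ 2 by rewrite mulr_gt0// exprn_gt0.
(* Then |y - a| <= 1 + (y - a)^2 <= (1 + 4 sigma^2) (1 + u), and 1 + u <= exp u. *)
pose u := (y - a) ^+ 2 / (4 * sigma ^+ 2).
have -> : g y = normal_fun a (Num.sqrt 2 * sigma) y * expR (- u).
  rewrite /normal_fun -expRD s2E /u -[sigma ^+ 2 *+ 2]mulr_natr; congr expR.
  by field; rewrite gt_eqF.
rewrite mulrCA mulrC ler_wpM2r ?expR_ge0// expRN ler_pdivrMr ?expR_gt0//.
apply: (@le_trans _ _ ((1 + 4 * sigma ^+ 2) * (1 + u))); last first.
  by rewrite ler_wpM2l ?expR_ge1Dx// addr_ge0// ltW.
have u0 : 0 <= u by rewrite divr_ge0 ?sqr_ge0// ltW.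
have : `|y - a| <= 1 + (y - a) ^+ 2.
  by rewrite -(real_normK (num_real (y - a))); have := normr_ge0 (y - a); nra.
move=> /le_trans; apply.
have -> : (y - a) ^+ 2 = u * (4 * sigma ^+ 2) by rewrite /u divfK// gt_eqF.
by nra.
Qed.

Let E t := \int[mu]_y (g y * cos (t * (y - a) + p)).

Let intE t : mu.-integrable setT (fun y => (g y * cos (t * (y - a) + p))%:E).
Proof.
apply: (@integrable_mul_bounded g _ 1).
- exact: integrable_normal_fun.
- exact: measurable_linear_cos.
- by move=> y; exact: cos_max.
Qed.

Let intS t : mu.-integrable setT (fun y => ((y - a) * g y * sin (t * (y - a) + p))%:E).
Proof.
apply: le_integrable integrable_moment => //.
  apply/measurable_EFinP; apply: measurable_funM; last exact: measurable_linear_sin.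
  by apply: measurable_funM; [exact: measurable_funB|exact: measurable_normal_fun].
move=> y _; rewrite lee_fin /= normrM [leRHS]ger0_norm ?mulr_ge0 ?expR_ge0//.
rewrite normrM (ger0_norm (expR_ge0 _)) -[leRHS]mulr1 ler_wpM2l ?mulr_ge0 ?expR_ge0//.
exact: sin_max.
Qed.

Let derive_cosE t y :
  is_derive t 1 (fun t => g y * cos (t * (y - a) + p)) (- ((y - a) * g y * sin (t * (y - a) + p))).
Proof.
have L : is_derive t 1 (fun t : R => t * (y - a) + p) (y - a).
  have := is_derive_add (is_derive_mul (is_derive_id t 1) (is_derive_cst (y - a) t 1)) (is_derive_cst p t 1).
  by move=> /is_deriveW; apply; rewrite mul1r mulr0 !addr0.
have := is_derive_mul (is_derive_cst (g y) t 1) (is_derive_comp L (is_derive_cos _)).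
by move=> /is_deriveW; apply; rewrite /cst; ring.
Qed.

Let derive_E t : is_derive t 1 E (- \int[mu]_y ((y - a) * g y * sin (t * (y - a) + p))).
Proof.
pose f t y := g y * cos (t * (y - a) + p).
have pE x y : partial1of2 f x y = - ((y - a) * g y * sin (x * (y - a) + p)).
  by rewrite partial1of2E; have D := derive_cosE x y; exact: derive_val.
have It : `]t - 1, t + 1[%classic t by rewrite /= in_itv/= ltrBlDr ltrDl ltr01.
have H := (@derivable_under_integral R _ _ mu f setT measurableT t (t - 1) (t + 1) It
  (fun x _ => intE x) (fun x y _ _ => @ex_derive _ _ _ _ _ _ _ (derive_cosE x y))
  (fun y => `|y - a| * g y)).
have H2 := (@differentiation_under_integral R _ _ mu f setT measurableT t (t - 1) (t + 1) It
  (fun x _ => intE x) (fun x y _ _ => @ex_derive _ _ _ _ _ _ _ (derive_cosE x y))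
  (fun y => `|y - a| * g y)).
have G0 y : 0 <= `|y - a| * g y by rewrite mulr_ge0 ?expR_ge0.
have Gb x y : `]t - 1, t + 1[%classic x -> setT y -> `|partial1of2 f x y| <= `|y - a| * g y.
  move=> _ _; rewrite pE normrN !normrM (ger0_norm (expR_ge0 _)).
  by rewrite -[leRHS]mulr1 ler_wpM2l ?mulr_ge0 ?expR_ge0// sin_max.
apply: DeriveDef; first exact: H G0 integrable_moment Gb.
rewrite -derive1E (H2 G0 integrable_moment Gb).
rewrite -mulN1r -RintegralZl//; last exact: intS.
by apply: eq_Rintegral => y _; rewrite pE mulN1r.
Qed.

(** (y - a) g y is - sigma^2 times the derivative of g, so this is an integration by parts. With
    [derive_E] it yields E' = - sigma^2 t E. *)
Let parts t : \int[mu]_y ((y - a) * g y * sin (t * (y - a) + p)) = sigma ^+ 2 * t * E t.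
Proof.
pose F y := g y * sin (t * (y - a) + p).
pose f y := - (sigma ^+ 2)^-1 * ((y - a) * g y * sin (t * (y - a) + p)) +
  t * (g y * cos (t * (y - a) + p)).
have s2 : 0 < sigma ^+ 2 by rewrite exprn_gt0.
have dF y : is_derive y 1 F (f y).
  have L : is_derive y 1 (fun y : R => t * (y - a) + p) t.
    have := is_derive_add (is_derive_mul (is_derive_cst t y 1)
      (is_derive_sub (is_derive_id y 1) (is_derive_cst a y 1))) (is_derive_cst p y 1).
    by move=> /is_deriveW; apply; rewrite mul0r add0r subr0 mulr1 addr0.
  have := is_derive_mul (is_derive_normal_fun a sigma0 y) (is_derive_comp L (is_derive_sin _)).
  by move=> /is_deriveW; apply; rewrite /f; field; rewrite gt_eqF.
have cf : continuous f.
  have cl y : {for y, continuous (fun y : R => t * (y - a) + p)}.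
    apply: cvgD; last exact: cvg_cst.
    apply: cvgM; first exact: cvg_cst.
    by apply: cvgB; [exact: cvg_id|exact: cvg_cst].
  have cg : continuous g by move=> y; exact: is_derive_continuous (is_derive_normal_fun a sigma0 y).
  move=> y; apply: cvgD; apply: cvgM; (try exact: cvg_cst); apply: cvgM.
  - apply: cvgM; last exact: cg.
    by apply: cvgB; [exact: cvg_id|exact: cvg_cst].
  - by apply: (continuous_cvg _ _ (cl y)); exact: continuous_sin.
  - exact: cg.
  - by apply: (continuous_cvg _ _ (cl y)); exact: continuous_cos.
have := Rintegral_derive_eq0 dF cf.
rewrite /f RintegralD//; last 2 first.
- by apply: integrable_scale; exact: intS.
- by apply: integrable_scale; exact: intE.
rewrite !RintegralZl//; [|exact: intS|exact: intE].
move=> H.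
have {H} : - (sigma ^+ 2)^-1 * \int[mu]_y ((y - a) * g y * sin (t * (y - a) + p)) + t * E t = 0.
  have gF y : `|F y| <= g y.
    by rewrite normrM (ger0_norm (expR_ge0 _)) -[leRHS]mulr1 ler_wpM2l ?expR_ge0// sin_max.
  (* Covers both ends, u n = n and u n = - n. The Gaussian is bounded by 2 sigma^2 / (u n - a)^2,
     and (u n - a)^2 >= n - |a| once the right side exceeds 1. *)
  have lim0 (u : nat -> R) : (forall n, n%:R - `|a| <= `|u n - a|) -> F (u n) @[n --> \oo] --> 0.
    move=> uE; apply: norm_cvg0.
    apply: (@squeeze_cvgr _ _ _ _ (fun=> 0) (fun n => (sigma ^+ 2 *+ 2) / (n%:R - `|a|))).
    + near=> n; rewrite normr_ge0/=; apply: (le_trans (gF _)).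
      have na : 1 <= n%:R - `|a| by rewrite lerBrDr; near: n; exact: nbhs_infty_ger.
      have na0 : 0 < n%:R - `|a| by exact: lt_le_trans na.
      have c0 : 0 < sigma ^+ 2 *+ 2 by rewrite pmulrn_lgt0.
      have v2 : n%:R - `|a| <= (u n - a) ^+ 2.
        by rewrite -(real_normK (num_real (u n - a))); have := uE n; nra.
      have v0 : 0 < (u n - a) ^+ 2 by exact: lt_le_trans v2.
      rewrite /normal_fun mulNr expRN -[leRHS]invf_div lef_pV2 ?posrE ?expR_gt0 ?divr_gt0//.
      apply: (@le_trans _ _ ((u n - a) ^+ 2 / (sigma ^+ 2 *+ 2))).
        by rewrite ler_pM2r ?invr_gt0.
      by rewrite (le_trans _ (expR_ge1Dx _))// lerDr.
    + exact: cvg_cst.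
    + rewrite -[X in _ --> X](mulr0 (sigma ^+ 2 *+ 2)); apply: cvgMr.
      apply/gtr0_cvgV0.
        near=> n; rewrite subr_gt0; near: n; exact: nbhs_infty_gtr.
      under eq_fun do rewrite addrC.
      apply/cvgryPge => A; near=> n; rewrite addrC lerBrDr; near: n; exact: nbhs_infty_ger.
  apply: H.
  - by apply: integrable_add; apply: integrable_scale; [exact: intS|exact: intE].
  - by apply: (lim0 (fun n => n%:R)) => n; rewrite -[X in X - `|a|]normr_nat lerB_dist.
  - apply: (lim0 (fun n => - n%:R)) => n.
    by rewrite -[X in X - `|a|]normr_nat -[`|n%:R|]normrN lerB_dist.
by move=> /eqP; rewrite mulNr addrC subr_eq0 => /eqP H; rewrite -mulrA H mulrA mulfV ?mul1r// gt_eqF.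
Unshelve. all: by end_near. Qed.

(** E solves a linear differential equation, so E t exp (sigma^2 t^2 / 2) is constant. The phase p =
    t a recovers the integral against cos (t y). *)
Lemma normal_fun_cos t : \int[mu]_y (g y * cos (t * (y - a) + p)) =
  cos p * Num.sqrt (sigma ^+ 2 * pi *+ 2) * expR (- (sigma ^+ 2 * t ^+ 2 / 2)).
Proof.
pose h t := E t * expR (sigma ^+ 2 * t ^+ 2 / 2).
have dh (r : R) : is_derive r 1 h 0.
  have D := is_derive_mul (is_derive_mul (is_derive_cst (sigma ^+ 2) r 1) (is_derive_sqr r)) (is_derive_cst (2^-1 : R) r 1).
  have := is_derive_mul (derive_E r) (is_derive_comp D (is_derive_expR _)).
  by move=> /is_deriveW; apply; rewrite parts /cst; field.
have E0 : h 0 = cos p * Num.sqrt (sigma ^+ 2 * pi *+ 2).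
  rewrite /h expr0n mulr0 mul0r expR0 mulr1 /E.
  under eq_Rintegral => y _ do rewrite mul0r add0r.
  by rewrite RintegralZr ?Rintegral_normal_fun ?(mulrC (cos p))//; exact: integrable_normal_fun.
have -> : cos p * Num.sqrt (sigma ^+ 2 * pi *+ 2) = h t.
  by rewrite -E0; apply/esym/is_derive_0_is_cst.
by rewrite expRN /h mulfK// gt_eqF// expR_gt0.
Qed.

End GaussianFourier.

(** * Fourier transform of two-sided exponentials *)

Section TwoSidedExponential.
Context {R : realType}.
Local Notation mu := (@lebesgue_measure R).
Implicit Types (s x a xi : R).

Definition exp_abs s x : R := expR (- (s * `|x|)).

Lemma continuous_exp_abs s : continuous (exp_abs s).
Proof.
move=> x; apply: continuous_comp; last exact: continuous_expR.
apply: cvgN; apply: cvgM; first exact: cvg_cst.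
exact: norm_continuous.
Qed.

Lemma is_derive_expR_lin (c x : R) : is_derive x 1 (fun y => expR (c * y)) (c * expR (c * x)).
Proof.
have := is_derive_comp (is_derive_mulc c x) (is_derive_expR _).
by move=> /is_deriveW; apply; rewrite mulrC.
Qed.

Lemma cvgy_expRN s : 0 < s -> expR (- (s * x)) @[x --> +oo] --> 0.
Proof.
move=> s0; apply: (cvg_comp (fun x : R => s * x) (fun x => expR (- x)) _ (@cvgr_expR R)).
by apply: gt0_cvgMry => //; exact: cvg_id.
Qed.

Lemma integral_exp_abs s : 0 < s -> (\int[mu]_x (exp_abs s x)%:E = (2 / s)%:E)%E.
Proof.
move=> s0; rewrite ge0_symfun_integralT//.
- rewrite (_ : [set x | _] = `[0, +oo[%classic); last first.
    by apply/seteqP; split => x/=; rewrite in_itv/= andbT.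
  transitivity (2%:E * \int[mu]_(x in `[0%R, +oo[) (expR (- s * x))%:E)%E.
    congr (_ * _)%E; apply: eq_integral => x; rewrite inE/= in_itv/= andbT => x0.
    by rewrite /exp_abs ger0_norm// mulNr.
  have D x := is_derive_mul (is_derive_expR_lin (- s) x) (is_derive_cst (- s)^-1 x 1).
  have cF : continuous (fun x => expR (- s * x) * (- s)^-1).
    by move=> x; exact: is_derive_continuous (D x).
  rewrite (@ge0_continuous_FTC2y _ _ (fun x => expR (- s * x) * (- s)^-1) 0 0).
  + by rewrite mulr0 expR0 mul1r -EFinB -EFinM invrN opprK add0r.
  + by move=> x _; exact: expR_ge0.
  + apply: continuous_subspaceT => x.
    exact: is_derive_continuous (is_derive_expR_lin (- s) x).
  + rewrite -[X in _ --> X](mul0r (- s)^-1); apply: cvgM; last exact: cvg_cst.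
    under eq_fun do rewrite mulNr.
    exact: cvgy_expRN.
  + by move=> x _; have := D x.
  + exact/cvg_at_right_filter/cF.
  + move=> x _; rewrite derive1E; have Dx := D x; rewrite (@derive_val _ _ _ _ _ _ _ Dx).
    by rewrite mulr0 addr0 mulrAC mulfV ?mul1r// oppr_eq0 gt_eqF.
- by move=> x; exact: expR_ge0.
- exact: continuous_exp_abs.
- by move=> x; rewrite /exp_abs /= normrN.
Qed.

Lemma integrable_exp_abs s : 0 < s -> mu.-integrable setT (EFin \o exp_abs s).
Proof.
move=> s0; have mE : measurable_fun setT (exp_abs s).
  by apply: continuous_measurable_fun; exact: continuous_exp_abs.
apply/integrableP; split; first exact/measurable_EFinP.
under eq_integral => x _ do rewrite /= ger0_norm ?expR_ge0//.
by rewrite integral_exp_abs// ltry.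
Qed.

Lemma Rintegral_continuous_FTC (f F : R -> R) (b c : R) : b < c ->
  (forall x : R, is_derive x 1 F (f x)) -> continuous f ->
  \int[mu]_(x in `[b, c]) f x = F c - F b.
Proof.
move=> bc dF cf; have cF : continuous F by move=> x; exact: is_derive_continuous (dF x).
rewrite /Rintegral (@continuous_FTC2 _ f F)//.
- exact: continuous_subspaceT.
- split => [x _||]; first by have := dF x.
    exact/cvg_at_right_filter/cF.
  exact/cvg_at_left_filter/cF.
- by move=> x _; rewrite derive1E; exact: derive_val.
Qed.

(** The real part of exp (c x + i (x - a) xi) / (c + i xi). *)
Definition exp_cos_primitive (c a xi x : R) : R :=
  expR (c * x) * (c * cos ((x - a) * xi) + xi * sin ((x - a) * xi)) / (c ^+ 2 + xi ^+ 2).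

Lemma is_derive_exp_cos_primitive (c a xi x : R) : c != 0 ->
  is_derive x 1 (exp_cos_primitive c a xi) (expR (c * x) * cos ((x - a) * xi)).
Proof.
move=> c0; have L : is_derive x 1 (fun x : R => (x - a) * xi) xi.
  have := is_derive_mul (is_derive_sub (is_derive_id x 1) (is_derive_cst a x 1)) (is_derive_cst xi x 1).
  by move=> /is_deriveW; apply; rewrite mulr0 addr0 subr0 mul1r.
have D1 := is_derive_mul (is_derive_cst c x 1) (is_derive_comp L (is_derive_cos _)).
have D2 := is_derive_mul (is_derive_cst xi x 1) (is_derive_comp L (is_derive_sin _)).
have := is_derive_mul (is_derive_mul (is_derive_expR_lin c x) (is_derive_add D1 D2))
  (is_derive_cst (c ^+ 2 + xi ^+ 2)^-1 x 1).
have cx : c ^+ 2 + xi ^+ 2 != 0.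
  by rewrite gt_eqF// ltr_pwDl ?sqr_ge0// lt_neqAle eq_sym sqrf_eq0 c0 sqr_ge0.
by move=> /is_deriveW; apply; rewrite /cst; field.
Qed.

Lemma continuous_exp_cos (c a xi : R) : continuous (fun x => expR (c * x) * cos ((x - a) * xi)).
Proof.
move=> x; apply: cvgM; first exact: is_derive_continuous (is_derive_expR_lin c x).
apply: (@continuous_comp _ _ _ (fun x : R => (x - a) * xi) (@cos R)); last exact: continuous_cos.
by apply: cvgM; [apply: cvgB; [exact: cvg_id|exact: cvg_cst]|exact: cvg_cst].
Qed.

Lemma measurable_cos_shift (a xi : R) : measurable_fun setT (fun x : R => cos ((x - a) * xi)).
Proof.
apply: measurableT_comp; first exact: measurable_cos.
by apply: measurable_funM => //; exact: measurable_funB.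
Qed.

Lemma integrable_exp_abs_cos (s a xi : R) : 0 < s ->
  mu.-integrable setT (EFin \o (fun x => exp_abs s x * cos ((x - a) * xi))).
Proof.
move=> s0; apply: (@integrable_mul_bounded _ (exp_abs s) _ 1).
- exact: integrable_exp_abs.
- exact: measurable_cos_shift.
- by move=> y; exact: cos_max.
Qed.

(** Split at 0: the primitive has c = s on the left and c = - s on the right. It vanishes at
    infinity, and at 0 the sine terms cancel. *)
Lemma Rintegral_exp_abs_cos s a xi : 0 < s ->
  \int[mu]_x (exp_abs s x * cos ((x - a) * xi)) = 2 * s / (s ^+ 2 + xi ^+ 2) * cos (a * xi).
Proof.
move=> s0; have C := cvg_integral_itvNnn (integrable_exp_abs_cos a xi s0).
apply: (cvg_unique _ C) => //.
have sn0 : s != 0 by rewrite gt_eqF.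
have sx : 0 < s ^+ 2 + xi ^+ 2 by rewrite ltr_pwDl ?sqr_ge0// exprn_gt0.
pose F c x := exp_cos_primitive c a xi x.
have lim c (u : nat -> R) : c ^+ 2 = s ^+ 2 -> (forall n, c * u n = - (s * n%:R)) ->
    F c (u n) @[n --> \oo] --> 0.
  move=> c2 cu; apply: norm_cvg0.
  apply: (@squeeze_cvgr _ _ _ _ (fun=> 0)
    (fun n => expR (- (s * n%:R)) * ((`|c| + `|xi|) / (s ^+ 2 + xi ^+ 2)))).
  - near=> n; rewrite normr_ge0/= /F /exp_cos_primitive c2 cu -mulrA normrM.
    rewrite (ger0_norm (expR_ge0 _)) ler_wpM2l ?expR_ge0// normrM normfV (gtr0_norm sx).
    rewrite ler_pM2r ?invr_gt0// (le_trans (ler_normD _ _))// !normrM lerD//.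
      by rewrite -[leRHS]mulr1 ler_wpM2l// cos_max.
    by rewrite -[leRHS]mulr1 ler_wpM2l// sin_max.
  - exact: cvg_cst.
  - rewrite -[X in _ --> X](mul0r ((`|c| + `|xi|) / (s ^+ 2 + xi ^+ 2))).
    apply: cvgM; last exact: cvg_cst.
    exact: (cvg_comp (fun n : nat => n%:R : R) (fun x => expR (- (s * x))) (@cvgr_idn R) (cvgy_expRN s0)).
have H : F s 0 - F s (- n%:R) + (F (- s) n%:R - F (- s) 0) @[n --> \oo] -->
    2 * s / (s ^+ 2 + xi ^+ 2) * cos (a * xi).
  rewrite (_ : _ * cos _ = F s 0 - 0 + (0 - F (- s) 0)); last first.
    rewrite /F /exp_cos_primitive !mulr0 expR0 !sub0r sqrrN mulNr cosN sinN.
    by field; rewrite gt_eqF.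
  apply: cvgD; apply: cvgB; (try exact: cvg_cst); apply: lim => //.
  - by move=> n; rewrite mulrN.
  - by rewrite sqrrN.
  - by move=> n; rewrite mulNr.
apply: cvg_trans H; apply: near_eq_cvg; near=> n.
have n0 : 0 < n%:R :> R by near: n; exact: nbhs_infty_gtr.
have i (b c : R) : mu.-integrable `[b, c] (EFin \o (fun x => exp_abs s x * cos ((x - a) * xi))).
  by apply: integrableS (integrable_exp_abs_cos a xi s0).
have -> : F s 0 - F s (- n%:R) =
    \int[mu]_(x in `[- n%:R, 0]) (expR (s * x) * cos ((x - a) * xi)).
  apply/esym; apply: Rintegral_continuous_FTC.
  - by rewrite oppr_lt0.
  - by move=> x; exact: is_derive_exp_cos_primitive.
  - exact: continuous_exp_cos.
have -> : F (- s) n%:R - F (- s) 0 =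
    \int[mu]_(x in `[0, n%:R]) (expR (- s * x) * cos ((x - a) * xi)).
  apply/esym; apply: Rintegral_continuous_FTC => //.
  - by move=> x; apply: is_derive_exp_cos_primitive; rewrite oppr_eq0.
  - exact: continuous_exp_cos.
have e1 : \int[mu]_(x in `[- n%:R, 0]) (expR (s * x) * cos ((x - a) * xi)) =
    \int[mu]_(x in `[- n%:R, 0]) (exp_abs s x * cos ((x - a) * xi)).
  apply: eq_Rintegral => x; rewrite inE/= in_itv/= => /andP[_ x0].
  by rewrite /exp_abs ler0_norm// mulrN opprK.
have e2 : \int[mu]_(x in `[0, n%:R]) (expR (- s * x) * cos ((x - a) * xi)) =
    \int[mu]_(x in `[0, n%:R]) (exp_abs s x * cos ((x - a) * xi)).
  apply: eq_Rintegral => x; rewrite inE/= in_itv/= => /andP[x0 _].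
  by rewrite /exp_abs ger0_norm// mulNr.
rewrite e1 e2 -[X in _ + X](Rintegral_itv_obnd_cbnd); last first.
  apply: integrableS (i 0 n%:R) => //; exact: subset_itv_oc_cc.
rewrite -(Rintegral_itvB (i (- n%:R) n%:R) (x := 0)) ?bnd_simp ?oppr_le0//.
by rewrite addrC subrK.
Unshelve. all: by end_near. Qed.

End TwoSidedExponential.

Section TestIdentity.
Context {R : realType}.
Local Notation mu := (@lebesgue_measure R).
Implicit Types (s x xi : R).

Definition kernel_of_weight x : R := pi^-1 * \int[mu]_s (weight s * exp_abs s x).

Lemma integrable_Rintegral (f : R * R -> R) : (mu \x mu)%E.-integrable setT (EFin \o f) ->
  mu.-integrable setT (EFin \o (fun x => \int[mu]_y f (x, y))).
Proof.
move=> intf; have iF := integrable_fubini_F intf.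
apply: le_integrable iF => //.
  apply/measurable_EFinP; apply: (measurableT_comp (@fine_measurable R setT measurableT)).
  exact: measurable_fubini_F intf.
move=> x _; rewrite /= /Rintegral /fubini_F /=.
by case: (integral _ _ _) => [r||] /=; rewrite ?normr0 ?leey.
Qed.

Lemma integrable_swap (f : R * R -> R) : (mu \x mu)%E.-integrable setT (EFin \o f) ->
  (mu \x mu)%E.-integrable setT (EFin \o (fun z => f (z.2, z.1))).
Proof.
move=> intf; have mf := measurable_int _ intf.
have mfs : measurable_fun setT (EFin \o (fun z : R * R => f (z.2, z.1))).
  apply: (measurableT_comp mf).
  by apply: measurable_fun_pair; [exact: measurable_snd|exact: measurable_fst].
apply/integrable12ltyP => //.
by move: intf => /integrable21ltyP; apply.
Qed.

Lemma Rintegral0_eq (f : R -> R) : (forall x, f x = 0) -> \int[mu]_x f x = 0.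
Proof. by move=> f0; rewrite /Rintegral integral0_eq// => x _; rewrite f0. Qed.

Lemma integrable_weight_stieltjes xi : xi != 0 ->
  mu.-integrable setT (EFin \o (fun s => weight s * (2 * s / (s ^+ 2 + xi ^+ 2)))).
Proof.
move=> xi0; apply/integrableP; split.
  apply/measurable_EFinP; apply: measurable_funM; first exact: measurable_weight.
  apply: measurable_funM; first exact: mulrl_measurable.
  by apply: measurable_funV; apply: measurable_funD => //; exact: measurable_funX.
under eq_integral => s _.
  rewrite gee0_abs; first over.
  rewrite lee_fin; have [->|w0] := eqVneq (weight s) 0; first by rewrite mul0r.
  have s0 : 0 < s by move: w0 => /weight_neq0; apply: lt_trans; rewrite divr_gt0// pi_gt0.
  by rewrite !mulr_ge0 ?weight_ge0 ?invr_ge0 ?addr_ge0 ?sqr_ge0 ?(ltW s0).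
by rewrite weight_stieltjes// ltry.
Qed.

(** For [weight_stieltjes], which says nothing about the frequency 0. *)
Lemma Rintegral_eq_off0 (f g : R -> R) : measurable_fun setT f -> measurable_fun setT g ->
  (forall x, x != 0 -> f x = g x) -> \int[mu]_x f x = \int[mu]_x g x.
Proof.
move=> mf mg fg; rewrite /Rintegral; congr fine; apply: ae_eq_integral => //.
- exact/measurable_EFinP.
- exact/measurable_EFinP.
- exists [set 0]; split => //; first exact: lebesgue_measure_set1.
  by move=> x /= H; apply: contrapT => /eqP x0; apply: H => _; rewrite fg.
Qed.

Lemma measurable_exp_abs d (T : measurableType d) (g h : T -> R) :
  measurable_fun setT g -> measurable_fun setT h ->
  measurable_fun setT (fun z => exp_abs (g z) (h z)).
Proof.
move=> mg mh; apply: measurableT_comp => //; apply: measurableT_comp => //.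
by apply: measurable_funM => //; exact: measurableT_comp.
Qed.

Lemma weight_pos s : weight s != 0 -> 0 < s.
Proof. by move=> /weight_neq0; apply: lt_trans; rewrite divr_gt0// pi_gt0. Qed.

Variables (a sigma : R).
Hypothesis sigma0 : 0 < sigma.
Local Notation phi := (normal_fun a sigma).
Local Notation nf := (normal_fun 0 sigma^-1).
Local Notation kappa := (Num.sqrt (sigma^-1 ^+ 2 * pi *+ 2)).

(** Writes the test function as a Fourier integral of the Gaussian of inverse width. *)
Lemma normal_fun_inverse x : \int[mu]_xi (nf xi * cos ((x - a) * xi)) = kappa * phi x.
Proof.
have s0 : 0 < sigma^-1 by rewrite invr_gt0.
have := normal_fun_cos 0 0 s0 (x - a); rewrite cos0 mul1r.
under eq_Rintegral => xi _ do rewrite subr0 addr0.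
move=> ->; rewrite /normal_fun; congr (_ * expR _).
by rewrite -[_ *+ 2]mulr_natr; field; rewrite gt_eqF.
Qed.

Lemma normal_fun_le1 x : phi x <= 1.
Proof.
rewrite /normal_fun -[leRHS]expR0 ler_expR mulNr oppr_le0 divr_ge0 ?sqr_ge0//.
by rewrite mulrn_wge0// sqr_ge0.
Qed.

(** Parseval for a single exponential: insert the Fourier integral of phi, exchange, and integrate
    in x. *)
Lemma Rintegral_exp_abs_normal_fun s : 0 < s ->
  kappa * \int[mu]_x (exp_abs s x * phi x) =
  \int[mu]_xi (nf xi * (2 * s / (s ^+ 2 + xi ^+ 2) * cos (a * xi))).
Proof.
move=> s0; have is0 : 0 < sigma^-1 by rewrite invr_gt0.
have iP : mu.-integrable setT (EFin \o (fun x => exp_abs s x * phi x)).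
  apply: (@integrable_mul_bounded _ (exp_abs s) _ 1).
  - exact: integrable_exp_abs.
  - exact: measurable_normal_fun.
  - by move=> x; rewrite ger0_norm ?expR_ge0// normal_fun_le1.
rewrite -RintegralZl//.
pose f z := exp_abs s z.1 * nf z.2 * cos ((z.1 - a) * z.2).
have mf : measurable_fun [set: R * R] (fun z => cos ((z.1 - a) * z.2)).
  apply: measurableT_comp; first exact: measurable_cos.
  apply: measurable_funM; last exact: measurable_snd.
  by apply: measurable_funB => //; exact: measurable_fst.
have intf : (mu \x mu)%E.-integrable setT (EFin \o f).
  apply: (integrable_prod_bounded (integrable_exp_abs s0) (integrable_normal_fun 0 is0) mf).
  by move=> z; exact: cos_max.
have := Rintegral_Fubini intf; rewrite /f/= => F.
transitivity (\int[mu]_x \int[mu]_y (exp_abs s x * nf y * cos ((x - a) * y))).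
  apply: eq_Rintegral => x _; under eq_Rintegral => y _ do rewrite -mulrA.
  rewrite RintegralZl//; last first.
    apply: (@integrable_mul_bounded _ nf _ 1).
    + exact: integrable_normal_fun.
    + apply: measurableT_comp; first exact: measurable_cos.
      exact: mulrl_measurable.
    + by move=> y; exact: cos_max.
  by rewrite normal_fun_inverse mulrCA.
rewrite F; apply: eq_Rintegral => xi _.
under eq_Rintegral => x _ do rewrite mulrAC mulrC.
by rewrite RintegralZl ?Rintegral_exp_abs_cos//; exact: integrable_exp_abs_cos.
Qed.

Let fW z := weight z.2 * exp_abs z.2 z.1 * phi z.1.

(** Integrating in x first, with phi <= 1, leaves 2 weight s / s. In the other order the kernel's
    singularity at x = 0 would have to be controlled. *)
Let integrable_fW : (mu \x mu)%E.-integrable setT (EFin \o fW).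
Proof.
have mfW : measurable_fun [set: R * R] fW.
  apply: measurable_funM; first apply: measurable_funM.
  - by apply: measurableT_comp; [exact: measurable_weight|exact: measurable_snd].
  - by apply: measurable_exp_abs; [exact: measurable_snd|exact: measurable_fst].
  - by apply: measurableT_comp; [exact: measurable_normal_fun|exact: measurable_fst].
apply/integrable21ltyP; first exact/measurable_EFinP.
have := integrableZl measurableT 2 (integrable_weight (R := R)).
move=> /integrableP[mI]; apply: le_lt_trans.
apply: ge0_le_integral => //.
- by move=> s _; apply: integral_ge0.
- have := @measurable_fun_fubini_tonelli_G _ _ _ _ _ mu (fun z => `|(fW z)%:E|%E).
  by apply => //; apply: measurableT_comp => //; exact/measurable_EFinP.
- by apply: measurableT_comp => //.
move=> s _; have [w0|w0] := eqVneq (weight s) 0.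
  rewrite w0 mul0r mule0 abse0 integral0_eq// => x _.
  by rewrite /fW /= w0 !mul0r normr0.
have s0 := weight_pos w0.
apply: (@le_trans _ _ (\int[mu]_x ((weight s)%:E * (exp_abs s x)%:E))%E).
  apply: ge0_le_integral => //.
  - apply: measurableT_comp => //; apply/measurable_EFinP.
    exact: measurableT_comp mfW (pair2_measurable s).
  - apply: emeasurable_funM => //; apply/measurable_EFinP.
    by apply: continuous_measurable_fun; exact: continuous_exp_abs.
  - move=> x _; rewrite -EFinM lee_fin /fW /= ger0_norm; last first.
      by rewrite !mulr_ge0 ?weight_ge0 ?expR_ge0.
    by rewrite -[leRHS]mulr1 ler_wpM2l ?normal_fun_le1// mulr_ge0 ?weight_ge0 ?expR_ge0.
rewrite ge0_integralZl_EFin ?weight_ge0//; last 2 first.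
- by move=> x _; rewrite lee_fin expR_ge0.
- apply/measurable_EFinP.
  by apply: continuous_measurable_fun; exact: continuous_exp_abs.
rewrite integral_exp_abs// -!EFinM/= lee_fin ger0_norm.
  by rewrite mulrCA.
by rewrite !mulr_ge0 ?invr_ge0 ?weight_ge0 ?(ltW s0).
Qed.

(** No integrability is assumed: if the integral of f is infinite, both sides are 0 by the
    convention on real-valued integrals. So [kernel_normal_funE] can include x = 0. *)
Lemma ge0_RintegralZr (f : R -> R) (r : R) : measurable_fun setT f ->
  (forall x, 0 <= f x) -> 0 < r -> \int[mu]_x (f x * r) = (\int[mu]_x f x) * r.
Proof.
move=> mf f0 r0; rewrite /Rintegral; under eq_integral => x _ do rewrite EFinM.
rewrite ge0_integralZr//; last 3 first.
- exact/measurable_EFinP.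
- by move=> x _; rewrite lee_fin.
- by rewrite lee_fin ltW.
by case: (integral _ _ _) => [y||] //=; rewrite ?mulyr ?mulNyr gtr0_sg// mul1e/= mul0r.
Qed.

Lemma kernel_normal_funE x : kernel_of_weight x * phi x = pi^-1 * \int[mu]_s fW (x, s).
Proof.
rewrite /kernel_of_weight -mulrA -ge0_RintegralZr//.
- apply: measurable_funM; first exact: measurable_weight.
  exact: measurable_exp_abs.
- by move=> s; rewrite mulr_ge0 ?weight_ge0 ?expR_ge0.
- exact: expR_gt0.
Qed.

Lemma integrable_kernel_normal_fun :
  mu.-integrable setT (EFin \o (fun x => kernel_of_weight x * phi x)).
Proof.
under eq_fun do rewrite kernel_normal_funE.
by apply: integrable_scale; exact: integrable_Rintegral integrable_fW.
Qed.

Lemma measurable_whitham_symbol : measurable_fun setT (@whitham_symbol R).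
Proof.
have me : measurable_fun setT (fun x : R => expR (- x)) by exact: measurableT_comp.
have ms : measurable_fun setT (@sinh R).
  by apply: measurable_funM => //; exact: measurable_funB.
have mc : measurable_fun setT (@cosh R).
  by apply: measurable_funM => //; exact: measurable_funD.
apply: measurable_fun_ifT => //; first exact: measurable_fun_eqr.
apply: measurableT_comp; first exact: measurable_sqrt.
by apply: measurable_funM; [apply: measurable_funM => //|]; exact: measurable_funV.
Qed.

(** The Lorentz factor 2 s / (s^2 + xi^2) with 1 / s taken out: that goes to the weight, making it
    integrable, and the rest is bounded by 2. *)
Let b z : R := 2 * z.1 ^+ 2 / (z.1 ^+ 2 + z.2 ^+ 2) * cos (a * z.2).

Let measurable_b : measurable_fun [set: R * R] b.
Proof.
have m1 := @measurable_fst _ _ R R; have m2 := @measurable_snd _ _ R R.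
apply: measurable_funM.
  apply: measurable_funM; first by apply: measurable_funM => //; exact: measurable_funX.
  by apply: measurable_funV; apply: measurable_funD; exact: measurable_funX.
apply: measurableT_comp; first exact: measurable_cos.
exact: measurable_funM.
Qed.

Let b_le2 z : `|b z| <= 2.
Proof.
rewrite /b normrM -[leRHS]mulr1 ler_pM// ?cos_max//.
have D0 : 0 <= z.1 ^+ 2 + z.2 ^+ 2 by rewrite addr_ge0 ?sqr_ge0.
rewrite ger0_norm; last by rewrite divr_ge0// mulr_ge0// sqr_ge0.
have [->|Dn0] := eqVneq (z.1 ^+ 2 + z.2 ^+ 2) 0; first by rewrite invr0 mulr0.
have Dp : 0 < z.1 ^+ 2 + z.2 ^+ 2 by rewrite lt_def Dn0.
by rewrite ler_pdivrMr// ler_wpM2l// lerDl sqr_ge0.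
Qed.

Let integrable_b : (mu \x mu)%E.-integrable setT
  (EFin \o (fun z => weight z.1 / z.1 * nf z.2 * b z)).
Proof.
have is0 : 0 < sigma^-1 by rewrite invr_gt0.
exact: (integrable_prod_bounded (integrable_weight (R := R)) (integrable_normal_fun 0 is0)
  measurable_b b_le2).
Qed.

Let kappa_neq0 : kappa != 0.
Proof. by rewrite gt_eqF// sqrtr_gt0 mulrn_wgt0// mulr_gt0 ?pi_gt0// exprn_gt0// invr_gt0. Qed.

Let integrable_nf_lorentz s : 0 < s -> mu.-integrable setT
  (EFin \o (fun xi => nf xi * (2 * s / (s ^+ 2 + xi ^+ 2) * cos (a * xi)))).
Proof.
move=> s0; have ss : 0 < s ^+ 2 by rewrite exprn_gt0.
apply: (@integrable_mul_bounded _ nf _ (2 / s)).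
- by apply: integrable_normal_fun; rewrite invr_gt0.
- apply: measurable_funM; last by apply: measurableT_comp; [exact: measurable_cos|exact: mulrl_measurable].
  apply: measurable_funM; first exact: measurable_cst.
  by apply: measurable_funV; apply: measurable_funD; [exact: measurable_cst|exact: measurable_funX].
move=> xi; have D0 : 0 < s ^+ 2 + xi ^+ 2 by rewrite ltr_pwDl ?sqr_ge0.
rewrite normrM -[leRHS]mulr1 ler_pM// ?cos_max// ger0_norm; last first.
  by rewrite divr_ge0 ?(ltW D0)// mulr_ge0 ?(ltW s0).
rewrite ler_pdivrMr// mulrAC ler_pdivlMr// -mulrA ler_wpM2l// -expr2.
by rewrite lerDl sqr_ge0.
Qed.

Let Rintegral_fW s : \int[mu]_x fW (x, s) =
  kappa^-1 * \int[mu]_xi (weight s / s * nf xi * b (s, xi)).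
Proof.
have [w0|w0] := eqVneq (weight s) 0.
  rewrite [LHS]Rintegral0_eq; last by move=> x; rewrite /fW/= w0 !mul0r.
  by rewrite [X in _ * X]Rintegral0_eq ?mulr0// => x; rewrite w0 !mul0r.
have s0 := weight_pos w0.
transitivity (weight s * \int[mu]_x (exp_abs s x * phi x)).
  rewrite -RintegralZl//.
    by apply: eq_Rintegral => x _; rewrite mulrA.
  apply: (@integrable_mul_bounded _ (exp_abs s) _ 1).
  - exact: integrable_exp_abs.
  - exact: measurable_normal_fun.
  - by move=> x; rewrite ger0_norm ?expR_ge0// normal_fun_le1.
apply: (mulfI kappa_neq0); rewrite (mulVKf kappa_neq0) mulrCA Rintegral_exp_abs_normal_fun//.
rewrite -RintegralZl//; last exact: integrable_nf_lorentz.
apply: eq_Rintegral => xi _; rewrite /b/=.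
have D0 : 0 < s ^+ 2 + xi ^+ 2 by rewrite ltr_pwDl ?sqr_ge0// exprn_gt0.
by field; rewrite !gt_eqF.
Qed.

Let Rintegral_b xi : xi != 0 -> \int[mu]_s (weight s / s * nf xi * b (s, xi)) =
  pi * whitham_symbol xi * (nf xi * cos (a * xi)).
Proof.
move=> xi0; have /(congr1 fine)/= W := weight_stieltjes xi0.
rewrite -W -RintegralZr//; last exact: integrable_weight_stieltjes.
apply: eq_Rintegral => s _; have [->|w0] := eqVneq (weight s) 0.
  by rewrite !mul0r.
have s0 := weight_pos w0; rewrite /b/=.
have D0 : 0 < s ^+ 2 + xi ^+ 2 by rewrite ltr_pwDl ?sqr_ge0// exprn_gt0.
by field; rewrite !gt_eqF.
Qed.

(** Two exchanges: x with s, to use the transform of each exponential, then s with xi, to use the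
    Stieltjes representation. *)
Lemma Rintegral_kernel_normal_fun :
  kappa * \int[mu]_x (kernel_of_weight x * phi x) =
  \int[mu]_xi (whitham_symbol xi * (nf xi * cos (a * xi))).
Proof.
have pi0 : (pi : R) != 0 by rewrite gt_eqF// pi_gt0.
under eq_Rintegral do rewrite kernel_normal_funE.
rewrite (RintegralZl _ measurableT (integrable_Rintegral integrable_fW)).
rewrite (Rintegral_Fubini integrable_fW).
under eq_Rintegral do rewrite Rintegral_fW.
rewrite (RintegralZl _ measurableT (integrable_Rintegral integrable_b)).
have isw := integrable_Rintegral (integrable_swap integrable_b).
rewrite (mulrCA pi^-1) (mulVKf kappa_neq0) (Rintegral_Fubini integrable_b).
rewrite -(RintegralZl _ measurableT isw).
apply: Rintegral_eq_off0.
- apply: measurable_funM; first exact: measurable_cst.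
  by apply/measurable_EFinP; exact: measurable_int isw.
- apply: measurable_funM; first exact: measurable_whitham_symbol.
  apply: measurable_funM; first exact: measurable_normal_fun.
  by apply: measurableT_comp; [exact: measurable_cos|exact: mulrl_measurable].
by move=> xi xi0; rewrite /= Rintegral_b// -mulrA mulKf.
Qed.

End TestIdentity.

(** * Gaussians as Schwartz functions *)

Section GaussianSchwartz.
Context {R : realType}.
Local Notation mu := (@lebesgue_measure R).
Variables (a sigma : R).
Hypothesis sigma0 : 0 < sigma.
Local Notation g := (normal_fun a sigma).

Lemma is_derive_horner_normal_fun (p : {poly R}) (x : R) :
  is_derive x 1 (fun x => p.[x] * g x)
    ((p^`() - (sigma ^- 2) *: (('X - a%:P) * p)).[x] * g x).
Proof.
have := is_derive_mul (is_derive_poly p x) (is_derive_normal_fun a sigma0 x).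
move=> /is_deriveW; apply.
rewrite hornerD hornerN hornerZ hornerM hornerXsubC.
by move: (p^`().[x]) (p.[x]) (g x) => A B C; field; rewrite gt_eqF.
Qed.

Lemma derive1n_normal_fun n : exists p : {poly R}, derive1n n g = (fun x => p.[x] * g x).
Proof.
elim: n => [|n [p IH]].
  by exists 1; apply/funext => x; rewrite hornerC mul1r.
exists (p^`() - (sigma ^- 2) *: (('X - a%:P) * p)).
rewrite derive1nS IH; apply/funext => x.
by have D := is_derive_horner_normal_fun p x; rewrite derive1E; exact: derive_val.
Qed.

Lemma horner_le_expR (p : {poly R}) :
  exists C k : R, 0 <= C /\ 0 <= k /\ forall x, `|p.[x]| <= C * expR (k * `|x|).
Proof.
elim/poly_ind: p => [|p c [C [k [C0 [k0 H]]]]].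
  by exists 0, 0; split=> //; split=> // x; rewrite horner0 normr0 mul0r.
exists (C + `|c|), (k + 1); split; first by rewrite addr_ge0.
split=> [|x]; first by rewrite addr_ge0.
rewrite hornerD hornerM hornerX hornerC (le_trans (ler_normD _ _))// normrM mulrDl.
apply: lerD.
  rewrite mulrDl mul1r expRD mulrA ler_pM//.
  by rewrite (le_trans _ (expR_ge1Dx _))// lerDr.
by rewrite ler_peMr// -expR0 ler_expR mulr_ge0// addr_ge0.
Qed.

(** After an exponential bound on p, completing the square gives k z - z^2 / (2 sigma^2) <= k^2
    sigma^2 / 2; hence the constant. *)
Lemma horner_normal_fun_bounded (p : {poly R}) : exists C, forall x, `|p.[x] * g x| <= C.
Proof.
have [C [k [C0 [k0 H]]]] := horner_le_expR p.
exists (C * expR (k * `|a| + k ^+ 2 * sigma ^+ 2 / 2)) => x.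
rewrite normrM (ger0_norm (expR_ge0 _)).
apply: (@le_trans _ _ (C * expR (k * `|x|) * g x)); first by rewrite ler_wpM2r ?expR_ge0.
rewrite -mulrA ler_wpM2l// /normal_fun -expRD ler_expR.
have xa : `|x| <= `|x - a| + `|a| by rewrite -{1}(subrK a x) ler_normD.
apply: (@le_trans _ _ (k * (`|x - a| + `|a|) + - (x - a) ^+ 2 / (sigma ^+ 2 *+ 2))).
  by rewrite lerD2r ler_wpM2l.
rewrite mulrDr addrAC addrC lerD2l -(real_normK (num_real (x - a))) -[_ *+ 2]mulr_natr.
have s2 : 0 < sigma ^+ 2 by rewrite exprn_gt0.
move: (`|x - a|) => z.
rewrite -subr_ge0 (_ : _ - _ = (z / sigma - k * sigma) ^+ 2 / 2).
  by rewrite divr_ge0// sqr_ge0.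
by field; rewrite gt_eqF.
Qed.

Lemma schwartz_normal_fun : schwartz g.
Proof.
split=> [n x _|k n].
  have [p ->] := derive1n_normal_fun n.
  by have := is_derive_horner_normal_fun p x.
have [p ->] := derive1n_normal_fun n.
have [C H] := horner_normal_fun_bounded ('X^k * p).
by exists C => x; have := H x; rewrite hornerM hornerXn mulrA.
Qed.

Lemma schwartz0 : schwartz (fun=> 0 : R).
Proof.
have H n : derive1n n (fun=> 0 : R) = (fun=> 0 : R).
  elim: n => [//|n IH]; rewrite derive1nS IH; apply/funext => x.
  by rewrite derive1_cst.
split=> [n x _|k n]; first by rewrite H; exact: derivable_cst.
by exists 0 => x; rewrite H mulr0 normr0.
Qed.

(** Read off from the Stieltjes representation, since 2 s / (s^2 + xi^2) <= 2 / s. *)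
Lemma whitham_symbol_bounded : exists B, forall xi : R, `|whitham_symbol xi| <= B.
Proof.
have iw := integrable_scale 2 (integrable_weight (R := R)).
exists (Num.max 1 (pi^-1 * \int[mu]_s (2 * (weight s / s)))) => xi.
have [->|xi0] := eqVneq xi 0; first by rewrite /whitham_symbol eqxx normr1 le_max lexx.
rewrite le_max; apply/orP; right.
have /(congr1 fine)/= W := weight_stieltjes xi0.
have p0 := @pi_gt0 R.
have m0 : 0 <= whitham_symbol xi by rewrite /whitham_symbol (negbTE xi0) sqrtr_ge0.
rewrite ger0_norm// ler_pdivlMl// -W; apply: le_Rintegral => //.
  exact: integrable_weight_stieltjes.
move=> s _; have [->|w0] := eqVneq (weight s) 0; first by rewrite !mul0r mulr0.
have s0 := weight_pos w0; have ss : 0 < s ^+ 2 by rewrite exprn_gt0.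
have D0 : 0 < s ^+ 2 + xi ^+ 2 by rewrite ltr_pwDl ?sqr_ge0.
rewrite [leRHS]mulrCA ler_wpM2l ?weight_ge0// ler_pdivrMr// mulrAC ler_pdivlMr//.
by rewrite -mulrA ler_wpM2l// -expr2 lerDl sqr_ge0.
Qed.

(** The distributional identity tested on a real Gaussian; its real part involves only cosine
    integrals, already computed for the candidate kernel. *)
Lemma whitham_kernel_normal_fun (K : R -> R) : whitham_kernel K ->
  mu.-integrable setT (EFin \o (fun x => K x * g x)) /\
  \int[mu]_x (K x * g x) = \int[mu]_x (kernel_of_weight x * g x).
Proof.
move=> [/(_ (fun x => Complex (g x) 0)) hK _].
have [|[iK _] /(congr1 (fun z => complex.Re z))] := hK.
  by split; [exact: schwartz_normal_fun|exact: schwartz0].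
have -> : (fun z => complex.Re z) (cintegral (fun x => real_complex R (K x) * Complex (g x) 0)) =
    \int[mu]_x complex.Re (real_complex R (K x) * Complex (g x) 0) by [].
have -> : (fun z => complex.Re z) (cintegral (fun xi => real_complex R (whitham_symbol xi) *
    inv_fourier (fun x => Complex (g x) 0) xi)) = \int[mu]_xi complex.Re
    (real_complex R (whitham_symbol xi) * inv_fourier (fun x => Complex (g x) 0) xi) by [].
move=> E.
have ReK x : complex.Re (real_complex R (K x) * Complex (g x) 0) = K x * g x.
  by rewrite /= mulr0 subr0.
have ReM xi : complex.Re (real_complex R (whitham_symbol xi) *
    inv_fourier (fun x => Complex (g x) 0) xi) =
    whitham_symbol xi * ((2 * pi)^-1 * \int[mu]_x (g x * cos (x * xi))).
  rewrite /inv_fourier /cintegral /= !mul0r !subr0; congr (_ * (_ * _)).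
  by apply: eq_Rintegral => x _; rewrite mul0r subr0.
split; first by move: iK; rewrite /comp; under eq_fun do rewrite ReK.
transitivity (\int[mu]_x complex.Re (real_complex R (K x) * Complex (g x) 0)).
  by apply: eq_Rintegral => x _; rewrite ReK.
rewrite {}E {ReK hK iK}.
transitivity (\int[mu]_xi
    (whitham_symbol xi * ((2 * pi)^-1 * \int[mu]_x (g x * cos (x * xi))))).
  by apply: eq_Rintegral => xi _; exact: ReM.
move=> {ReM}.
have s2 : 0 < sigma ^+ 2 by rewrite exprn_gt0.
have p0 := @pi_gt0 R.
pose kappa : R := Num.sqrt (sigma^-1 ^+ 2 * pi *+ 2).
have k0 : 0 < kappa.
  by rewrite sqrtr_gt0 mulrn_wgt0// mulr_gt0// exprn_gt0// invr_gt0.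
have is0 : 0 < sigma^-1 by rewrite invr_gt0.
have [B HB] := whitham_symbol_bounded.
have iM : mu.-integrable setT (EFin \o (fun xi =>
    whitham_symbol xi * (normal_fun 0 sigma^-1 xi * cos (a * xi)))).
  have -> : (fun xi => whitham_symbol xi * (normal_fun 0 sigma^-1 xi * cos (a * xi))) =
      (fun xi => normal_fun 0 sigma^-1 xi * (whitham_symbol xi * cos (a * xi))).
    by apply/funext => xi; rewrite mulrCA.
  apply: (@integrable_mul_bounded _ (normal_fun 0 sigma^-1) _ B).
  - exact: integrable_normal_fun.
  - apply: measurable_funM; first exact: measurable_whitham_symbol.
    by apply: measurableT_comp; [exact: measurable_cos|exact: mulrl_measurable].
  - by move=> xi; rewrite normrM -[leRHS]mulr1 ler_pM ?cos_max.
apply: (mulfI (lt0r_neq0 k0)); rewrite Rintegral_kernel_normal_fun//.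
rewrite -[RHS](mulVKf (lt0r_neq0 k0)) -(RintegralZl _ measurableT iM).
congr (_ * _); apply: eq_Rintegral => xi _; apply: (mulfI (lt0r_neq0 k0)).
rewrite (mulVKf (lt0r_neq0 k0)); have := normal_fun_cos a (xi * a) sigma0 xi.
  rewrite (_ : (fun y => _) = (fun x => g x * cos (x * xi))); last first.
    by apply/funext => y; congr (_ * cos _); ring.
  move=> ->; rewrite [LHS]mulrCA; congr (_ * _).
  have -> : normal_fun 0 sigma^-1 xi = expR (- (sigma ^+ 2 * xi ^+ 2 / 2)).
    by rewrite /normal_fun subr0 -[_ *+ 2]mulr_natr; congr expR; field; rewrite gt_eqF.
  rewrite (mulrC xi a).
  (* The normalisations of two Gaussians of inverse widths multiply to 2 pi, cancelling the
     prefactor of the inverse Fourier transform. *)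
  have : kappa * Num.sqrt (sigma ^+ 2 * pi *+ 2) = 2 * pi.
    rewrite /kappa -sqrtrM; last by rewrite mulrn_wge0// mulr_ge0 ?sqr_ge0// ltW.
    have -> : sigma^-1 ^+ 2 * pi *+ 2 * (sigma ^+ 2 * pi *+ 2) = (2 * pi) ^+ 2.
      by rewrite -(mulr_natl (sigma^-1 ^+ 2 * pi)) -(mulr_natl (sigma ^+ 2 * pi)); field; rewrite gt_eqF.
    by rewrite sqrtr_sqr gtr0_norm// mulr_gt0.
  move: (Num.sqrt (sigma ^+ 2 * pi *+ 2)) (cos (a * xi)) (expR _) => b C D kB.
  rewrite (_ : kappa * _ = (kappa * b) / (2 * pi) * (D * C)); last by ring.
  by rewrite kB mulfV ?mul1r// mulf_neq0// gt_eqF.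
Qed.

End GaussianSchwartz.

(** If the integral were 0, f would vanish off a null set, which would then contain an interval of
    positive length. *)
Lemma Rintegral_gt0 {R : realType} (f : R -> R) (c d : R) : c < d ->
  (@lebesgue_measure R).-integrable setT (EFin \o f) -> (forall x, 0 <= f x) ->
  (forall x, c < x < d -> 0 < f x) -> 0 < \int[@lebesgue_measure R]_x f x.
Proof.
move=> cd intf f0 fcd; rewrite lt_neqAle Rintegral_ge0// andbT.
apply/eqP => /esym fI.
have : (\int[@lebesgue_measure R]_x `|(EFin \o f) x| = 0)%E.
  under eq_integral do rewrite /= ger0_norm//.
  by rewrite -(fineK (integrable_fin_num measurableT intf)) -/(Rintegral _ _ _) fI.
move/(ae_eq_integral_abs _ measurableT (measurable_int _ intf)) => [N [mN N0 sub]].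
have : ((@lebesgue_measure R) `]c, d[ <= (@lebesgue_measure R) N)%E.
  apply: le_measure; rewrite ?inE//.
  apply: subset_trans sub => x /=; rewrite in_itv/= => /fcd fx /(_ I) /eqP.
  by rewrite eqe gt_eqF.
by rewrite N0 /= lebesgue_measure_itv/= lte_fin cd -EFinB lee_fin subr_le0 leNgt cd.
Qed.

(** * Laplace transforms of nonnegative densities *)

Section LaplaceTransform.
Context {R : realType}.
Local Notation mu := (@lebesgue_measure R).
Variable rho : R -> R.
Hypothesis measurable_rho : measurable_fun setT rho.
Hypothesis rho_ge0 : forall s, 0 <= rho s.
Hypothesis rho_supp : forall s, rho s != 0 -> 0 < s.
Hypothesis integrable_rho : mu.-integrable setT (fun s => (rho s / s)%:E).
Implicit Types (n : nat) (s x y : R).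

(** The n-th derivative of the Laplace transform up to the sign (-1)^n, which is left out to keep
    the integrand nonnegative. *)
Definition laplace n x : R := \int[mu]_s (s ^+ n * expR (- (s * x)) * rho s).

Let rho_div_ge0 s : 0 <= rho s / s.
Proof.
have [->|/rho_supp s0] := eqVneq (rho s) 0; first by rewrite mul0r.
by rewrite divr_ge0// ltW.
Qed.

Let integrand_ge0 n x s : 0 <= s ^+ n * expR (- (s * x)) * rho s.
Proof.
have [->|/rho_supp s0] := eqVneq (rho s) 0; first by rewrite mulr0.
by rewrite !mulr_ge0 ?expR_ge0 ?exprn_ge0 ?(ltW s0).
Qed.

(** From exp (s x) >= (s x)^(n+1) / (n+1)!. The extra power of s turns rho into the integrable rho s
    / s. *)
Let integrand_le n x y s : 0 < x -> x <= y ->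
  s ^+ n * expR (- (s * y)) * rho s <= n.+1`!%:R / x ^+ n.+1 * (rho s / s).
Proof.
move=> x0 xy; have [->|r0] := eqVneq (rho s) 0; first by rewrite mul0r !mulr0.
have s0 := rho_supp r0.
have -> : s ^+ n * expR (- (s * y)) * rho s = s ^+ n.+1 * expR (- (s * y)) * (rho s / s).
  by rewrite exprS; field; rewrite gt_eqF.
rewrite ler_wpM2r// expRN ler_pdivrMr ?expR_gt0// mulrAC ler_pdivlMr ?exprn_gt0//.
rewrite -exprMn -ler_pdivrMl ?ltr0n ?fact_gt0// mulrC.
have sx0 : 0 <= s * x by rewrite mulr_ge0// ltW.
apply: (@le_trans _ _ (expR (s * x))); last by rewrite ler_expR ler_pM2l.
by rewrite (le_trans _ (expR_ge1Dxn n sx0))// lerDr.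
Qed.

Let measurable_integrand n x :
  measurable_fun setT (fun s => s ^+ n * expR (- (s * x)) * rho s).
Proof.
apply: measurable_funM => //; apply: measurable_funM; first exact: measurable_funX.
by apply: measurableT_comp => //; apply: measurableT_comp => //; exact: mulrr_measurable.
Qed.

Lemma integrable_laplace n x : 0 < x ->
  mu.-integrable setT (EFin \o (fun s => s ^+ n * expR (- (s * x)) * rho s)).
Proof.
move=> x0; have := integrable_scale (n.+1`!%:R / x ^+ n.+1) integrable_rho.
apply: le_integrable => //; first by apply/measurable_EFinP; exact: measurable_integrand.
move=> s _; rewrite /= lee_fin (ger0_norm (integrand_ge0 n x s)) ger0_norm.
  exact: integrand_le.
by rewrite mulr_ge0// divr_ge0// exprn_ge0// ltW.
Qed.

Let derive_integrand n s x : is_derive x 1 (fun x => s ^+ n * expR (- (s * x)) * rho s)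
  (- (s ^+ n.+1 * expR (- (s * x)) * rho s)).
Proof.
have D := is_derive_comp (is_deriveN (is_derive_mulc s x)) (is_derive_expR _).
have := is_derive_mul (is_derive_mul (is_derive_cst (s ^+ n) x 1) D) (is_derive_cst (rho s) x 1).
by move=> /is_deriveW; apply; rewrite /cst exprS; ring.
Qed.

Lemma is_derive_laplace n x : 0 < x -> is_derive x 1 (laplace n) (- laplace n.+1 x).
Proof.
move=> x0; pose f (y s : R) := s ^+ n * expR (- (s * y)) * rho s.
have x20 : 0 < x / 2 by rewrite divr_gt0.
have pE y s : partial1of2 f y s = - (s ^+ n.+1 * expR (- (s * y)) * rho s).
  by rewrite partial1of2E; have D := derive_integrand n s y; exact: derive_val.
have Ix : `]x / 2, 2 * x[%classic x by rewrite /= in_itv/=; apply/andP; split; lra.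
have I0 y : `]x / 2, 2 * x[%classic y -> x / 2 < y by rewrite /= in_itv/= => /andP[].
have intf y : `]x / 2, 2 * x[%classic y -> mu.-integrable setT (EFin \o f y).
  by move=> /I0 xy; apply: integrable_laplace; exact: lt_trans xy.
have df y s : `]x / 2, 2 * x[%classic y -> setT s -> derivable (f ^~ s) y 1.
  by move=> _ _; have := derive_integrand n s y.
(* The majorant of the derivative, whose power of s is n.+1, valid for all arguments above x / 2. *)
pose G s := n.+2`!%:R / (x / 2) ^+ n.+2 * (rho s / s).
have G0 s : 0 <= G s by rewrite mulr_ge0// divr_ge0// exprn_ge0// ltW.
have Gb y s : `]x / 2, 2 * x[%classic y -> setT s -> `|partial1of2 f y s| <= G s.
  move=> /I0 /ltW xy _; rewrite pE normrN (ger0_norm (integrand_ge0 n.+1 y s)).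
  exact: integrand_le.
have iG : mu.-integrable setT (EFin \o G) by exact: integrable_scale integrable_rho.
apply: DeriveDef.
  exact: (derivable_under_integral measurableT Ix intf df G0 iG Gb).
rewrite -derive1E.
rewrite [LHS](differentiation_under_integral measurableT Ix intf df G0 iG Gb).
rewrite -mulN1r /laplace -RintegralZl//; last exact: integrable_laplace.
by apply: eq_Rintegral => s _; rewrite pE mulN1r.
Qed.

Lemma laplace_ge0 n x : 0 <= laplace n x.
Proof. by apply: Rintegral_ge0 => s _; exact: integrand_ge0. Qed.

Lemma le_laplace n x y : 0 < x -> x <= y -> laplace n y <= laplace n x.
Proof.
move=> x0 xy; apply: le_Rintegral => //.
- by apply: integrable_laplace; exact: lt_le_trans xy.
- exact: integrable_laplace.
move=> s _; have [->|/rho_supp s0] := eqVneq (rho s) 0; first by rewrite !mulr0.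
by rewrite ler_wpM2r// ler_wpM2l ?exprn_ge0 ?(ltW s0)// ler_expR lerN2 ler_pM2l.
Qed.

Lemma continuous_laplace n x : 0 < x -> {for x, continuous (laplace n)}.
Proof. by move=> x0; exact: is_derive_continuous (is_derive_laplace n x0). Qed.

Variables c d : R.
Hypothesis cd : c < d.
Hypothesis rho_gt0 : forall s, c < s < d -> 0 < rho s.

Let supp_gt0 s : c < s < d -> 0 < s.
Proof. by move=> /rho_gt0 r0; apply: rho_supp; rewrite gt_eqF. Qed.

(** The interval ]c, d[ on which rho is positive makes the inequality strict, here and in
    [lt_laplace]. *)
Lemma laplace_gt0 n x : 0 < x -> 0 < laplace n x.
Proof.
move=> x0; apply: (Rintegral_gt0 cd).
- exact: integrable_laplace.
- by move=> s; exact: integrand_ge0.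
move=> s sc; apply: mulr_gt0; last exact: rho_gt0.
by rewrite mulr_gt0 ?expR_gt0// exprn_gt0// supp_gt0.
Qed.

Lemma lt_laplace n x y : 0 < x -> x < y -> laplace n y < laplace n x.
Proof.
move=> x0 xy; have y0 := lt_trans x0 xy; rewrite -subr_gt0.
rewrite /laplace -RintegralB//; [|exact: integrable_laplace..].
apply: (Rintegral_gt0 cd).
- have -> : (fun s => s ^+ n * expR (- (s * x)) * rho s - s ^+ n * expR (- (s * y)) * rho s) =
    (fun s => s ^+ n * expR (- (s * x)) * rho s + -1 * (s ^+ n * expR (- (s * y)) * rho s)).
    by apply/funext => s; rewrite mulN1r.
  apply: integrable_add; first exact: integrable_laplace.
  by apply: integrable_scale; exact: integrable_laplace.
- move=> s; rewrite subr_ge0.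
  have [->|/rho_supp s0] := eqVneq (rho s) 0; first by rewrite !mulr0.
  by rewrite ler_wpM2r// ler_wpM2l ?exprn_ge0 ?(ltW s0)// ler_expR lerN2 ler_pM2l// ltW.
- move=> s sc; have s0 := supp_gt0 sc; rewrite subr_gt0 ltr_pM2r ?rho_gt0//.
  by rewrite ltr_pM2l ?exprn_gt0// ltr_expR ltrN2 ltr_pM2l.
Qed.

End LaplaceTransform.

(** * Identification of the kernel *)

Section Identification.
Context {R : realType}.
Local Notation mu := (@lebesgue_measure R).

(* If h a > 0, then as sigma tends to 0 the part of the integral near a, where
   h > h a / 2, dominates the exponentially smaller remaining part. *)
Lemma gaussian_tests_le0 (h : R -> R) (a : R) :
  (forall sigma, 0 < sigma -> mu.-integrable setT (EFin \o (fun x => h x * normal_fun a sigma x))) ->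
  (forall sigma, 0 < sigma -> \int[mu]_x (h x * normal_fun a sigma x) = 0) ->
  {for a, continuous h} -> h a <= 0.
Proof.
move=> ih h0 ch; rewrite leNgt; apply/negP => ha.
have ha2 : h a / 2 < h a by rewrite ltr_pdivrMr//; lra.
have [r /= r0 hr] : exists2 r : R, 0 < r & forall x, `|x - a| < r -> h a / 2 < h x.
  have : \forall x \near a, h a / 2 < h x by exact: (cvgr_gt (h a) ch).
  move=> /nbhs_ballP[r /= r0 hr]; exists r => // x xa; apply: hr.
  by rewrite /ball/= distrC.
set dl := h a / 2 in hr; have d0 : 0 < dl by rewrite divr_gt0.
(* The Gaussian with sigma = 1 serves as reference for the size of h far from a. *)
pose C := \int[mu]_x `|h x * normal_fun a 1 x|.
have iC : mu.-integrable setT (EFin \o (fun x => `|h x * normal_fun a 1 x|)).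
  by have := integrable_norm (ih 1 ltr01).
have C0 : 0 <= C by exact: Rintegral_ge0.
(* Large enough for dl r exp (3/4 r^2 L) > C exp (r^2 / 2), by exp y >= 1 + y. The width s below
   makes the Gaussian exp (- L (x - a)^2). *)
pose L := 1 + C * expR (2^-1 * r ^+ 2) / (dl * r) / (3 / 4 * r ^+ 2).
have r2 : 0 < r ^+ 2 by rewrite exprn_gt0.
have dr0 : 0 < dl * r by rewrite mulr_gt0.
have r34 : 0 < 3 / 4 * r ^+ 2 by rewrite mulr_gt0.
have L1 : 1 <= L by rewrite lerDl !divr_ge0 ?(ltW dr0) ?(ltW r34)// mulr_ge0 ?expR_ge0.
have L0 : 0 < L by exact: lt_le_trans L1.
pose s := Num.sqrt ((2 * L)^-1).
have s0 : 0 < s by rewrite sqrtr_gt0 invr_gt0 mulr_gt0.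
have gE x : normal_fun a s x = expR (- (L * (x - a) ^+ 2)).
  rewrite /normal_fun /s sqr_sqrtr ?invr_ge0 ?mulr_ge0 ?(ltW L0)// -[_ *+ 2]mulr_natr.
  by congr expR; field; rewrite gt_eqF.
have g1 x : normal_fun a 1 x = expR (- (2^-1 * (x - a) ^+ 2)).
  by rewrite /normal_fun expr1n; congr expR; field.
pose A : R := dl * expR (- (L * (r / 2) ^+ 2)).
pose B : R := expR (- ((L - 2^-1) * r ^+ 2)).
have A0 : 0 < A by rewrite mulr_gt0// expR_gt0.
have B0 : 0 < B by exact: expR_gt0.
pose J : set R := `](a - r / 2), (a + r / 2)[%classic.
have mJ : measurable J by exact: measurable_itv.
have iJ : mu.-integrable setT (EFin \o (\1_J : R -> R)).
  by have := @integrable_indic_itv R (a - r / 2) (a + r / 2) false true.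
have IJ : \int[mu]_x (\1_J x : R) = r.
  rewrite /Rintegral integral_indic// setIT /J/= lebesgue_measure_itv/= lte_fin ifT; last by lra.
  by rewrite -EFinB /=; field.
(* On J, h > dl and the Gaussian is at least its value at distance r / 2; between J and distance r,
   h is still positive; beyond r, the Gaussian is at most B times the reference one. *)
have pt x : A * \1_J x + (- B) * `|h x * normal_fun a 1 x| <= h x * normal_fun a s x.
  rewrite mulNr gE g1 normrM (ger0_norm (expR_ge0 _)).
  have [xr|xr] := ltP `|x - a| r.
    have hx := hr x xr.
    apply: (@le_trans _ _ (A * \1_J x)).
      by rewrite gerBl !mulr_ge0 ?expR_ge0// ltW.
    rewrite indicE; case: (boolP (_ \in _)) => [/set_mem|_]; last first.
      by rewrite mulr0 mulr_ge0 ?expR_ge0// (le_trans _ (ltW hx))// ltW.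
    rewrite /J/= in_itv/= => /andP[x1 x2]; rewrite mulr1 /A.
    rewrite ler_pM ?(ltW d0) ?expR_ge0 ?(ltW hx)// ler_expR lerN2 ler_pM2l//.
    by nra.
  have -> : \1_J x = 0 :> R.
    rewrite indicE memNset// /J/= in_itv/= => /andP[x1 x2].
    by move: xr; rewrite leNgt ltr_norml; move/negP; apply; apply/andP; split; lra.
  rewrite mulr0 sub0r; apply: (@le_trans _ _ (- (`|h x| * expR (- (L * (x - a) ^+ 2))))); last first.
    by rewrite -mulNr ler_wpM2r ?expR_ge0// lerNl -normrN ler_norm.
  rewrite lerN2 [leRHS]mulrCA ler_wpM2l// /B -expRD ler_expR.
  have : r ^+ 2 <= (x - a) ^+ 2.
    by rewrite -[leRHS](real_normK (num_real (x - a))) ler_sqr ?nnegrE// ltW.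
  by nra.
have : \int[mu]_x (A * \1_J x + (- B) * `|h x * normal_fun a 1 x|) <= 0.
  rewrite -(h0 s s0); apply: le_Rintegral => //; last exact: ih.
  by apply: integrable_add; exact: integrable_scale.
rewrite RintegralD//; [|exact: integrable_scale..].
rewrite !RintegralZl// IJ -/C mulNr subr_le0.
apply/negP; rewrite -ltNge /A /B.
have -> : expR (- ((L - 2^-1) * r ^+ 2)) =
    expR (- (L * (r / 2) ^+ 2)) * (expR (2^-1 * r ^+ 2) / expR (3 / 4 * r ^+ 2 * L)).
  by rewrite -expRN -!expRD; congr expR; field.
set E := expR (- (L * (r / 2) ^+ 2)); set F := expR (2^-1 * r ^+ 2).
set G := expR (3 / 4 * r ^+ 2 * L).
have -> : E * (F / G) * C = E * (C * F / G).
  by rewrite -mulrA; congr (_ * _); rewrite mulrC mulrA.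
have -> : dl * E * r = E * (dl * r) by rewrite mulrAC mulrC.
rewrite ltr_pM2l ?expR_gt0// ltr_pdivrMr ?expR_gt0// -ltr_pdivrMl// (mulrC _^-1).
apply: (@lt_le_trans _ _ (1 + 3 / 4 * r ^+ 2 * L)); last exact: expR_ge1Dx.
rewrite /L mulrDr mulr1 (mulrC (3 / 4 * r ^+ 2) (_ / _)) divfK ?gt_eqF//.
by rewrite -/F; lra.
Qed.

Lemma kernel_laplace (x : R) : kernel_of_weight x = pi^-1 * laplace weight 0 `|x|.
Proof.
rewrite /kernel_of_weight /laplace; congr (_ * _); apply: eq_Rintegral => s _.
by rewrite expr0 mul1r mulrC.
Qed.

Lemma continuous_kernel_of_weight (x : R) : x != 0 -> {for x, continuous kernel_of_weight}.
Proof.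
move=> x0; have -> : kernel_of_weight = (fun y : R => pi^-1 * laplace weight 0 `|y|).
  by apply/funext => y; exact: kernel_laplace.
apply: cvgM; first exact: cvg_cst.
apply: continuous_comp; first exact: norm_continuous.
apply: continuous_laplace; rewrite ?normr_gt0//.
- exact: measurable_weight.
- exact: weight_ge0.
- exact: weight_pos.
- exact: integrable_weight.
Qed.

(** Gaussians centred at a test the difference in both directions, and continuity at a turns each
    test into an inequality at a. *)
Lemma whitham_kernelE (K : R -> R) : whitham_kernel K ->
  forall x, x != 0 -> K x = kernel_of_weight x.
Proof.
move=> hK a a0.
have cK : {for a, continuous K} by exact: hK.2.
have ck := continuous_kernel_of_weight a0.
have iK (s : R) (s0 : 0 < s) := (whitham_kernel_normal_fun a s0 hK).1.
have ik (s : R) (s0 : 0 < s) := integrable_kernel_normal_fun a s.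
have H (f k : R -> R) :
    (forall s, 0 < s -> mu.-integrable setT (EFin \o (fun x => f x * normal_fun a s x))) ->
    (forall s, 0 < s -> mu.-integrable setT (EFin \o (fun x => k x * normal_fun a s x))) ->
    (forall s, 0 < s -> \int[mu]_x (f x * normal_fun a s x) = \int[mu]_x (k x * normal_fun a s x)) ->
    {for a, continuous f} -> {for a, continuous k} -> f a <= k a.
  move=> if_ ig fg cf cg; rewrite -subr_le0.
  apply: (@gaussian_tests_le0 (fun x => f x - k x)).
  - move=> s s0.
    have -> : (fun x => (f x - k x) * normal_fun a s x) =
       (fun x => f x * normal_fun a s x + (-1) * (k x * normal_fun a s x)).
      by apply/funext => x; ring.
    by apply: integrable_add; [exact: if_|apply: integrable_scale; exact: ig].
  - move=> s s0; under eq_Rintegral do rewrite mulrBl.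
    by rewrite RintegralB// ?fg ?subrr//; [exact: if_|exact: ig].
  - exact: cvgB.
apply/eqP; rewrite eq_le; apply/andP; split; apply: H => // s s0.
- exact: (whitham_kernel_normal_fun a s0 hK).2.
- by rewrite (whitham_kernel_normal_fun a s0 hK).2.
Qed.

End Identification.

Lemma cvg_nneseries {R : realType} (u : nat -> R) (l : R) :
  series u @ \oo --> l -> (\sum_(n <oo) (u n)%:E = l%:E)%E.
Proof.
move=> ul; apply: cvg_lim => //.
have -> : (fun n => (\sum_(0 <= k < n) (u k)%:E)%E) = EFin \o series u.
  by apply/funext => n /=; rewrite sumEFin.
by apply: cvg_EFin => //; exact: nearW.
Qed.

Lemma nneseries_cvg {R : realType} (u : nat -> R) (l : R) : (forall n, 0 <= u n) ->
  (\sum_(n <oo) (u n)%:E = l%:E)%E -> series u @ \oo --> l.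
Proof.
move=> u0 ul; have : (fun n => (\sum_(0 <= k < n) (u k)%:E)%E) @ \oo --> l%:E.
  by rewrite -ul; apply: is_cvg_nneseries => n _ _; rewrite lee_fin.
have -> : (fun n => (\sum_(0 <= k < n) (u k)%:E)%E) = EFin \o series u.
  by apply/funext => n /=; rewrite sumEFin.
by move/fine_cvg.
Qed.

(** * The periodised kernel *)

Section PeriodicWeight.
Context {R : realType}.
Local Notation mu := (@lebesgue_measure R).
Variable P : R.
Hypothesis P_gt0 : 0 < P.
Implicit Types s : R.

(* 1 / (1 - exp (-s P)) is the sum of the geometric series exp (-s n P), and the
   factor 1 / pi of the kernel is included. *)
Definition periodic_weight s : R := weight s / (pi * (1 - expR (- (s * P)))).

Lemma expRN_lt1 s : 0 < s -> expR (- (s * P)) < 1.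
Proof. by move=> s0; rewrite expR_lt1 oppr_lt0 mulr_gt0. Qed.

Lemma periodic_weight_ge0 s : 0 <= periodic_weight s.
Proof.
have [w0|/weight_pos s0] := eqVneq (weight s) 0; first by rewrite /periodic_weight w0 mul0r.
by rewrite divr_ge0 ?weight_ge0// mulr_ge0 ?pi_ge0// subr_ge0 ltW// expRN_lt1.
Qed.

Lemma periodic_weight_pos s : periodic_weight s != 0 -> 0 < s.
Proof. by rewrite mulf_eq0 negb_or => /andP[/weight_pos]. Qed.

Lemma measurable_periodic_weight : measurable_fun setT periodic_weight.
Proof.
apply: measurable_funM; first exact: measurable_weight.
apply: measurable_funV; apply: measurable_funM => //; apply: measurable_funB => //.
by apply: measurableT_comp => //; apply: measurableT_comp => //; exact: mulrr_measurable.
Qed.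

(** On the support s > pi / 2, so 1 - exp (- s P) is at least its value at pi / 2. *)
Lemma integrable_periodic_weight : mu.-integrable setT (fun s => (periodic_weight s / s)%:E).
Proof.
pose c : R := (pi * (1 - expR (- (pi / 2 * P))))^-1.
have := integrable_scale c integrable_weight.
apply: le_integrable => //.
  apply/measurable_EFinP; apply: measurable_funM; first exact: measurable_periodic_weight.
  exact: measurable_inv.
move=> s _ /=; rewrite lee_fin /periodic_weight.
have [->|w0] := eqVneq (weight s) 0; first by rewrite !mul0r mulr0.
have s0 := weight_pos w0; have ps := weight_neq0 w0.
have c0 : 0 < pi * (1 - expR (- (pi / 2 * P))).
  by rewrite mulr_gt0 ?pi_gt0// subr_gt0 expRN_lt1// divr_gt0// pi_gt0.
have d0 : 0 < pi * (1 - expR (- (s * P))) by rewrite mulr_gt0 ?pi_gt0// subr_gt0 expRN_lt1.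
have ws := weight_ge0 s.
rewrite !ger0_norm ?divr_ge0 ?mulr_ge0 ?invr_ge0 ?(ltW c0) ?(ltW d0) ?(ltW s0)//.
rewrite mulrAC (mulrC _ (_ / s)) ler_wpM2l ?divr_ge0 ?(ltW s0)//.
rewrite lef_pV2 ?posrE// ler_pM2l ?pi_gt0// lerD2l lerN2 ler_expR lerN2 ler_pM2r//.
- exact: ltW.
- exact: pi_ge0.
- by rewrite subr_ge0 ltW// expRN_lt1.
Qed.

(** The first branch is the interval of positivity behind all strict inequalities for the periodic
    kernel. *)
Lemma periodic_weight_gt0 s : pi / 2 < s < pi -> 0 < periodic_weight s.
Proof.
move=> sp; have s0 : 0 < s by case/andP: sp => + _; apply: lt_trans; rewrite divr_gt0 ?pi_gt0.
have sb : branch 0 s by rewrite /branch /= in_itv /= mulr0 add0r mul1r.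
apply: divr_gt0; last by rewrite mulr_gt0 ?pi_gt0// subr_gt0 expRN_lt1.
rewrite /weight indicE mem_set; last by exists 0%N.
rewrite mul1r sqrtr_gt0 divr_gt0// normr_gt0 lt_eqF//.
exact: (branch_tan_lt0 sb).
Qed.

Definition periodic_laplace := laplace periodic_weight.

End PeriodicWeight.

Lemma esum_int {R : realType} (a : int -> \bar R) : (forall n, (0 <= a n)%E) ->
  (\esum_(n in [set: int]) a n = \sum_(n <oo) a n%:Z + \sum_(n <oo) a (- n.+1%:Z)%R)%E.
Proof.
move=> a0; rewrite (esumID [set n : int | 0 <= n]) => [|n _//]; rewrite !setTI.
congr (_ + _)%E.
- rewrite [X in esum X _](_ : _ = [set n%:Z | n in (fun n : nat => xpredT n)]).
    by rewrite esum_pred_image// => m n _ _ [].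
  apply/seteqP; split => [[n|n]//= _|_ [n _ <-]//]; by exists n.
- rewrite [X in esum X _](_ : _ = [set (- n.+1%:Z)%R | n in (fun n : nat => xpredT n)]).
    by rewrite (esum_pred_image a (fun n : nat => (- n.+1%:Z)%R))// => m n _ _ /oppr_inj [].
  apply/seteqP; split => [[n|n]//= _|_ [n _ <-]//]; by exists n.
Qed.

Section KernelSum.
Context {R : realType}.
Local Notation mu := (@lebesgue_measure R).
Variable P : R.
Hypothesis P_gt0 : 0 < P.
Implicit Types (n : nat) (s x y : R).

Lemma kernel_of_weight_ge0 x : 0 <= kernel_of_weight x.
Proof.
rewrite kernel_laplace mulr_ge0 ?invr_ge0 ?pi_ge0//.
by apply: laplace_ge0; [exact: weight_ge0|exact: weight_pos].
Qed.

(** Sum and integral are exchanged by nonnegativity; for fixed s the series is geometric with ratio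
    exp (- s P). *)
Lemma nneseries_kernel y : 0 < y ->
  (\sum_(n <oo) (kernel_of_weight (y + n%:R * P))%:E = (periodic_laplace P 0 y)%:E)%E.
Proof.
move=> y0.
pose h n s : R := pi^-1 * (s ^+ 0 * expR (- (s * (y + n%:R * P))) * weight s).
have yn0 n : 0 < y + n%:R * P by rewrite ltr_pwDl// mulr_ge0// ltW.
have ih n : mu.-integrable setT (EFin \o h n).
  apply: integrable_scale; apply: integrable_laplace => //.
  - exact: measurable_weight.
  - exact: weight_ge0.
  - exact: weight_pos.
  - exact: integrable_weight.
have h0 n s : 0 <= h n s.
  rewrite mulr_ge0 ?invr_ge0 ?pi_ge0// mulr_ge0 ?weight_ge0//.
  by rewrite expr0 mul1r expR_ge0.
transitivity (\sum_(n <oo) \int[mu]_s (h n s)%:E)%E.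
  apply: eq_eseriesr => n _; rewrite kernel_laplace (gtr0_norm (yn0 n)) /laplace.
  rewrite -RintegralZl//; last first.
    apply: integrable_laplace => //.
    - exact: measurable_weight.
    - exact: weight_ge0.
    - exact: weight_pos.
    - exact: integrable_weight.
  by rewrite /Rintegral fineK//; apply: (integrable_fin_num _ (ih n)).
rewrite -integral_nneseries//; first last.
- by move=> n s _; rewrite lee_fin.
- by move=> n; have /integrableP[] := ih n.
rewrite /periodic_laplace /laplace /Rintegral fineK; last first.
  apply: integrable_fin_num => //; apply: integrable_laplace => //.
  - exact: measurable_periodic_weight.
  - exact: periodic_weight_ge0.
  - exact: periodic_weight_pos.
  - exact: integrable_periodic_weight.
apply: eq_integral => s _; apply: cvg_nneseries.
have [w0|w0] := eqVneq (weight s) 0.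
  rewrite /periodic_weight w0 mul0r mulr0.
  have -> : h^~ s = (fun=> 0) by apply/funext => n; rewrite /h w0 !mulr0.
  have -> : series (fun=> 0 : R) = (fun=> 0).
    by apply/funext => n; rewrite /series/= big1.
  exact: cvg_cst.
have s0 := weight_pos w0; have z1 := expRN_lt1 P_gt0 s0.
have -> : h^~ s = geometric (pi^-1 * (expR (- (s * y)) * weight s)) (expR (- (s * P))).
  apply/funext => n; rewrite /h/= expr0 mul1r -expRM_natl.
  have -> : - (s * (y + n%:R * P)) = - (s * y) + n%:R * - (s * P) by ring.
  by rewrite expRD; ring.
have -> : s ^+ 0 * expR (- (s * y)) * periodic_weight P s =
    pi^-1 * (expR (- (s * y)) * weight s) * (1 - expR (- (s * P)))^-1.
  by rewrite expr0 mul1r /periodic_weight invfM; ring.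
by apply: cvg_geometric_series; rewrite ger0_norm ?expR_ge0.
Qed.

End KernelSum.

Section PeriodisedKernel.
Context {R : realType}.
Variable P : R.
Hypothesis P_gt0 : 0 < P.
Implicit Types (n : nat) (x y : R) (j : int).

Definition cell j : set R := `]j%:~R * P, (j + 1)%:~R * P[%classic.

Lemma cell_off_lattice j x : cell j x -> off_lattice P x.
Proof.
rewrite /cell /= in_itv /= => /andP[jx xj] n; apply/eqP => xn; move: jx xj.
rewrite xn !ltr_pM2r// !ltr_int => *; lia.
Qed.

Lemma off_lattice_cell x : off_lattice P x -> cell (Num.floor (x / P)) x.
Proof.
move=> ox; rewrite /cell /= in_itv /= -(ltr_pdivlMr _ _ P_gt0) -(ltr_pdivrMr _ _ P_gt0).
rewrite floorD1_gt andbT lt_neqAle floor_le andbT; apply/eqP => e.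
by have /eqP := ox (Num.floor (x / P)); apply; rewrite e divfK// gt_eqF.
Qed.

Variable K : R -> R.
Hypothesis K_kernel : forall x, x != 0 -> K x = kernel_of_weight x.

Let K_ge0 x : x != 0 -> 0 <= K x.
Proof. by move=> x0; rewrite K_kernel// kernel_of_weight_ge0. Qed.

Let K_neg x : x != 0 -> K (- x) = K x.
Proof. move=> x0; have nx0 : - x != 0 by rewrite oppr_eq0.
by rewrite (K_kernel x0) (K_kernel nx0) (kernel_laplace x) (kernel_laplace (- x)) normrN. Qed.

Let KE n y : 0 < y -> K (y + n%:R * P) = kernel_of_weight (y + n%:R * P).
Proof. by move=> y0; rewrite K_kernel// gt_eqF// ltr_pwDl// mulr_ge0// ltW. Qed.

Lemma off_lattice_neq0 x j : off_lattice P x -> x + j%:~R * P != 0.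
Proof. by move=> ox; have := ox (- j); rewrite mulrNz mulNr addr_eq0. Qed.

(** After a shift of the index by j, nonnegative indices give the translates of x - j P. Negative
    ones give, by evenness, those of (j + 1) P - x. *)
Lemma esum_kernel j x : cell j x ->
  \esum_(n in [set: int]) (K (x + n%:~R * P))%:E =
  (periodic_laplace P 0 (x - j%:~R * P) + periodic_laplace P 0 ((j + 1)%:~R * P - x))%:E.
Proof.
move=> jx; have ox := cell_off_lattice jx.
have [a0 b0] : 0 < x - j%:~R * P /\ 0 < (j + 1)%:~R * P - x.
  by move: jx; rewrite /cell /= in_itv /= => /andP[]; rewrite !subr_gt0.
rewrite (@reindex_esum _ _ _ [set: int] _ (fun n : int => n - j)); last first.
  split => //; first by move=> m n _ _ /addIr.
  by move=> n _; exists (n + j) => //; rewrite addrK.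
have xE (n : int) : x + (n - j)%:~R * P = x - j%:~R * P + n%:~R * P.
  by rewrite intrB; ring.
have xE' n : x + (- n.+1%:Z - j)%:~R * P = - ((j + 1)%:~R * P - x + n%:R * P).
  by rewrite intrB intrN -[n.+1]addn1 PoszD !intrD; ring.
rewrite esum_int => [|n]; last by rewrite lee_fin K_ge0// off_lattice_neq0.
rewrite EFinD -!nneseries_kernel//; congr (_ + _)%E; apply: eq_eseriesr => n _.
- by rewrite xE KE.
- by rewrite xE' K_neg ?KE// gt_eqF// ltr_pwDl// mulr_ge0// ltW.
Qed.

Lemma summable_kernel x : off_lattice P x ->
  summable [set: int] (fun n : int => (K (x + n%:~R * P))%:E).
Proof.
move=> ox; rewrite /summable (eq_esum (b := fun n : int => (K (x + n%:~R * P))%:E)).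
  by rewrite (esum_kernel (off_lattice_cell ox)) ltry.
by move=> n _; rewrite /= ger0_norm// K_ge0// off_lattice_neq0.
Qed.

Lemma periodised_kernel j x : cell j x ->
  periodised K P x =
  periodic_laplace P 0 (x - j%:~R * P) + periodic_laplace P 0 ((j + 1)%:~R * P - x).
Proof.
move=> jx; have ox := cell_off_lattice jx; have := esum_kernel jx.
rewrite esum_int => [|n]; last by rewrite lee_fin K_ge0// off_lattice_neq0.
set a := (\sum_(n <oo) _)%E; set b := (\sum_(n <oo) _)%E => abE.
have a0 : (0 <= a)%E.
  by apply: nneseries_ge0 => n _ _; rewrite lee_fin K_ge0// off_lattice_neq0.
have b0 : (0 <= b)%E.
  by apply: nneseries_ge0 => n _ _; rewrite lee_fin K_ge0// off_lattice_neq0.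
have /andP[fa fb] : (a \is a fin_num) && (b \is a fin_num).
  by rewrite -fin_numD abE.
have cvga : series (fun n => K (x + n%:R * P)) @ \oo --> fine a.
  apply: nneseries_cvg => [n|]; first by rewrite K_ge0// (off_lattice_neq0 n%:Z).
  by rewrite fineK.
have cvgb : series (fun n => K (x - n.+1%:R * P)) @ \oo --> fine b.
  have e n : x - n.+1%:R * P = x + (- n.+1%:Z)%:~R * P by rewrite intrN mulNr.
  apply: nneseries_cvg => [n|]; first by rewrite e K_ge0// off_lattice_neq0.
  by rewrite fineK//; apply: eq_eseriesr => n _; rewrite e.
rewrite /periodised (cvg_lim _ cvga)// (cvg_lim _ cvgb)//.
by apply: EFin_inj; rewrite EFinD !fineK.
Qed.

End PeriodisedKernel.

Section PeriodicFormula.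
Context {R : realType}.
Local Notation mu := (@lebesgue_measure R).
Variable P : R.
Hypothesis P_gt0 : 0 < P.
Implicit Types (n k : nat) (s x : R).

Let density x s : R :=
  (expR (- (s * x)) + expR (- (s * (P - x)))) * periodic_weight P s.

(** Numerator and denominator multiplied by exp (- s P / 2). *)
Lemma cosh_div_sinhE s x : 0 < s ->
  cosh (s * (x - P / 2)) / sinh (P / 2 * s) =
  (expR (- (s * x)) + expR (- (s * (P - x)))) / (1 - expR (- (s * P))).
Proof.
move=> s0; have e1 := expRN_lt1 P_gt0 s0; rewrite /cosh /sinh.
set a := expR (P / 2 * s); have a0 : 0 < a by exact: expR_gt0.
set b := expR (s * (x - P / 2)); have b0 : 0 < b by exact: expR_gt0.
have hP : expR (- (s * P)) = (a * a)^-1.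
  by rewrite /a -expRD -expRN; congr expR; field.
have hx : expR (- (s * x)) = (a * b)^-1.
  by rewrite /a /b -expRD -expRN; congr expR; field.
have hPx : expR (- (s * (P - x))) = b / a.
  by rewrite /a /b -expRN -expRD; congr expR; field.
rewrite hP hx hPx !expRN -/a -/b.
have aa : 1 < a * a.
  by move: e1; rewrite hP invf_lt1// mulr_gt0.
by field; rewrite !gt_eqF//; lra.
Qed.

Lemma periodic_integrandE k s x : branch k s ->
  cosh (s * (x - P / 2)) / sinh (P / 2 * s) * Num.sqrt (`|tan s| / s) =
  pi * density x s.
Proof.
move=> ks; have s0 := branch_gt0 ks; have e1 := expRN_lt1 P_gt0 s0.
rewrite cosh_div_sinhE// /density /periodic_weight /weight indicE mem_set; last by exists k.
have d0 : 1 - expR (- (s * P)) != 0 by rewrite subr_eq0 gt_eqF.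
have p0 : pi != 0 :> R by rewrite gt_eqF ?pi_gt0.
by rewrite mul1r; move: (@pi R) p0 => p p0; field; apply/andP.
Qed.

Let integrable_expR x : 0 < x ->
  mu.-integrable setT (EFin \o (fun s => s ^+ 0 * expR (- (s * x)) * periodic_weight P s)).
Proof.
move=> x0; apply: integrable_laplace => //.
- exact: measurable_periodic_weight.
- exact: periodic_weight_ge0.
- exact: periodic_weight_pos.
- exact: integrable_periodic_weight.
Qed.

Let densityE x s : density x s =
  s ^+ 0 * expR (- (s * x)) * periodic_weight P s +
  s ^+ 0 * expR (- (s * (P - x))) * periodic_weight P s.
Proof. by rewrite /density mulrDl expr0 !mul1r. Qed.

Let integrable_density x : 0 < x -> x < P -> mu.-integrable setT (EFin \o density x).
Proof.
move=> x0 xP; have -> : density x = (fun s =>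
  s ^+ 0 * expR (- (s * x)) * periodic_weight P s +
  s ^+ 0 * expR (- (s * (P - x))) * periodic_weight P s).
  by apply/funext => s; exact: densityE.
by apply: integrable_add; apply: integrable_expR; rewrite ?subr_gt0.
Qed.

Let density_ge0 x s : 0 <= density x s.
Proof. by rewrite mulr_ge0 ?addr_ge0 ?expR_ge0 ?periodic_weight_ge0. Qed.

Let integrand_ge0 x s :
  0 <= cosh (s * (x - P / 2)) / sinh (P / 2 * s) * Num.sqrt (`|tan s| / s).
Proof.
have [s0|s0] := ltP 0 s.
  rewrite mulr_ge0 ?sqrtr_ge0// divr_ge0 ?(ltW (cosh_gt0 _))// ltW// sinh_gt0//.
  by rewrite mulr_gt0 ?divr_gt0.
by rewrite (ler0_sqrtr (_ : `|tan s| / s <= 0)) ?mulr0// mulr_ge0_le0// invr_le0.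
Qed.

(** The density vanishes off the disjoint branches, so its integral over the line is the sum over
    the branches. *)
Lemma periodic_formula x : 0 < x -> x < P ->
  ((periodic_laplace P 0 x + periodic_laplace P 0 (P - x))%:E =
   (pi^-1)%:E * \sum_(1 <= n <oo)
     \int[mu]_(s in `[((2 * n%:R - 1) * pi / 2)%R, (n%:R * pi)%R]%classic)
       (cosh (s * (x - P / 2)) / sinh (P / 2 * s) * Num.sqrt (`|tan s| / s))%:E)%E.
Proof.
move=> x0 xP; have pi0 := @pi_gt0 R.
have id0 := integrable_density x0 xP.
have mh : measurable_fun setT (fun s => (pi * density x s)%:E).
  by apply/measurable_EFinP; apply: measurable_funM => //; have /integrableP[/measurable_EFinP] := id0.
rewrite -nneseries_addn => [|n]; last by apply: integral_ge0 => s _; rewrite lee_fin.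
transitivity ((pi^-1)%:E * \sum_(k <oo) \int[mu]_(s in branch k) (pi * density x s)%:E)%E; last first.
  congr (_ * _)%E; apply: eq_eseriesr => k _; rewrite addn1.
  have -> : (2 * k.+1%:R - 1) * pi / 2 = (2 * k%:R + 1) * pi / 2 :> R.
    by rewrite -(natr1 k); field.
  (* The stated intervals are closed and the branches open; the endpoints, one of them a pole of
     tan, form a null set. *)
  symmetry; rewrite integral_itv_bndoo.
    by apply: eq_integral => s /set_mem ks; rewrite (periodic_integrandE _ ks).
  apply: (eq_measurable_fun (fun s => (pi * density x s)%:E)).
    by move=> s /set_mem ks; rewrite (periodic_integrandE _ ks).
  exact: measurable_funTS.
rewrite -ge0_integral_bigcup; first last.
- by apply/trivIsetP => i j _ _; apply: contra_neq_eq => /set0P[s [si sj]]; exact: branch_inj si sj.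
- by move=> s _; rewrite lee_fin mulr_ge0// ltW.
- exact: measurable_funTS.
- exact: measurable_branch.
rewrite integral_mkcond.
transitivity ((pi^-1)%:E * \int[mu]_s (pi%:E * (density x s)%:E))%E; last first.
  congr (_ * _)%E; apply: eq_integral => s _; rewrite /patch; case: ifPn => [_|/negP sb].
    by rewrite EFinM.
  rewrite /density /periodic_weight /weight indicE memNset; last first.
    by move=> bs; apply: sb; exact: mem_set.
  by rewrite !mul0r mulr0 mule0.
rewrite ge0_integralZl_EFin//; first last.
- exact: ltW.
- by have /integrableP[] := id0.
- by move=> s _; rewrite lee_fin.
rewrite muleA -EFinM mulVf ?gt_eqF// mul1e.
rewrite -(fineK (integrable_fin_num measurableT id0)) -/(Rintegral _ _ _); congr EFin.
rewrite /periodic_laplace /laplace -RintegralD//; first last.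
- by apply: integrable_expR; rewrite subr_gt0.
- exact: integrable_expR.
by apply: eq_Rintegral => s _; symmetry; exact: densityE.
Qed.

End PeriodicFormula.

(** [derive1n] differentiates a total function known only on D. As D is open, agreement on D is
    agreement near each point, and the induction carries value and derivative together. *)
Lemma derive1n_open {R : realType} (D : set R) (f : R -> R) (g : nat -> R -> R) :
  open D -> (forall x, D x -> f x = g 0%N x) ->
  (forall n x, D x -> is_derive x 1 (g n) (g n.+1 x)) ->
  forall n x, D x -> derive1n n f x = g n x /\ is_derive x 1 (derive1n n f) (g n.+1 x).
Proof.
move=> oD fg dg; elim=> [|n IH] x Dx; last first.
  have E : forall y, D y -> derive1n n.+1 f y = g n.+1 y.
    by move=> y /IH[_ Dy]; rewrite derive1nS derive1E; exact: derive_val.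
  split; first exact: E.
  apply: near_eq_is_derive (dg n.+1 x Dx); near=> y; apply/esym/E; near: y.
  exact: open_nbhs_nbhs.
split; first exact: fg.
apply: near_eq_is_derive (dg 0%N x Dx); near=> y; apply/esym/fg; near: y.
exact: open_nbhs_nbhs.
Unshelve. all: by end_near. Qed.

(** * Smoothness, monotonicity and convexity of the periodised kernel *)

Section PeriodisedDerivatives.
Context {R : realType}.
Variable P : R.
Hypothesis P_gt0 : 0 < P.
Implicit Types (n : nat) (s x y : R) (j : int).
Local Notation F := (periodic_laplace P).

Let is_derive_F n x : 0 < x -> is_derive x 1 (F n) (- F n.+1 x).
Proof.
move=> x0; apply: is_derive_laplace => //.
- exact: measurable_periodic_weight.
- exact: periodic_weight_ge0.
- exact: periodic_weight_pos.
- exact: integrable_periodic_weight.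
Qed.

Lemma le_periodic_laplace n x y : 0 < x -> x <= y -> F n y <= F n x.
Proof.
move=> x0 xy; apply: le_laplace => //.
- exact: measurable_periodic_weight.
- exact: periodic_weight_ge0.
- exact: periodic_weight_pos.
- exact: integrable_periodic_weight.
Qed.

Lemma lt_periodic_laplace n x y : 0 < x -> x < y -> F n y < F n x.
Proof.
move=> x0 xy; have lt_pi : pi / 2 < pi :> R by have := @pi_gt0 R; lra.
apply: (lt_laplace _ _ _ _ lt_pi) => //.
- exact: measurable_periodic_weight.
- exact: periodic_weight_ge0.
- exact: periodic_weight_pos.
- exact: integrable_periodic_weight.
- exact: periodic_weight_gt0.
Qed.

Lemma periodic_laplace_gt0 n x : 0 < x -> 0 < F n x.
Proof.
move=> x0; have lt_pi : pi / 2 < pi :> R by have := @pi_gt0 R; lra.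
apply: (laplace_gt0 _ _ _ _ lt_pi) => //.
- exact: measurable_periodic_weight.
- exact: periodic_weight_ge0.
- exact: periodic_weight_pos.
- exact: integrable_periodic_weight.
- exact: periodic_weight_gt0.
Qed.

Let conv_gt0 (t : {i01 R}) x y : 0 < x -> 0 < y -> 0 < t%:num * x + (1 - t%:num) * y.
Proof.
move=> x0 y0; have [t0|t0] := eqVneq (t%:num : R) 0.
  by rewrite t0 mul0r add0r subr0 mul1r.
apply: ltr_pwDl; first by rewrite mulr_gt0// lt0r t0 /=.
by apply: mulr_ge0; [rewrite subr_ge0|exact: ltW].
Qed.

(** Convexity of the exponential, integrated against a nonnegative weight. *)
Lemma convex_periodic_laplace (t : {i01 R}) x y : 0 < x -> 0 < y ->
  F 0 (t%:num * x + (1 - t%:num) * y) <= t%:num * F 0 x + (1 - t%:num) * F 0 y.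
Proof.
move=> x0 y0.
have iF (z : R) : 0 < z -> (@lebesgue_measure R).-integrable setT
    (EFin \o (fun s => s ^+ 0 * expR (- (s * z)) * periodic_weight P s)).
  move=> z0; apply: integrable_laplace => //.
  - exact: measurable_periodic_weight.
  - exact: periodic_weight_ge0.
  - exact: periodic_weight_pos.
  - exact: integrable_periodic_weight.
rewrite /periodic_laplace /laplace -!RintegralZl//; [|exact: iF..].
rewrite -RintegralD//; [|by apply: integrable_scale; exact: iF..].
apply: le_Rintegral => //; first exact/iF/conv_gt0.
  by apply: integrable_add; apply: integrable_scale; exact: iF.
move=> s _; have w0 := periodic_weight_ge0 P_gt0 s; move: (periodic_weight P s) w0 => w w0.
rewrite !expr0 !mul1r !mulrA -mulrDl ler_wpM2r//.
have := convex_expR t (- (s * x)) (- (s * y)); rewrite !convRE; apply: le_trans.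
by rewrite ler_expR /unstable.onem; rewrite le_eqVlt; apply/orP; left; apply/eqP; ring.
Qed.

(** In the second term the reflection of the argument contributes another (-1)^n, cancelling the
    sign of the Laplace derivative. *)
Definition cell_derivative j n x : R :=
  (-1) ^+ n * F n (x - j%:~R * P) + F n ((j + 1)%:~R * P - x).

Lemma is_derive_cell j n x : cell P j x ->
  is_derive x 1 (cell_derivative j n) (cell_derivative j n.+1 x).
Proof.
rewrite /cell /= in_itv /= => /andP[jx xj].
have a0 : 0 < x - j%:~R * P by rewrite subr_gt0.
have b0 : 0 < (j + 1)%:~R * P - x by rewrite subr_gt0.
have dl := is_derive_sub (is_derive_id x 1) (is_derive_cst (j%:~R * P) x 1).
have dr := is_derive_sub (is_derive_cst ((j + 1)%:~R * P) x 1) (is_derive_id x 1).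
have Da := is_derive_comp dl (is_derive_F n a0).
have Db := is_derive_comp dr (is_derive_F n b0).
have := is_derive_add (is_derive_mul (is_derive_cst ((-1) ^+ n : R) x 1) Da) Db.
move=> /is_deriveW; apply; rewrite /cell_derivative /cst exprS.
by move: (F n.+1 _) (F n.+1 _) (F n _) ((-1) ^+ n) => u v w z; ring.
Qed.

Variable K : R -> R.
Hypothesis K_kernel : forall x, x != 0 -> K x = kernel_of_weight x.

Lemma derive1n_periodised j n x : cell P j x ->
  derive1n n (periodised K P) x = cell_derivative j n x /\
  is_derive x 1 (derive1n n (periodised K P)) (cell_derivative j n.+1 x).
Proof.
apply: derive1n_open; first exact: interval_open.
- by move=> y jy; rewrite (periodised_kernel P_gt0 K_kernel jy) /cell_derivative expr0 mul1r.
- by move=> m y; exact: is_derive_cell.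
Qed.

Lemma cell0 x : cell P 0 x = (0 < x < P).
Proof. by rewrite /cell /= in_itv /= mul0r add0r mul1r. Qed.

Lemma cell_derivative0 n x : cell_derivative 0 n x = (-1) ^+ n * F n x + F n (P - x).
Proof. by rewrite /cell_derivative mul0r subr0 add0r mul1r. Qed.

Lemma smooth_periodised : smooth_on (off_lattice P) (periodised K P).
Proof. by move=> n x /(off_lattice_cell P_gt0) jx; have [_] := derive1n_periodised n jx. Qed.

Lemma completely_monotone_periodised :
  completely_monotone `]0, (P / 2)[%classic (periodised K P).
Proof.
have sub x : `]0, (P / 2)[%classic x -> [/\ 0 < x, x < P - x & cell P 0 x].
  by rewrite /= in_itv/= => /andP[x0 xP]; split => //; rewrite ?cell0; lra.
split=> n x /sub[x0 xP cx]; first by have [_] := derive1n_periodised n cx.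
have [-> _] := derive1n_periodised n cx.
(* What remains is F n x + (-1)^n F n (P - x), nonnegative even for odd n because F n decreases and
   x < P - x. *)
rewrite cell_derivative0 mulrDr mulrA -exprD addnn -mul2n exprM sqrrN !expr1n mul1r.
have := le_periodic_laplace n x0 (ltW xP).
have : 0 < F n (P - x) by rewrite periodic_laplace_gt0// (lt_trans x0).
move: (F n x) (F n (P - x)) => u v v0 vu.
by rewrite -signr_odd; case: odd; rewrite ?expr0 ?expr1; lra.
Qed.

Lemma periodised_gt0 x : off_lattice P x -> 0 < periodised K P x.
Proof.
move=> /(off_lattice_cell P_gt0) jx; rewrite (periodised_kernel P_gt0 K_kernel jx).
move: jx; rewrite /cell /= in_itv /= => /andP[jx xj].
by rewrite addr_gt0// periodic_laplace_gt0// subr_gt0.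
Qed.

(** The derivative is F 1 (P - x) - F 1 x, negative because F 1 is strictly decreasing and x < P -
    x. *)
Lemma lt_periodised x y : 0 < x -> x < y -> y < P / 2 -> periodised K P y < periodised K P x.
Proof.
move=> x0 xy yP.
have cell_lt z : z \in `]0, P / 2[ -> [/\ 0 < z, z < P - z & cell P 0 z].
  by rewrite in_itv/= => /andP[z0 zP]; split => //; rewrite ?cell0; lra.
apply: (@ltr0_derive1_lt_oo _ (periodised K P) 0 (P / 2)) => //.
- by move=> z /cell_lt[_ _ cz]; have [_] := derive1n_periodised 0 cz.
- move=> z /cell_lt[z0 zP cz]; have [e _] := derive1n_periodised 1 cz.
  rewrite -[X in X < 0]/(derive1n 1 (periodised K P) z) e.
  by rewrite cell_derivative0 expr1 mulN1r addrC subr_lt0 lt_periodic_laplace.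
- move=> z /set_mem/cell_lt[_ _ cz].
  by have [_] := derive1n_periodised 0 cz; exact: is_derive_continuous.
- by rewrite in_itv/=; apply/andP; split; lra.
- by rewrite in_itv/=; apply/andP; split; lra.
Qed.

(** Both F 0 x and F 0 (P - x) are convex on the whole period, the second because P - x is
    affine. *)
Lemma convex_periodised : convex_function (`]0, P[%classic : set R) (periodised K P).
Proof.
move=> t x y /set_mem/=; rewrite in_itv/= => /andP[x0 xP] /set_mem/=.
rewrite in_itv/= => /andP[y0 yP].
have E (z : R) : 0 < z -> z < P -> periodised K P z = F 0 z + F 0 (P - z).
  move=> z0 zP; have cz : cell P 0 z by rewrite cell0 z0.
  by rewrite (periodised_kernel P_gt0 K_kernel cz) mul0r subr0 add0r mul1r.
rewrite !convRE /unstable.onem.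
have c0 := conv_gt0 t x0 y0.
have cP : 0 < t%:num * (P - x) + (1 - t%:num) * (P - y) by rewrite conv_gt0 ?subr_gt0.
have cE : P - (t%:num * x + (1 - t%:num) * y) =
    t%:num * (P - x) + (1 - t%:num) * (P - y) by ring.
have Px : 0 < P - x by rewrite subr_gt0.
have Py : 0 < P - y by rewrite subr_gt0.
have cP' : t%:num * x + (1 - t%:num) * y < P by rewrite -subr_gt0 cE.
rewrite (E _ x0 xP) (E _ y0 yP) (E _ c0 cP') cE.
apply: (le_trans (lerD (convex_periodic_laplace t x0 y0) (convex_periodic_laplace t Px Py))).
move: (F 0 x) (F 0 y) (F 0 (P - x)) (F 0 (P - y)) => a b c d.
by rewrite le_eqVlt; apply/orP; left; apply/eqP; ring.
Qed.

End PeriodisedDerivatives.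

Theorem corollary3p3 (R : realType) (K : R -> R) (P : R)
    (hK : whitham_kernel K) (hP : 0 < P) :
  (forall x : R, off_lattice P x ->
    summable [set: int] (fun n : int => (K (x + n%:~R * P))%:E) /\
    ((periodised K P x)%:E =
      (pi^-1)%:E *
      \sum_(1 <= n <oo)
        \int[@lebesgue_measure R]_(s in
            `[((2 * n%:R - 1) * pi / 2)%R, (n%:R * pi)%R]%classic)
          (cosh (s * (x - P / 2 - P * (Num.floor (x / P))%:~R))
            / sinh (P / 2 * s) * Num.sqrt (`|tan s| / s))%:E)%E) /\
  smooth_on (off_lattice P) (periodised K P) /\
  completely_monotone `]0, (P / 2)[%classic (periodised K P) /\
  (forall x : R, off_lattice P x -> 0 < periodised K P x) /\
  (forall x y : R, 0 < x -> x < y -> y < P / 2 ->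
    periodised K P y < periodised K P x) /\
  convex_function (`]0, P[%classic : set R) (periodised K P).
Proof.
have hKE := whitham_kernelE hK; split.
  move=> x ox; split; first exact: summable_kernel.
  have cx := off_lattice_cell hP ox; rewrite (periodised_kernel hP hKE cx).
  move: cx; rewrite /cell /=; set j := Num.floor _.
  rewrite in_itv /= intrD mulrDl mul1r => /andP[jx xj].
  (* Subtracting j P moves x into (0, P), where [periodic_formula] applies. *)
  have -> : x - P / 2 - P * j%:~R = x - j%:~R * P - P / 2 by ring.
  have -> : j%:~R * P + P - x = P - (x - j%:~R * P) by ring.
  by apply: periodic_formula => //; rewrite ?subr_gt0// ltrBlDl.
split; first exact: smooth_periodised.
split; first exact: completely_monotone_periodised.
split; first exact: periodised_gt0.
split; first exact: lt_periodised.
exact: convex_periodised.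
Qed.
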